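(* Let $\mathbf{k}$ be an algebraically closed field of characteristic zero, and let $\Delta$ and $\Delta'$ be fully exposed simplicial complexes on finite vertex sets. If there is an isomorphism of ind-groups $\operatorname{Aut}(X_\Delta)\cong\operatorname{Aut}(X_{\Delta'})$, then $\Delta\cong\Delta'$ as abstract simplicial complexes, and hence $X_\Delta\cong X_{\Delta'}$ as algebraic varieties.
   Context: $\mathbf{k}$ is an algebraically closed field of characteristic zero. For $n\ge 1$, $[n]=\{1,\dots,n\}$. A simplicial complex $\Delta$ on $[n]$ is a collection of subsets of $[n]$ (faces) closed under taking subsets; it is always assumed that $\{i\}\in\Delta$ for every $i\in[n]$. Facets are the inclusion-maximal faces; $\mathcal F(\Delta)$ is the set of facets, and for $\sigma\subseteq[n]$, $\mathcal F_\sigma(\Delta)=\{F\in\mathcal F(\Delta):\sigma\subseteq F\}$. (The same notions are used for any finite vertex set.) Closure and exposure: for a face $S$, $\operatorname{cl}(S)=\bigcap_{F\in\mathcal F_S(\Delta)}F$. For $i\in[n]$, $\mathcal A_i(\Delta)=\{S\subseteq[n]\setminus\{i\}: S\in\Delta,\ i\in\operatorname{cl}(S)\}$. A facet $F$ is exposed if there exist $i\in[n]$ and $S\in\mathcal A_i(\Delta)$ with $S\subseteq F$. $\Delta$ is fully exposed if every facet is exposed. Stanley-Reisner variety: $\mathbf k[\Delta]=\mathbf k[x_1,\dots,x_n]/I_\Delta$ with $I_\Delta=(\prod_{i\in\sigma}x_i:\sigma\subseteq[n],\sigma\notin\Delta)$, $X_\Delta=\operatorname{Spec}\mathbf k[\Delta]$,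 and $\overline{x}_i$ is the class of $x_i$. Ind-varieties and ind-groups: an ind-variety is a set $\mathcal V$ with an ascending filtration $\mathcal V_0\subseteq\mathcal V_1\subseteq\cdots$ with union $\mathcal V$, each $\mathcal V_k$ an algebraic variety (not necessarily irreducible) and each inclusion a closed immersion. A morphism $\varphi:\mathcal V\to\mathcal W$ is a map such that for each $k$ there is $\ell$ with $\varphi(\mathcal V_k)\subseteq\mathcal W_\ell$ and $\varphi|_{\mathcal V_k}:\mathcal V_k\to\mathcal W_\ell$ a morphism of varieties. An ind-group is a group with an ind-variety structure for which multiplication and inversion are morphisms. An isomorphism of ind-groups is a group isomorphism that is also an isomorphism of ind-varieties. Ind-group structure on $\operatorname{Aut}(X_\Delta)=\operatorname{Aut}_{\mathbf k}(\mathbf k[\Delta])$: with $A=\mathbf k[\Delta]$ and $A_{\le d}$ the finite-dimensional span of monomials of total degree $\le d$, endomorphisms of $A$ are identified with tuples of images of $\overline{x}_1,\dots,\overline{x}_n$, so that endomorphisms sending every $\overline x_l$ to degree $\le d$ form a closed subvariety of $(A_{\le d})^n$. An automorphism $\varphi$ is identified with the pair $(\varphi,\varphi^{-1})$, and the $d$-th filtration piece consists of the pairs for which $\varphi$ and $\varphi^{-1}$ both send every $\overline{x}_l$ to an element of degree at most $d$. *)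

(* Defs.v *)
From HB Require Import structures.
From mathcomp Require Import all_boot all_order all_algebra.
From mathcomp Require Import mpoly.
From mathcomp Require Import boolp.

Set Implicit Arguments.
Unset Strict Implicit.
Unset Printing Implicit Defensive.

Import GRing.Theory.
Local Open Scope ring_scope.
Local Open Scope quotient_scope.

Record complex (V : finType) := Complex {
  faces : {set {set V}};
  face_subset : forall S T : {set V}, T \in faces -> S \subset T -> S \in faces;
  face_vertex : forall v : V, [set v] \in faces;
  (* follows from the two previous fields when [V] is nonempty *)
  face_empty : set0 \in faces
}.

Section Exposure.
Variables (V : finType) (D : complex V).

Definition facets : {set {set V}} :=
  [set F | maxset [pred S : {set V} | S \in faces D] F].

Definition facets_over (S : {set V}) : {set {set V}} :=
  [set F in facets | S \subset F].

Definition cl (S : {set V}) : {set V} := \bigcap_(F in facets_over S) F.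

Definition exposing (v : V) : {set {set V}} :=
  [set S in faces D | (v \notin S) && (v \in cl S)].

Definition exposed (F : {set V}) : Prop :=
  exists v, exists2 S, S \in exposing v & S \subset F.

Definition fully_exposed : Prop := forall F, F \in facets -> exposed F.

End Exposure.

Definition complex_isomorphic (V V' : finType) (D : complex V) (D' : complex V')
    : Prop :=
  exists2 f : V -> V', bijective f &
    forall S : {set V}, (f @: S \in faces D') = (S \in faces D).

(* Polynomials in variables indexed by [V] are encoded as [{mpoly K[#|V|]}], the
   variable of [v : V] being ['X_(enum_rank v)]. *)
Section StanleyReisner.
Variables (K : closedFieldType) (V : finType) (D : complex V).
Local Notation R := {mpoly K[#|V|]}.

Definition SR_generator (S : {set V}) : R := \prod_(v in S) 'X_(enum_rank v).

Definition SR_ideal : {pred R} := fun p =>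
  `[< exists c : {set V} -> R,
        p = \sum_(S : {set V} | S \notin faces D) c S * SR_generator S >].

Definition mnm_supp (m : 'X_{1..#|V|}) : {set V} :=
  [set v | m (enum_rank v) != 0%N].

Definition set_mnm (S : {set V}) : 'X_{1..#|V|} :=
  [multinom (enum_val i \in S : nat) | i < #|V|].

Lemma SR_generatorE S : SR_generator S = 'X_[set_mnm S].
Proof.
rewrite /SR_generator mpolyXE_id (reindex (@enum_val V V)) /=; last first.
  by exists enum_rank => x _; rewrite ?enum_valK ?enum_rankK.
rewrite [LHS]big_mkcond /=; apply: eq_bigr => i _.
by rewrite mnmE enum_valK; case: (_ \in S); rewrite ?expr1 ?expr0.
Qed.

Lemma mcoeffMX_eq0 (p : R) (k m : 'X_{1..#|V|}) :
  ~~ (k <= m)%MM -> (p * 'X_[k])@_m = 0.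
Proof.
move=> nkm; rewrite mcoeffMr; apply: big1 => -[m1 m2] /= /eqP e.
rewrite mcoeffX; case: eqP; rewrite ?mulr0 // => h.
by case/negP: nkm; rewrite e -h lem_addr.
Qed.

Lemma SR_idealP (p : R) :
  reflect (forall m, mnm_supp m \in faces D -> p@_m = 0) (p \in SR_ideal).
Proof.
rewrite unfold_in /SR_ideal; apply: (iffP (asboolP _)) => [[c ->] m mD|h].
  rewrite raddf_sum /= big1 // => S SD.
  rewrite SR_generatorE mcoeffMX_eq0 //; apply: contra SD => /mnm_lepP le.
  apply: face_subset mD _; apply/subsetP => v vS; rewrite inE.
  by have := le (enum_rank v); rewrite mnmE enum_rankK vS -lt0n.
exists (fun S => \sum_(m <- msupp p | mnm_supp m == S)
                   p@_m *: 'X_[m - set_mnm S]).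
rewrite [LHS]mpolyE; under [RHS]eq_bigr => S _.
  rewrite mulr_suml SR_generatorE.
  under eq_bigr => m /eqP mS.
    rewrite -scalerAl -mpolyXD submK; last first.
      apply/mnm_lepP => i; rewrite mnmE -mS inE enum_valK.
      by case: (m i).
    over.
  over.
rewrite (exchange_big_dep predT) //=; apply: eq_big_seq => m mp.
rewrite (big_pred1 (mnm_supp m)) // => S /=; rewrite eq_sym.
case: eqP => [->|]; rewrite ?andbF ?andbT //.
by apply/negP => /h /eqP; rewrite mcoeff_eq0 mp.
Qed.

Lemma SR_ideal_closed : idealr_closed SR_ideal.
Proof.
split; first by apply/SR_idealP => m _; rewrite mcoeff0.
  apply/negP => /SR_idealP /(_ 0%MM); rewrite mcoeff1 eqxx => h.
  suff /h/eqP : mnm_supp 0%MM \in faces D by rewrite oner_eq0.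
  suff -> : mnm_supp 0%MM = set0 by apply: face_empty.
  by apply/setP => v; rewrite !inE mnm0E.
move=> a u v; rewrite !unfold_in => /asboolP [c ->] /asboolP [d ->].
apply/asboolP; exists (fun S => a * c S + d S).
rewrite mulr_sumr -big_split /=; apply: eq_bigr => S _.
by rewrite mulrDl mulrA.
Qed.

HB.instance Definition _ := isIdealr.Build R SR_ideal SR_ideal_closed.

Definition SR_ring := {ideal_quot SR_ideal}.
HB.instance Definition _ := GRing.ComNzRing.on SR_ring.

Definition SR_pi : R -> SR_ring := \pi_SR_ring.
HB.instance Definition _ := GRing.RMorphism.copy SR_pi SR_pi.

Definition SR_repr (u : SR_ring) : R := repr u.

Definition SR_var (v : V) : SR_ring := SR_pi 'X_(enum_rank v).

Lemma SR_reprK u : SR_pi (SR_repr u) = u.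
Proof. exact: reprK. Qed.

Lemma SR_pi_surj u : exists p, u = SR_pi p.
Proof. by exists (SR_repr u); rewrite SR_reprK. Qed.

Lemma SR_pi_eq (p q : R) : (SR_pi p == SR_pi q) = (p - q \in SR_ideal).
Proof. by rewrite Quotient.idealrBE. Qed.

Definition SR_scale (a : K) (u : SR_ring) : SR_ring := SR_pi (a *: SR_repr u).

Lemma SR_scale_pi a p : SR_scale a (SR_pi p) = SR_pi (a *: p).
Proof.
apply/eqP; rewrite SR_pi_eq -scalerBr -mul_mpolyC idealMr //.
by rewrite -SR_pi_eq SR_reprK.
Qed.

Lemma SR_scaleA a b u : SR_scale a (SR_scale b u) = SR_scale (a * b) u.
Proof. by have [p ->] := SR_pi_surj u; rewrite !SR_scale_pi scalerA. Qed.

Lemma SR_scale1 : left_id 1 SR_scale.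
Proof. by move=> u; rewrite /SR_scale scale1r SR_reprK. Qed.

Lemma SR_scaleDr : right_distributive SR_scale +%R.
Proof.
move=> a u v; have [p ->] := SR_pi_surj u; have [q ->] := SR_pi_surj v.
by rewrite -rmorphD !SR_scale_pi scalerDr rmorphD.
Qed.

Lemma SR_scaleDl u : {morph SR_scale^~ u : a b / a + b}.
Proof.
move=> a b /=; have [p ->] := SR_pi_surj u.
by rewrite !SR_scale_pi scalerDl rmorphD.
Qed.

HB.instance Definition _ := GRing.Zmodule_isLmodule.Build K SR_ring
  SR_scaleA SR_scale1 SR_scaleDr SR_scaleDl.

Lemma SR_piZ a p : SR_pi (a *: p) = a *: SR_pi p.
Proof. by rewrite -SR_scale_pi. Qed.

Lemma SR_scaleAl (a : K) (u v : SR_ring) : a *: (u * v) = (a *: u) * v.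
Proof.
have [p ->] := SR_pi_surj u; have [q ->] := SR_pi_surj v.
by rewrite -rmorphM -!SR_piZ -rmorphM scalerAl.
Qed.

HB.instance Definition _ := GRing.Lmodule_isLalgebra.Build K SR_ring SR_scaleAl.
HB.instance Definition _ := GRing.Lalgebra_isComAlgebra.Build K SR_ring.

HB.instance Definition _ := GRing.isScalable.Build K R SR_ring *:%R SR_pi SR_piZ.

End StanleyReisner.

Lemma digits_inj (B n : nat) (a b : 'I_n -> nat) :
  (forall i, a i < B)%N -> (forall i, b i < B)%N ->
  (\sum_i a i * B ^ i = \sum_i b i * B ^ i)%N -> a =1 b.
Proof.
elim: n a b => [|n IH] a b ha hb; first by move=> _ [].
have E (c : 'I_n.+1 -> nat) : (\sum_i c i * B ^ i =
    (\sum_(i < n) c (lift ord0 i) * B ^ i) * B + c ord0)%N.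
  rewrite big_ord_recl /= expn0 muln1 addnC big_distrl /=; congr (_ + _)%N.
  by apply: eq_bigr => i _; rewrite /bump /= add1n expnSr mulnA.
rewrite !E => e.
have B0 : (0 < B)%N by apply: leq_ltn_trans (ha ord0).
have e0 : a ord0 = b ord0.
  by have := congr1 (modn^~ B) e; rewrite /= !modnMDl !modn_small.
have e1 : a \o lift ord0 =1 b \o lift ord0.
  apply: IH => [i|i|] /=; rewrite ?ha ?hb //.
  have := congr1 (divn^~ B) e.
  by rewrite /= !divnMDl // !divn_small // !addn0.
by move=> i; case: (unliftP ord0 i) => [j ->|->] //; apply: e1.
Qed.

Lemma mpoly_eval_eq0 (K : closedFieldType) n (p : {mpoly K[n]}) :
  (forall v : 'I_n -> K, p.@[v] = 0) -> p = 0.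
Proof.
move=> h; apply/mpolyP => m0; rewrite mcoeff0; apply/eqP.
rewrite mcoeff_eq0; apply/negP => m0p.
pose B := msize p; pose e (m : 'X_{1..n}) := (\sum_i m i * B ^ i)%N.
pose q : {poly K} := \sum_(m <- msupp p) p@_m *: 'X^(e m).
have q0 : q = 0.
  apply/eqP/contraT => /closed_nonrootP [t]; rewrite rootE -[X in _ != X](h
    (fun i => t ^+ (B ^ i))) mevalE horner_sum => /eqP [].
  apply: eq_bigr => m _; rewrite hornerZ hornerXn /e -prodrXr; congr (_ * _).
  by apply: eq_bigr => i _; rewrite -exprM mulnC.
have mB m : m \in msupp p -> forall i, (m i < B)%N.
  move=> mp i; apply: leq_ltn_trans (msize_mdeg_lt mp).
  by rewrite mdegE (bigD1 i) //= leq_addr.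
have := congr1 (fun r : {poly K} => r`_(e m0)) q0.
rewrite coef0 coef_sum (bigD1_seq m0) ?msupp_uniq //= coefZ coefXn eqxx mulr1.
rewrite big_seq_cond big1 ?addr0 => [/eqP|m /andP [mp mm0]].
  by rewrite mcoeff_eq0 m0p.
rewrite coefZ coefXn; case: eqP => [/esym em|]; rewrite ?mulr0 //.
case/eqP: mm0; apply/mnmP.
by apply: (@digits_inj B) em => i; rewrite mB.
Qed.

Section Varieties.
Variable K : closedFieldType.

Definition zariski_closed (N : nat) (Z : 'rV[K]_N -> Prop) : Prop :=
  exists E : {mpoly K[N]} -> Prop,
    forall x, Z x <-> (forall P, E P -> P.@[x 0] = 0).

(* An affine algebraic variety whose points form a subset of the type [T]: a
   bijection of that subset onto a Zariski-closed subset of an affine space. *)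
Record variety (T : Type) := Variety {
  points :> T -> Prop;
  adim : nat;
  chart : T -> 'rV[K]_adim;
  chart_inj : forall x y, points x -> points y -> chart x = chart y -> x = y;
  chart_closed : zariski_closed (fun z => exists2 x, points x & z = chart x)
}.

(* Regular maps between closed subsets of affine spaces are the restrictions of
   polynomial maps. *)
Definition is_morphism (T U : Type) (X : variety T) (Y : variety U)
    (f : T -> U) : Prop :=
  (forall x, X x -> Y (f x)) /\
  exists P : 'I_(adim Y) -> {mpoly K[adim X]},
    forall x, X x -> forall i, chart Y (f x) 0 i = (P i).@[chart X x 0].

(* The image is closed, and the map is an isomorphism onto its image. *)
Definition is_closed_immersion (T U : Type) (X : variety T) (Y : variety U)
    (f : T -> U) : Prop :=
  [/\ is_morphism X Y f,
      zariski_closed (fun z => exists2 x, X x & z = chart Y (f x)) &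
      exists Q : 'I_(adim X) -> {mpoly K[adim Y]},
        forall x, X x -> forall i, chart X x 0 i = (Q i).@[chart Y (f x) 0]].

Definition variety_isomorphic (T U : Type) (X : variety T) (Y : variety U)
    : Prop :=
  exists (f : T -> U) (g : U -> T),
    [/\ is_morphism X Y f, is_morphism Y X g,
        forall x, X x -> g (f x) = x & forall y, Y y -> f (g y) = y].

(* All filtration pieces are affine. *)
Record ind_variety (T : Type) := IndVariety {
  piece : nat -> variety T;
  piece_incl : forall d, is_closed_immersion (piece d) (piece d.+1) id;
  piece_cover : forall x, exists d, piece d x
}.

Definition is_ind_morphism (T U : Type) (X : ind_variety T) (Y : ind_variety U)
    (f : T -> U) : Prop :=
  forall k, exists l, is_morphism (piece X k) (piece Y l) f.

Lemma zariski_closedP N (Z : 'rV[K]_N -> Prop) :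
  (forall x : 'rV[K]_N, (forall P : {mpoly K[N]}, (forall z, Z z -> P.@[z 0] = 0) ->
     P.@[x 0] = 0) -> Z x) -> zariski_closed Z.
Proof.
move=> h; exists (fun P => forall z, Z z -> P.@[z 0] = 0) => x; split=> [Zx P|].
  by apply.
exact: h.
Qed.

Lemma zariski_closed_ideal N (Z : 'rV[K]_N -> Prop) (x : 'rV[K]_N) : zariski_closed Z ->
  (forall P : {mpoly K[N]}, (forall z, Z z -> P.@[z 0] = 0) ->
     P.@[x 0] = 0) -> Z x.
Proof.
by move=> [E ZE] h; apply/ZE => P EP; apply: h => z /ZE; apply.
Qed.

Definition sub_poly (M N : nat) (s : 'I_M -> 'I_N) (P : {mpoly K[M]}) :
  {mpoly K[N]} := P \mPo [tuple 'X_(s i) | i < M].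

Lemma sub_polyE M N (s : 'I_M -> 'I_N) P (v : 'I_N -> K) :
  (sub_poly s P).@[v] = P.@[fun i => v (s i)].
Proof.
rewrite comp_mpoly_meval; apply: meval_eq => i.
by rewrite tnth_mktuple mevalXU.
Qed.

Section Product.
Variables (T U : Type) (X : variety T) (Y : variety U).

Definition prod_points (p : T * U) : Prop := X p.1 /\ Y p.2.
Definition prod_chart (p : T * U) : 'rV[K]_(adim X + adim Y) :=
  row_mx (chart X p.1) (chart Y p.2).

Lemma prod_chartl p i : prod_chart p 0 (lshift _ i) = chart X p.1 0 i.
Proof. by rewrite row_mxEl. Qed.
Lemma prod_chartr p i : prod_chart p 0 (rshift _ i) = chart Y p.2 0 i.
Proof. by rewrite row_mxEr. Qed.

Lemma prod_chart_inj p q : prod_points p -> prod_points q ->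
  prod_chart p = prod_chart q -> p = q.
Proof.
case: p q => [x y] [x' y'] [/= Xx Yy] [/= Xx' Yy'] /eq_row_mx [e1 e2].
by rewrite (chart_inj Xx Xx' e1) (chart_inj Yy Yy' e2).
Qed.

Lemma prod_image_closed (ZX : 'rV[K]_(adim X) -> Prop) ZY :
  zariski_closed ZX -> zariski_closed ZY ->
  zariski_closed (fun z : 'rV[K]_(adim X + adim Y) =>
    ZX (lsubmx z) /\ ZY (rsubmx z)).
Proof.
move=> cX cY; apply: zariski_closedP => z h; split.
  apply: (zariski_closed_ideal cX) => P hP.
  have := h (sub_poly (lshift _) P); rewrite sub_polyE => h'.
  rewrite -[RHS]h'; first by apply: meval_eq => i; rewrite mxE.
  move=> w [Zw _]; rewrite sub_polyE -(hP _ Zw).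
  by apply: meval_eq => i; rewrite mxE.
apply: (zariski_closed_ideal cY) => P hP.
have := h (sub_poly (@rshift _ _) P); rewrite sub_polyE => h'.
rewrite -[RHS]h'; first by apply: meval_eq => i; rewrite mxE.
move=> w [_ Zw]; rewrite sub_polyE -(hP _ Zw).
by apply: meval_eq => i; rewrite mxE.
Qed.

Lemma zariski_closed_ext N (Z Z' : 'rV[K]_N -> Prop) :
  (forall z, Z z <-> Z' z) -> zariski_closed Z -> zariski_closed Z'.
Proof.
by move=> e [E ZE]; exists E => x; rewrite -ZE; split=> /e.
Qed.

Lemma prod_chart_closed :
  zariski_closed (fun z => exists2 p, prod_points p & z = prod_chart p).
Proof.
apply: zariski_closed_ext (prod_image_closed (chart_closed X) (chart_closed Y)).
move=> z; split=> [[[x Xx ex] [y Yy ey]]|[[x y] [/= Xx Yy] ->]].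
  by exists (x, y) => //; rewrite /prod_chart -ex -ey hsubmxK.
by rewrite /prod_chart row_mxKl row_mxKr; split; [exists x|exists y].
Qed.

Definition prod_variety : variety (T * U) :=
  Variety prod_chart_inj prod_chart_closed.
End Product.

Section IndProduct.
Variables (T U : Type) (X : ind_variety T) (Y : ind_variety U).

Definition prod_piece d := prod_variety (piece X d) (piece Y d).

Lemma prod_piece_incl d :
  is_closed_immersion (prod_piece d) (prod_piece d.+1) id.
Proof.
have [[iX [P PE]] cX [Q QE]] := piece_incl X d.
have [[iY [P' PE']] cY [Q' QE']] := piece_incl Y d.
split.
- split=> [[x y] [/= /iX ? /iY ?]|] //.
  exists (fun i => match split i with
                   | inl j => sub_poly (lshift _) (P j)
                   | inr j => sub_poly (@rshift _ _) (P' j)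
                   end).
  move=> [x y] [/= Xx Yy] i; case: splitP => j e.
    have -> : i = lshift _ j by apply: val_inj.
    rewrite sub_polyE row_mxEl PE //; apply: meval_eq => k.
    by rewrite row_mxEl.
  have -> : i = rshift _ j by apply: val_inj.
  rewrite sub_polyE row_mxEr PE' //; apply: meval_eq => k.
  by rewrite row_mxEr.
- apply: zariski_closed_ext (prod_image_closed cX cY).
  move=> z; split=> [[[x Xx ex] [y Yy ey]]|[[x y] [/= Xx Yy] ->]].
    by exists (x, y) => //=; rewrite /prod_chart -ex -ey hsubmxK.
  by rewrite /= /prod_chart row_mxKl row_mxKr; split; [exists x|exists y].
- exists (fun i => match split i with
                   | inl j => sub_poly (lshift _) (Q j)
                   | inr j => sub_poly (@rshift _ _) (Q' j)
                   end).
  move=> [x y] [/= Xx Yy] i; case: splitP => j e.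
    have -> : i = lshift _ j by apply: val_inj.
    rewrite sub_polyE row_mxEl QE //; apply: meval_eq => k.
    by rewrite row_mxEl.
  have -> : i = rshift _ j by apply: val_inj.
  rewrite sub_polyE row_mxEr QE' //; apply: meval_eq => k.
  by rewrite row_mxEr.
Qed.

Lemma piece_mono (S : Type) (Z : ind_variety S) d e x :
  (d <= e)%N -> piece Z d x -> piece Z e x.
Proof.
move=> /subnK <-; elim: (e - d)%N => [|n IH] // /IH.
by rewrite addSn; case: (piece_incl Z (n + d)) => [[h _] _ _]; apply: h.
Qed.

Lemma prod_piece_cover p : exists d, prod_piece d p.
Proof.
have [d hd] := piece_cover X p.1; have [e he] := piece_cover Y p.2.
by exists (maxn d e); split; [apply: piece_mono hd|apply: piece_mono he];
  rewrite ?leq_maxl ?leq_maxr.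
Qed.

Definition prod_ind_variety : ind_variety (T * U) :=
  IndVariety prod_piece_incl prod_piece_cover.
End IndProduct.

Record ind_group := IndGroup {
  ig_group :> groupType;
  ig_variety : ind_variety ig_group;
  ig_mul : is_ind_morphism (prod_ind_variety ig_variety ig_variety) ig_variety
             (fun p => (p.1 * p.2)%g);
  ig_inv : is_ind_morphism ig_variety ig_variety (fun x => x^-1%g)
}.

Definition ind_group_isomorphic (G H : ind_group) : Prop :=
  exists (f : G -> H) (g : H -> G),
    [/\ {morph f : x y / (x * y)%g}, cancel f g, cancel g f,
        is_ind_morphism (ig_variety G) (ig_variety H) f &
        is_ind_morphism (ig_variety H) (ig_variety G) g].

End Varieties.

Section Automorphisms.
Variables (K : closedFieldType) (V : finType) (D : complex V).
Local Notation R := {mpoly K[#|V|]}.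
Local Notation A := (SR_ring K D).
Local Notation pi := (@SR_pi K V D).

(* [A_{<= d}]; [msize] is the degree plus one. *)
Definition SR_deg_le (d : nat) (u : A) : Prop :=
  exists2 p : R, (msize p <= d.+1)%N & u = pi p.

(* A [K]-algebra automorphism, given together with its inverse. *)
Record alg_aut := AlgAut {
  aut :> {lrmorphism A -> A};
  aut_inv : {lrmorphism A -> A};
  autK : cancel aut aut_inv;
  aut_invK : cancel aut_inv aut
}.

Lemma lrmorphism_eq (f g : {lrmorphism A -> A}) : f =1 g -> f = g.
Proof.
case: f g => [f cf] [g cg] /= /funext e; subst g; congr GRing.LRMorphism.Pack.
case: cf cg => [[a1] [a2] [a3]] [[b1] [b2] [b3]].
by rewrite (Prop_irrelevance a1 b1) (Prop_irrelevance a2 b2)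
  (Prop_irrelevance a3 b3).
Qed.

Lemma alg_aut_eq (f g : alg_aut) : aut f =1 aut g -> f = g.
Proof.
case: f g => [f f' fK f'K] [g g' gK g'K] /= fg.
have e : f = g by apply: lrmorphism_eq.
have e' : f' = g'.
  by apply: lrmorphism_eq => u; rewrite -{1}(g'K u) -fg fK.
subst; rewrite (Prop_irrelevance fK gK) (Prop_irrelevance f'K g'K) //.
Qed.

HB.instance Definition _ := gen_eqMixin alg_aut.
HB.instance Definition _ := gen_choiceMixin alg_aut.

Definition alg_aut_one : alg_aut :=
  @AlgAut idfun idfun (fun _ => erefl) (fun _ => erefl).

Definition alg_aut_inv (f : alg_aut) : alg_aut := AlgAut (@aut_invK f) (@autK f).

Definition alg_aut_mul (f g : alg_aut) : alg_aut :=
  @AlgAut (aut f \o aut g) (aut_inv g \o aut_inv f)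
    (can_comp (@autK f) (@autK g)) (can_comp (@aut_invK g) (@aut_invK f)).

Lemma alg_aut_mulA : associative alg_aut_mul.
Proof. by move=> f g h; apply: alg_aut_eq. Qed.
Lemma alg_aut_mul1g : left_id alg_aut_one alg_aut_mul.
Proof. by move=> f; apply: alg_aut_eq. Qed.
Lemma alg_aut_mulg1 : right_id alg_aut_one alg_aut_mul.
Proof. by move=> f; apply: alg_aut_eq. Qed.
Lemma alg_aut_mulVg : left_inverse alg_aut_one alg_aut_inv alg_aut_mul.
Proof. by move=> f; apply: alg_aut_eq => u /=; rewrite autK. Qed.
Lemma alg_aut_mulgV : right_inverse alg_aut_one alg_aut_inv alg_aut_mul.
Proof. by move=> f; apply: alg_aut_eq => u /=; rewrite aut_invK. Qed.

HB.instance Definition _ := isGroup.Build alg_aut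
  alg_aut_mulA alg_aut_mul1g alg_aut_mulg1 alg_aut_mulVg alg_aut_mulgV.

Definition aut_piece (d : nat) (f : alg_aut) : Prop :=
  forall v, SR_deg_le d (aut f (SR_var K D v)) /\
            SR_deg_le d (aut_inv f (SR_var K D v)).

(* The monomials supported on a face, which form a basis of [A] (see
   [SR_basis]), here up to degree [d]. *)
Definition face_mnm (d : nat) : finType :=
  {m : 'X_{1..#|V| < d.+1} | mnm_supp m \in faces D}.

Definition aut_coord (d : nat) : finType := (bool * V * face_mnm d)%type.

(* The coordinates of the pair [(f, f^-1)] in [(A_{<= d})^V * (A_{<= d})^V]. *)
Definition aut_chart (d : nat) (f : alg_aut) : 'rV[K]_#|aut_coord d| :=
  \row_j let: (b, v, m) := enum_val j in
    (SR_repr ((if b then aut f else aut_inv f) (SR_var K D v)))@_(val (val m)).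

Lemma SR_coef_pi (p : R) m : mnm_supp m \in faces D ->
  (SR_repr (pi p))@_m = p@_m.
Proof.
move=> mD; apply/eqP; rewrite -subr_eq0 -mcoeffB.
have : SR_repr (pi p) - p \in SR_ideal D by rewrite -SR_pi_eq SR_reprK.
by move/SR_idealP/(_ m mD) => ->.
Qed.

Lemma SR_coefD (u v : A) m : mnm_supp m \in faces D ->
  (SR_repr (u + v))@_m = (SR_repr u)@_m + (SR_repr v)@_m.
Proof.
move=> mD; have [p ->] := SR_pi_surj u; have [q ->] := SR_pi_surj v.
by rewrite -rmorphD !SR_coef_pi // mcoeffD.
Qed.

Lemma SR_coefZ a (u : A) m : mnm_supp m \in faces D ->
  (SR_repr (a *: u))@_m = a * (SR_repr u)@_m.
Proof.
move=> mD; have [p ->] := SR_pi_surj u.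
by rewrite -SR_piZ !SR_coef_pi // mcoeffZ.
Qed.

Lemma SR_coef0 m : mnm_supp m \in faces D -> (SR_repr (0 : A))@_m = 0.
Proof. by move=> mD; rewrite -(rmorph0 pi) SR_coef_pi // mcoeff0. Qed.

Lemma SR_coef_sum (I : Type) (r : seq I) (F : I -> A) m :
  mnm_supp m \in faces D ->
  (SR_repr (\sum_(i <- r) F i))@_m = \sum_(i <- r) (SR_repr (F i))@_m.
Proof.
move=> mD; elim: r => [|i r IH]; first by rewrite !big_nil SR_coef0.
by rewrite !big_cons SR_coefD // IH.
Qed.

Lemma SR_coef_eq (u v : A) :
  (forall m, mnm_supp m \in faces D -> (SR_repr u)@_m = (SR_repr v)@_m) -> u = v.
Proof.
move=> h; rewrite -[u]SR_reprK -[v]SR_reprK; apply/eqP; rewrite SR_pi_eq.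
by apply/SR_idealP => m mD; rewrite mcoeffB h // subrr.
Qed.

Lemma SR_deg_leP d (u : A) :
  SR_deg_le d u <-> forall m, mnm_supp m \in faces D -> (d < mdeg m)%N ->
    (SR_repr u)@_m = 0.
Proof.
split=> [[p sp ->] m mD dm|h].
  rewrite SR_coef_pi //; apply/eqP; rewrite mcoeff_eq0.
  by apply: msize_mdeg_ge; apply: leq_trans sp _.
exists (\sum_(m : 'X_{1..#|V| < d.+1}) (SR_repr u)@_m *: 'X_[m]).
  apply: (big_ind (fun p : R => msize p <= d.+1)%N).
  - by rewrite msize0.
  - by move=> p q hp hq; apply: leq_trans (msizeD_le _ _) _; rewrite geq_max hp.
  - move=> m _; apply: leq_trans (msizeZ_le _ _) _.
    by rewrite msizeX bmdeg.
apply: SR_coef_eq => m mD; rewrite SR_coef_pi // raddf_sum /=.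
have [dm|md] := ltnP d (mdeg m).
  rewrite h // big1 // => k _; rewrite mcoeffZ mcoeffX.
  case: eqP => [e|]; rewrite ?mulr0 //.
  by have := bmdeg k; rewrite e => /(leq_ltn_trans dm); rewrite ltnn.
rewrite (bigD1 (BMultinom (n := #|V|) (bound := d.+1) (bmnm := m) md)) //=.
rewrite mcoeffZ mcoeffX eqxx mulr1 big1 ?addr0 // => k.
rewrite -val_eqE /= mcoeffZ mcoeffX => /negPf ->.
by rewrite mulr0.
Qed.

Lemma SR_basis d (u : A) : SR_deg_le d u ->
  u = \sum_(m : face_mnm d) (SR_repr u)@_(val (val m)) *: pi 'X_[val (val m)].
Proof.
move/SR_deg_leP => h; apply: SR_coef_eq => m mD.
rewrite SR_coef_sum //; under eq_bigr do rewrite SR_coefZ // SR_coef_pi // mcoeffX.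
have [dm|md] := ltnP d (mdeg m).
  rewrite h // big1 // => k _; case: eqP => [e|]; rewrite ?mulr0 //.
  have md : (mdeg m < d.+1)%N by rewrite -e; apply: bmdeg.
  by have := leq_ltn_trans dm md; rewrite ltnn.
pose m1 := BMultinom (n := #|V|) (bound := d.+1) (bmnm := m) md.
rewrite (bigD1 (exist (fun m : 'X_{1..#|V| < d.+1} => mnm_supp m \in faces D)
  m1 mD)) //= eqxx mulr1 big1 ?addr0 // => k.
by rewrite -!val_eqE /= => /negPf ->; rewrite mulr0.
Qed.

Lemma SR_deg_le_mono d e u : (d <= e)%N -> SR_deg_le d u -> SR_deg_le e u.
Proof. by move=> de [p sp ->]; exists p => //; apply: leq_trans sp _. Qed.

Lemma SR_deg_leD d u v : SR_deg_le d u -> SR_deg_le d v -> SR_deg_le d (u + v).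
Proof.
move=> /SR_deg_leP hu /SR_deg_leP hv; apply/SR_deg_leP => m mD dm.
by rewrite SR_coefD // hu // hv // addr0.
Qed.

Lemma SR_deg_leZ d a u : SR_deg_le d u -> SR_deg_le d (a *: u).
Proof.
move=> /SR_deg_leP hu; apply/SR_deg_leP => m mD dm.
by rewrite SR_coefZ // hu // mulr0.
Qed.

Lemma SR_deg_le_sum d (I : Type) (r : seq I) (P : pred I) (F : I -> A) :
  (forall i, P i -> SR_deg_le d (F i)) -> SR_deg_le d (\sum_(i <- r | P i) F i).
Proof.
move=> h; apply: big_ind => //; last exact: SR_deg_leD.
by exists 0; rewrite ?msize0 ?rmorph0.
Qed.

Lemma SR_deg_le1 : SR_deg_le 0 1.
Proof. by exists 1; rewrite ?msize1 ?rmorph1. Qed.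

Lemma SR_deg_leM d e u v :
  SR_deg_le d u -> SR_deg_le e v -> SR_deg_le (d + e) (u * v).
Proof.
move=> [p sp ->] [q sq ->]; exists (p * q); last by rewrite rmorphM.
have [->|p0] := eqVneq p 0; first by rewrite mul0r msize0.
have [->|q0] := eqVneq q 0; first by rewrite mulr0 msize0.
rewrite msizeM //; have := leq_add sp sq; rewrite addSn addnS.
by case: (msize p + msize q)%N.
Qed.

Lemma SR_deg_leX d u k : SR_deg_le d u -> SR_deg_le (k * d) (u ^+ k).
Proof.
move=> h; elim: k => [|k IH]; first exact: SR_deg_le1.
by rewrite exprS mulSn; apply: SR_deg_leM.
Qed.

Definition SR_subst (a : 'I_#|V| -> A) (p : R) : A := mmap (in_alg A) a p.

Lemma SR_substE (f : {lrmorphism A -> A}) p :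
  f (pi p) = SR_subst (fun i => f (pi 'X_i)) p.
Proof.
rewrite {1}[p]mpolyE rmorph_sum rmorph_sum /=; apply: eq_bigr => m _.
rewrite SR_piZ linearZ /= mulr_algl; congr (_ *: _).
by rewrite mpolyXE_id !rmorph_prod; apply: eq_bigr => i _; rewrite !rmorphXn.
Qed.

Lemma SR_mmap1_deg d (a : 'I_#|V| -> A) m : (forall i, SR_deg_le d (a i)) ->
  SR_deg_le (mdeg m * d) (mmap1 a m).
Proof.
move=> h; rewrite mdegE big_distrl /= /mmap1.
elim/big_rec2: _ => [|i k u _ hu]; first exact: SR_deg_le1.
by apply: SR_deg_leM => //; apply: SR_deg_leX.
Qed.

Lemma SR_subst_deg d e a p : (forall i, SR_deg_le d (a i)) ->
  (msize p <= e.+1)%N -> SR_deg_le (e * d) (SR_subst a p).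
Proof.
move=> h sp; rewrite /SR_subst /mmap big_seq; apply: SR_deg_le_sum => m mp.
rewrite mulr_algl; apply/SR_deg_leZ/SR_deg_le_mono; last exact: SR_mmap1_deg.
by rewrite leq_mul2r -ltnS (leq_trans (msize_mdeg_lt mp)) ?orbT.
Qed.

Lemma SR_lift (a : 'I_#|V| -> A) :
  (forall p, p \in SR_ideal D -> SR_subst a p = 0) ->
  exists f : {lrmorphism A -> A}, forall p, f (pi p) = SR_subst a p.
Proof.
move=> h; pose f (u : A) : A := SR_subst a (SR_repr u).
have fE p : f (pi p) = SR_subst a p.
  apply/eqP; rewrite -subr_eq0 /f /SR_subst -rmorphB; apply/eqP/h.
  by rewrite -SR_pi_eq SR_reprK.
have fB : zmod_morphism f.
  move=> u v; have [p ->] := SR_pi_surj u; have [q ->] := SR_pi_surj v.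
  by rewrite -rmorphB !fE /SR_subst rmorphB.
have fM : monoid_morphism f.
  split; first by rewrite -(rmorph1 pi) fE /SR_subst !rmorph1.
  move=> u v; have [p ->] := SR_pi_surj u; have [q ->] := SR_pi_surj v.
  by rewrite -rmorphM !fE /SR_subst rmorphM.
have fZ : scalable f.
  move=> c u; have [p ->] := SR_pi_surj u.
  by rewrite -SR_piZ !fE /SR_subst mmapZ mulr_algl.
pose m1 := GRing.isZmodMorphism.Build A A f fB.
pose m2 := GRing.isMonoidMorphism.Build A A f fM.
pose m3 := GRing.isScalable.Build K A A *:%R f fZ.
pose g : {lrmorphism A -> A} := HB.pack f m1 m2 m3.
by exists g.
Qed.

(* [A]-valued polynomial maps *)
Definition apoly N (F : 'rV[K]_N -> A) : Prop :=
  exists s : seq ({mpoly K[N]} * A),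
    forall z, F z = \sum_(q <- s) q.1.@[z 0] *: q.2.

Section Apoly.
Variable N : nat.
Implicit Types F G : 'rV[K]_N -> A.

Lemma apoly_ext F G : F =1 G -> apoly F -> apoly G.
Proof. by move=> e [s sE]; exists s => z; rewrite -e. Qed.

Lemma apoly_const u : apoly (fun _ : 'rV[K]_N => u).
Proof. by exists [:: (1, u)] => z; rewrite big_seq1 /= meval1 scale1r. Qed.

Lemma apolyD F G : apoly F -> apoly G -> apoly (fun z => F z + G z).
Proof.
by move=> [s sE] [t tE]; exists (s ++ t) => z; rewrite big_cat /= sE tE.
Qed.

Lemma apolyM F G : apoly F -> apoly G -> apoly (fun z => F z * G z).
Proof.
move=> [s sE] [t tE].
exists [seq (q.1 * r.1, q.2 * r.2) | q <- s, r <- t] => z.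
rewrite sE tE big_distrlr /= big_allpairs_dep /=.
apply: eq_bigr => q _; apply: eq_bigr => r _ /=.
by rewrite mevalM -scalerAl -scalerAr scalerA.
Qed.

Lemma apolyZ j F : apoly F -> apoly (fun z => z 0 j *: F z).
Proof.
move=> [s sE]; exists [seq ('X_j * q.1, q.2) | q <- s] => z.
rewrite sE big_map scaler_sumr; apply: eq_bigr => q _ /=.
by rewrite mevalM mevalXU scalerA.
Qed.

Lemma apoly_sum (I : Type) (r : seq I) (F : I -> 'rV[K]_N -> A) :
  (forall i, apoly (F i)) -> apoly (fun z => \sum_(i <- r) F i z).
Proof.
move=> h; elim: r => [|i r IH].
  by apply: apoly_ext (apoly_const 0) => z; rewrite big_nil.
by apply: apoly_ext (apolyD (h i) IH) => z; rewrite big_cons.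
Qed.

Lemma apoly_prod (I : Type) (r : seq I) (F : I -> 'rV[K]_N -> A) :
  (forall i, apoly (F i)) -> apoly (fun z => \prod_(i <- r) F i z).
Proof.
move=> h; elim: r => [|i r IH].
  by apply: apoly_ext (apoly_const 1) => z; rewrite big_nil.
by apply: apoly_ext (apolyM (h i) IH) => z; rewrite big_cons.
Qed.

Lemma apolyX F k : apoly F -> apoly (fun z => F z ^+ k).
Proof.
move=> h; elim: k => [|k IH]; first exact: apoly_const.
by apply: apoly_ext (apolyM h IH) => z; rewrite exprS.
Qed.

Lemma apoly_mmap1 (a : 'rV[K]_N -> 'I_#|V| -> A) m :
  (forall i, apoly (fun z => a z i)) -> apoly (fun z => mmap1 (a z) m).
Proof. by move=> h; apply: apoly_prod => i; apply: apolyX. Qed.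

Lemma apoly_subst (a : 'rV[K]_N -> 'I_#|V| -> A) p :
  (forall i, apoly (fun z => a z i)) -> apoly (fun z => SR_subst (a z) p).
Proof.
move=> h; apply: apoly_sum => m; apply: apolyM; first exact: apoly_const.
exact: apoly_mmap1.
Qed.

Lemma apoly_coef F m : mnm_supp m \in faces D -> apoly F ->
  exists P : {mpoly K[N]}, forall z, (SR_repr (F z))@_m = P.@[z 0].
Proof.
move=> mD [s sE]; exists (\sum_(q <- s) (SR_repr q.2)@_m *: q.1) => z.
rewrite sE SR_coef_sum // raddf_sum /=; apply: eq_bigr => q _.
by rewrite SR_coefZ // mevalZ mulrC.
Qed.

Lemma apoly_closure F u (Z : 'rV[K]_N -> Prop) (x : 'rV[K]_N) :
  apoly F -> (forall z, Z z -> F z = u) ->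
  (forall P : {mpoly K[N]}, (forall z, Z z -> P.@[z 0] = 0) -> P.@[x 0] = 0) ->
  F x = u.
Proof.
move=> pF FZ h; apply: SR_coef_eq => m mD.
have [P PE] := apoly_coef mD pF.
apply/eqP; rewrite -subr_eq0 PE; apply/eqP.
rewrite -[X in _ - X](mevalC (x 0)) -mevalB; apply: h => z Zz.
by rewrite mevalB mevalC -PE FZ // subrr.
Qed.
End Apoly.

Section Decode.
Variable d : nat.
Local Notation N := #|aut_coord d|.

Definition sel (f : alg_aut) (b : bool) : {lrmorphism A -> A} :=
  if b then aut f else aut_inv f.

Lemma selK f b : cancel (sel f b) (sel f (~~ b)).
Proof. by case: b; [exact: autK|exact: aut_invK]. Qed.

Definition decp (z : 'rV[K]_N) b v : R :=
  \sum_(m : face_mnm d) z 0 (enum_rank ((b, v, m) : aut_coord d))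
    *: 'X_[val (val m)].

Definition dec (z : 'rV[K]_N) b (i : 'I_#|V|) : A :=
  \sum_(m : face_mnm d) z 0 (enum_rank ((b, enum_val i, m) : aut_coord d))
    *: pi 'X_[val (val m)].

Lemma aut_chartE f b v m :
  aut_chart d f 0 (enum_rank ((b, v, m) : aut_coord d)) =
  (SR_repr (sel f b (SR_var K D v)))@_(val (val m)).
Proof. by rewrite mxE enum_rankK; case: b. Qed.

Lemma pi_decp z b v : pi (decp z b v) = dec z b (enum_rank v).
Proof.
rewrite rmorph_sum /=; apply: eq_bigr => m _.
by rewrite SR_piZ enum_rankK.
Qed.

Lemma dec_deg z b i : SR_deg_le d (dec z b i).
Proof.
apply: SR_deg_le_sum => m _; apply: SR_deg_leZ.
by exists 'X_[val (val m)] => //; rewrite msizeX bmdeg.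
Qed.

Lemma dec_coef z b v (m : face_mnm d) :
  (SR_repr (dec z b (enum_rank v)))@_(val (val m)) =
  z 0 (enum_rank ((b, v, m) : aut_coord d)).
Proof.
have mD := valP m; rewrite SR_coef_sum //.
under eq_bigr do rewrite SR_coefZ // SR_coef_pi // mcoeffX.
rewrite (bigD1 m) //= eqxx mulr1 enum_rankK big1 ?addr0 // => k.
by rewrite -!val_eqE /= => /negPf ->; rewrite mulr0.
Qed.

Lemma dec_chart f b i : aut_piece d f ->
  dec (aut_chart d f) b i = sel f b (pi 'X_i).
Proof.
move=> fd; have -> : pi 'X_i = SR_var K D (enum_val i).
  by rewrite /SR_var enum_valK.
rewrite [RHS](@SR_basis d); last by case: b; have [] := fd (enum_val i).
by apply: eq_bigr => m _; rewrite aut_chartE.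
Qed.

Lemma subst_dec_chart f b p : aut_piece d f ->
  SR_subst (dec (aut_chart d f) b) p = sel f b (pi p).
Proof.
move=> fd; rewrite SR_substE; congr (mmap _ _ p).
by apply/funext => i; apply: dec_chart.
Qed.

Lemma apoly_dec b i : apoly (fun z => dec z b i).
Proof. by apply: apoly_sum => m; apply: apolyZ; apply: apoly_const. Qed.

Lemma apoly_subst_decp b b' v : apoly (fun z => SR_subst (dec z b) (decp z b' v)).
Proof.
apply: (@apoly_ext _ (fun z => \sum_(m : face_mnm d)
  z 0 (enum_rank ((b', v, m) : aut_coord d)) *: mmap1 (dec z b) (val (val m)))).
  move=> z; rewrite /SR_subst rmorph_sum /=; apply: eq_bigr => m _.
  by rewrite mmapZ mmapX mulr_algl.
apply: apoly_sum => m; apply: apolyZ; apply: apoly_mmap1 => i; apply: apoly_dec.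
Qed.

Lemma aut_chart_inj f g : aut_piece d f -> aut_piece d g ->
  aut_chart d f = aut_chart d g -> f = g.
Proof.
move=> fd gd e; apply: alg_aut_eq => u; have [p ->] := SR_pi_surj u.
by rewrite -[aut f]/(sel f true) -[aut g]/(sel g true) -!subst_dec_chart // e.
Qed.

Lemma aut_chart_closed :
  zariski_closed (fun z => exists2 f, aut_piece d f & z = aut_chart d f).
Proof.
apply: zariski_closedP => z h.
have C1 b p : p \in SR_ideal D -> SR_subst (dec z b) p = 0.
  move=> pI; apply: (apoly_closure (F := fun z => SR_subst (dec z b) p) _ _ h).
    by apply: apoly_subst => i; apply: apoly_dec.
  move=> _ [f fd ->]; rewrite subst_dec_chart //.
  suff -> : pi p = 0 by rewrite rmorph0.
  by apply/eqP; rewrite -(rmorph0 pi) SR_pi_eq subr0.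
have C2 b v : SR_subst (dec z b) (decp z (~~ b) v) = SR_var K D v.
  apply: (apoly_closure (F := fun z => SR_subst (dec z b) (decp z (~~ b) v)) _ _ h);
    first exact: apoly_subst_decp.
  move=> _ [f fd ->]; rewrite subst_dec_chart // pi_decp dec_chart //.
  by rewrite -{1}[b]negbK selK.
have [F FE] := choice (fun b => SR_lift (@C1 b)).
have Fvar b v : F b (SR_var K D v) = dec z b (enum_rank v).
  by rewrite FE /SR_subst mmapX mmap1U.
have FK b : cancel (F b) (F (~~ b)).
  move=> u; have [p ->] := SR_pi_surj u.
  rewrite -[LHS]/((F (~~ b) \o F b) (pi p)) -[RHS]/(idfun (pi p)).
  rewrite (SR_substE (F (~~ b) \o F b)) (SR_substE idfun).
  congr (mmap _ _ p); apply/funext => i /=.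
  have -> : pi 'X_i = SR_var K D (enum_val i) by rewrite /SR_var enum_valK.
  by rewrite Fvar -pi_decp FE -{2}[b]negbK C2.
pose f := AlgAut (FK true) (FK false).
have selE b : sel f b = F b by case: b.
exists f.
  by move=> v; rewrite /= !Fvar; split; apply: dec_deg.
apply/rowP => j; rewrite -[j]enum_valK; case: (enum_val j) => [[b v] m].
by rewrite aut_chartE selE Fvar dec_coef.
Qed.

Definition aut_variety : variety K alg_aut :=
  Variety aut_chart_inj aut_chart_closed.
End Decode.

Lemma aut_piece_deg d f b v : aut_piece d f -> SR_deg_le d (sel f b (SR_var K D v)).
Proof. by move=> /(_ v) []; case: b. Qed.

Definition find_mnm d (m : 'X_{1..#|V|}) : option (face_mnm d) :=
  [pick k : face_mnm d | val (val k) == m].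

Lemma find_mnmP d m : mnm_supp m \in faces D ->
  (exists2 k, find_mnm d m = Some k & val (val k) = m) \/
  (find_mnm d m = None /\ (d < mdeg m)%N).
Proof.
move=> mD; rewrite /find_mnm; case: pickP => [k /eqP e|h]; first by left; exists k.
right; split=> //; rewrite ltnNge; apply/negP => md.
have md' : (mdeg m < d.+1)%N by [].
pose m1 := BMultinom md'.
by have := h (exist (fun m : 'X_{1..#|V| < d.+1} => mnm_supp m \in faces D)
  m1 mD); rewrite /= eqxx.
Qed.

Lemma aut_chart_sub d e :
  exists P : 'I_#|aut_coord e| -> {mpoly K[#|aut_coord d|]},
    forall f, aut_piece d f ->
      forall i, aut_chart e f 0 i = (P i).@[aut_chart d f 0].
Proof.
exists (fun i => let: (b, v, m) := enum_val i in
  if find_mnm d (val (val m)) is Some k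
  then 'X_(enum_rank ((b, v, k) : aut_coord d)) else 0).
move=> g gd i; rewrite -[i]enum_valK; case: (enum_val i) => [[b v] m].
rewrite aut_chartE enum_rankK.
have mD : mnm_supp (val (val m)) \in faces D := valP m.
case: (find_mnmP d mD) => [[k -> <-]|[-> dm]].
  by rewrite mevalXU aut_chartE.
rewrite meval0; have /SR_deg_leP := aut_piece_deg b v gd.
by apply=> //; apply: valP.
Qed.

Lemma aut_piece_mono d e f : (d <= e)%N -> aut_piece d f -> aut_piece e f.
Proof.
by move=> de fd v; have [h h'] := fd v; split; apply: (SR_deg_le_mono de).
Qed.

Lemma aut_variety_incl d :
  is_closed_immersion (aut_variety d) (aut_variety d.+1) id.
Proof.
split.
- split=> [f|]; first exact: aut_piece_mono.
  exact: aut_chart_sub.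
- apply: zariski_closedP => z h.
  have [f fd zE] : exists2 f, aut_piece d.+1 f & z = aut_chart d.+1 f.
    apply: (zariski_closed_ideal (@aut_chart_closed d.+1)) => P hP.
    apply: h => w [f fd ->]; apply: hP; exists f => //.
    exact: aut_piece_mono fd.
  exists f => //.
  suff fb b v : SR_deg_le d (sel f b (SR_var K D v)).
    by move=> v; split; [apply: (fb true)|apply: (fb false)].
  have /SR_deg_leP hb := aut_piece_deg b v fd.
  apply/SR_deg_leP => m mD dm; case: (find_mnmP d.+1 mD) => [[k _ km]|[_]].
    have : ('X_(enum_rank ((b, v, k) : aut_coord d.+1)) :
              {mpoly K[#|aut_coord d.+1|]}).@[z 0] = 0.
      apply: h => w [g gd ->]; rewrite mevalXU aut_chartE.
      have /SR_deg_leP := aut_piece_deg b v gd.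
      by apply; rewrite km.
    by rewrite mevalXU zE aut_chartE km.
  exact: hb.
- have [Q QE] := aut_chart_sub d.+1 d.
  by exists Q => f fd i; apply: QE; apply: aut_piece_mono fd.
Qed.

Lemma aut_variety_cover f : exists d, aut_variety d f.
Proof.
exists (\sum_b \sum_v msize (SR_repr (sel f b (SR_var K D v)))) => v.
have h b : SR_deg_le (\sum_b \sum_v msize (SR_repr (sel f b (SR_var K D v))))
    (sel f b (SR_var K D v)).
  exists (SR_repr (sel f b (SR_var K D v))); last by rewrite SR_reprK.
  by apply: leqW; rewrite (bigD1 b) //= (bigD1 v) //= -addnA leq_addr.
by split; [apply: (h true)|apply: (h false)].
Qed.

Definition aut_ind_variety : ind_variety K alg_aut :=
  IndVariety aut_variety_incl aut_variety_cover.

Lemma sel_inv (f : alg_aut) b : sel f^-1%g b = sel f (~~ b).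
Proof. by case: b. Qed.

Lemma aut_ind_inv :
  is_ind_morphism aut_ind_variety aut_ind_variety (fun f : alg_aut => f^-1%g).
Proof.
move=> d; exists d; split=> [f fd v|]; first by have [] := fd v.
exists (fun i => let: (b, v, m) := enum_val i in
                 'X_(enum_rank ((~~ b, v, m) : aut_coord d))).
move=> f fd i; rewrite -[i]enum_valK; case: (enum_val i) => [[b v] m].
by rewrite aut_chartE enum_rankK mevalXU sel_inv [in RHS]aut_chartE.
Qed.

Definition fst_sel (b : bool) (p : alg_aut * alg_aut) : alg_aut :=
  if b then p.1 else p.2.

Lemma sel_mul p b u : sel (p.1 * p.2)%g b u =
  sel (fst_sel b p) b (sel (fst_sel (~~ b) p) b u).
Proof. by case: b. Qed.

Section Mul.
Variable d : nat.
Local Notation N := (adim (prod_variety (aut_variety d) (aut_variety d))).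

Definition sub_side (b : bool) (z : 'rV[K]_N) : 'rV[K]_#|aut_coord d| :=
  if b then lsubmx z else rsubmx z.

Lemma sub_sideE b p :
  sub_side b (prod_chart (aut_variety d) (aut_variety d) p) =
  aut_chart d (fst_sel b p).
Proof. by case: b; rewrite /= /prod_chart ?row_mxKl ?row_mxKr. Qed.

Lemma apoly_side b F : apoly F -> apoly (fun z => F (sub_side b z)).
Proof.
move=> [s sE].
exists [seq (sub_poly (if b then lshift _ else @rshift _ _) q.1, q.2) | q <- s].
move=> z; rewrite sE big_map; apply: eq_bigr => q _ /=.
by rewrite sub_polyE; congr (_ *: _); apply: meval_eq => i; case: b; rewrite mxE.
Qed.

Lemma apoly_mul b v : apoly (fun z : 'rV[K]_N =>
  SR_subst (dec (sub_side b z) b) (decp (sub_side (~~ b) z) b v)).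
Proof.
apply: (@apoly_ext _ (fun z => \sum_(m : face_mnm d)
  (sub_side (~~ b) z) 0 (enum_rank ((b, v, m) : aut_coord d)) *:
   mmap1 (dec (sub_side b z) b) (val (val m)))).
  move=> z; rewrite /SR_subst rmorph_sum /=; apply: eq_bigr => m _.
  by rewrite mmapZ mmapX mulr_algl.
apply: apoly_sum => m.
have a1 : apoly (fun z => mmap1 (dec (sub_side b z) b) (val (val m))).
  by apply: apoly_mmap1 => i; exact: (apoly_side b (@apoly_dec d b i)).
by case: b a1 => a1 /=; apply: apoly_ext (apolyZ _ a1) => z;
  rewrite /sub_side /= mxE.
Qed.

Lemma aut_mulE p b v : prod_points (aut_variety d) (aut_variety d) p ->
  let z := prod_chart (aut_variety d) (aut_variety d) p in
  sel (p.1 * p.2)%g b (SR_var K D v) =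
  SR_subst (dec (sub_side b z) b) (decp (sub_side (~~ b) z) b v).
Proof.
move=> [p1 p2] /=; have pb c : aut_piece d (fst_sel c p) by case: c.
rewrite !sub_sideE subst_dec_chart // pi_decp dec_chart // sel_mul.
by rewrite /SR_var.
Qed.
End Mul.

Lemma msize_decp d (z : 'rV[K]_#|aut_coord d|) b v : (msize (decp z b v) <= d.+1)%N.
Proof.
apply: (big_ind (fun p : R => msize p <= d.+1)%N).
- by rewrite msize0.
- by move=> p q hp hq; apply: leq_trans (msizeD_le _ _) _; rewrite geq_max hp.
- by move=> m _; apply: leq_trans (msizeZ_le _ _) _; rewrite msizeX bmdeg.
Qed.

Lemma aut_ind_mul :
  is_ind_morphism (prod_ind_variety aut_ind_variety aut_ind_variety)
    aut_ind_variety (fun p : alg_aut * alg_aut => (p.1 * p.2)%g).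
Proof.
move=> d; exists (d * d)%N; split=> [p pd v|].
  suff h b : SR_deg_le (d * d) (sel (p.1 * p.2)%g b (SR_var K D v)).
    by split; [apply: (h true)|apply: (h false)].
  rewrite (@aut_mulE d) //; apply: SR_subst_deg; last exact: msize_decp.
  by move=> i; apply: dec_deg.
pose N := adim (prod_variety (aut_variety d) (aut_variety d)).
have ex (i : 'I_#|aut_coord (d * d)|) : exists P : {mpoly K[N]},
    forall z : 'rV[K]_N, let: (b, v, m) := enum_val i in
    (SR_repr (SR_subst (dec (sub_side b z) b)
       (decp (sub_side (~~ b) z) b v)))@_(val (val m)) = P.@[z 0].
  case: (enum_val i) => [[b v] m].
  have mD : mnm_supp (val (val m)) \in faces D := valP m.
  exact: (apoly_coef mD (@apoly_mul d b v)).
have [P PE] := choice ex.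
exists P => p pd i; move: (PE i); rewrite -[i]enum_valK enum_rankK.
case: (enum_val i) => [[b v] m] PiE; rewrite aut_chartE -PiE.
by rewrite (@aut_mulE d).
Qed.

Definition aut_ind_group : ind_group K := IndGroup aut_ind_mul aut_ind_inv.

(* [X_D], as the zero locus of [SR_ideal D]; by [SR_variety_ideal] below its
   ring of regular functions is [SR_ring K D]. *)
Definition SR_points (x : 'rV[K]_#|V|) : Prop :=
  forall p, p \in SR_ideal D -> p.@[x 0] = 0.

Lemma SR_points_closed :
  zariski_closed (fun z => exists2 x, SR_points x & z = id x).
Proof.
exists (fun p => p \in SR_ideal D) => z.
by split=> [[x h ->]|h]; [exact: h|exists z].
Qed.

Definition SR_variety : variety K 'rV[K]_#|V| :=
  Variety (chart := id) (fun x y _ _ e => e) SR_points_closed.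

Lemma SR_variety_ideal (p : R) :
  (forall x, SR_variety x -> p.@[x 0] = 0) <-> p \in SR_ideal D.
Proof.
split=> [h|pI x]; last by apply.
apply/SR_idealP => m mD; set S := mnm_supp m.
pose q : R := \sum_(k <- msupp p | mnm_supp k \subset S) p@_k *: 'X_[k].
suff q0 : q = 0.
  have := congr1 (mcoeff m) q0; rewrite mcoeff0 raddf_sum /= => <-.
  have [mp|] := boolP (m \in msupp p); last first.
    move=> mp; rewrite (memN_msupp_eq0 mp) big_seq_cond big1 // => k /andP[kp _].
    rewrite mcoeffZ mcoeffX; case: eqP => [e|]; rewrite ?mulr0 //.
    by rewrite e (negPf mp) in kp.
  rewrite big_mkcond (bigD1_seq m) ?msupp_uniq //= subxx mcoeffZ mcoeffX eqxx.
  rewrite mulr1 big1 ?addr0 // => k /negPf km.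
  by case: ifP => // _; rewrite mcoeffZ mcoeffX km mulr0.
apply: mpoly_eval_eq0 => v.
pose x : 'rV[K]_#|V| := \row_i (if enum_val i \in S then v i else 0).
have Xx : SR_variety x.
  move=> r; rewrite unfold_in => /asboolP [c ->].
  rewrite raddf_sum big1 // => T TD /=; rewrite mevalM.
  have /subsetPn [w wT wS] : ~~ (T \subset S).
    by apply: contra TD; apply: face_subset.
  rewrite /SR_generator rmorph_prod (bigD1 w) //= mevalXU mxE enum_rankK.
  by rewrite (negPf wS) mul0r mulr0.
rewrite -(h x Xx) [p in RHS]mpolyE !raddf_sum /= big_mkcond /=.
apply: eq_bigr => k _; rewrite !mevalZ !mevalX.
case: ifP => [kS|/negbT /subsetPn [w]].
  congr (_ * _); apply: eq_bigr => i _; rewrite mxE.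
  case: ifP => // iS; suff -> : k i = 0%N by rewrite !expr0.
  apply/eqP; apply: contraFT iS => ki; apply: (subsetP kS).
  by rewrite inE enum_valK.
rewrite inE => kw wS; rewrite (bigD1 (enum_rank w)) //= mxE enum_rankK.
by rewrite (negPf wS) expr0n (negPf kw) mul0r mulr0.
Qed.

End Automorphisms.

(* Main.v *)
From mathcomp Require Import all_boot all_order all_algebra all_fingroup.
From mathcomp Require Import mpoly boolp zify.
Require Import Defs.

Set Implicit Arguments.
Unset Strict Implicit.
Unset Printing Implicit Defensive.

Import Order.TTheory GRing.Theory Num.Theory.
Local Open Scope ring_scope.

(** Let [n] and [m] be the numbers of vertices of the two complexes, and suppose that
[n >= m]. The diagonal torus of the first automorphism group has dimension [n]; an
isomorphism of ind-groups makes it act faithfully and algebraically on the second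
Stanley-Reisner ring, whose variables are then sums of weight vectors.

The first point is that this action is linearizable (lemma [linearization], for the
Lie algebra of the torus). A derivation preserves the ideals of the facets, hence
that of the core, the intersection of all facets; so the torus acts on the affine
space of the core. The subtorus acting trivially there fixes the origin and acts
faithfully on its cotangent space, which bounds its dimension ([core_kernel]). What
remains of the torus is so large that a function of weight zero on the core is
constant ([weight0_const]), which yields a fixed point ([fixed_point]); a
translation along the core, over which the complex is a cone, moves it to the
origin. At a fixed origin, weight components of the variables with independent
linear parts have linearly independent weights, so [n = m], and by comparing orders
at the origin they are new coordinates in which the torus is diagonal
([linearization_at_origin]). A determinant selects them so that the component
replacing a variable vanishes wherever this variable does, whence the
substitution respects the relations ([lift_facets]).

The second point is that the weights of the additive one-parameter groups
normalized by the diagonal torus are exactly the exponents of the derivations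
[x^m * d/dx_v] for which the support of [m] is an exposing face of [v]
([root_of_exposing] and [root_has_shape]). After linearization the isomorphism gives an injective integral
linear map that sends the weights for the second complex to weights for the first
([roots_transported]).

The third point is combinatorial. In a fully exposed complex every facet consists of
an exposing face and the vertex exposed by it, so the complex can be read off the
supports of these weights. A permutation in the expansion of a nonzero determinant
gives an injection of the vertices along which the matrix of the linear map has
nonzero entries, and applying the map to weights with large positive part shows that it
sends faces to faces ([roots_to_faces]). Exchanging the roles of the two complexes
gives an injection the other way, and counting faces shows that both are
isomorphisms ([bijection_of_faces]). *)

(** * Linear algebra *)

Lemma regroup (I : eqType) (T : Type) (M : nmodType) (s : seq T) (key : T -> I)
    (F : T -> M) (l : seq I) : uniq l -> {subset map key s <= l} ->
  \sum_(q <- s) F q = \sum_(i <- l) \sum_(q <- s | key q == i) F q.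
Proof.
move=> ul; elim: s => [|q s IH] sl.
  by rewrite big_nil big1 // => i _; rewrite big_nil.
rewrite big_cons IH => [|i si]; last by apply: sl; rewrite inE si orbT.
have ql : key q \in l by apply: sl; rewrite inE eqxx.
rewrite (bigD1_seq _ ql ul) [RHS](bigD1_seq _ ql ul) /= big_cons eqxx addrA.
congr (_ + _); apply: eq_bigr => i /negPf ni.
by rewrite big_cons eq_sym ni.
Qed.

Section LinearAlgebra.
Variable F : fieldType.

Lemma row_full_ker m n (N : 'M[F]_(m, n)) :
  (forall c : 'cV[F]_n, N *m c = 0 -> c = 0) -> row_full N.
Proof.
move=> h; suff : cokermx N = 0.
  move/eqP; rewrite -mxrank_eq0 mxrank_coker subn_eq0 => le.
  by rewrite /row_full eqn_leq rank_leq_col le.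
apply/matrixP => i j.
suff /colP /(_ i) : col j (cokermx N) = 0 by rewrite !mxE.
by apply: h; rewrite colE mulmxA mulmx_coker mul0mx.
Qed.

(** Enlarging a finite family of vectors satisfying [P] raises its rank as long as its
annihilator is not reduced to zero. *)
Lemma row_full_family n (P : 'rV[F]_n -> Prop) :
  (forall c : 'cV[F]_n, (forall x, P x -> x *m c = 0) -> c = 0) ->
  exists q (Z : 'M[F]_(q, n)), (forall i, P (row i Z)) /\ row_full Z.
Proof.
move=> h.
suff : forall r, (r <= n)%N ->
    exists q (Z : 'M[F]_(q, n)), (forall i, P (row i Z)) /\ (r <= \rank Z)%N.
  case/(_ n (leqnn n)) => q [Z [PZ nZ]]; exists q, Z; split=> //.
  by rewrite /row_full eqn_leq rank_leq_col.
elim=> [_|r IH rn]; first by exists 0%N, 0; split=> // -[].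
have [q [Z [PZ]]] := IH (ltnW rn).
rewrite leq_eqVlt => /orP [/eqP rZ|]; last by exists q, Z.
have nfull : ~ row_full Z by move/eqP => e; rewrite -e rZ ltnn in rn.
have [c [Zc c0]] : exists c : 'cV_n, Z *m c = 0 /\ c != 0.
  apply: contrapT => h'; apply/nfull/row_full_ker => c Zc.
  by apply: contrapT => /eqP c0; apply: h'; exists c.
have [x [Px xc]] : exists x, P x /\ x *m c != 0.
  apply: contrapT => h'; case/eqP: c0; apply: h => x Px.
  by apply: contrapT => /eqP c0; apply: h'; exists x.
exists (q + 1)%N, (col_mx Z x); split=> [i|].
  case: (split_ordP i) => j ->; first by rewrite rowKu.
  by rewrite rowKd row_id.
rewrite rZ; apply: rank_ltmx; rewrite ltmxE -addsmxE addsmxSl /=.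
apply/negP; rewrite col_mx_sub => /andP [_ /submxP [y xy]].
by case/eqP: xc; rewrite xy -mulmxA Zc mulmx0.
Qed.

(** The determinant is linear in each row, so that it is the sum of the determinants of
all the selections, one of which must be nonzero. *)
Lemma unitmx_select m (I : eqType) (M : 'M[F]_m) (s : 'I_m -> seq I)
    (r : 'I_m -> I -> 'rV[F]_m) :
  M \in unitmx -> (forall i, row i M = \sum_(j <- s i) r i j) ->
  exists f : 'I_m -> I,
    (forall i, f i \in s i) /\ \matrix_i r i (f i) \in unitmx.
Proof.
move=> uM rM.
suff [f [fs uN]] : exists f : 'I_m -> option I,
    (forall i, if f i is Some j then j \in s i else i \notin enum 'I_m) /\
    \matrix_i (if f i is Some j then r i j else row i M) \in unitmx.
  have g i : {j | f i = Some j & j \in s i}.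
    by apply: cid2; have := fs i; case: (f i) => [j|]; [exists j|rewrite mem_enum].
  exists (fun i => s2val (g i)); split=> [i|]; first by case: (g i).
  suff <- : \matrix_i (if f i is Some j then r i j else row i M) =
    \matrix_i r i (s2val (g i)) by [].
  by apply/row_matrixP => i; rewrite !rowK; case: (g i) => j /= ->.
(* The rows are replaced one at a time; [f] is undefined on the rows still to be
replaced. *)
elim: (enum 'I_m) => [|i l [f [fs uN]]].
  exists (fun=> None); split=> //; suff -> : \matrix_i row i M = M by [].
  by apply/row_matrixP => i; rewrite rowK.
case fi: (f i) => [j0|].
  exists f; split=> // k; have := fs k; case fk : (f k) => [//|].
  by rewrite inE negb_or => ->; rewrite andbT; apply/eqP => e; rewrite e fi in fk.
set N := \matrix_ _ _ in uN.
pose N' j := \matrix_k (if k == i then r i j else row k N).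
have [j sj uj] : exists2 j, j \in s i & N' j \in unitmx.
  apply: contrapT => h.
  have : \det N = \sum_(j <- s i) \det (N' j).
    rewrite (expand_det_row _ i).
    have Ni k : N i k = \sum_(j <- s i) r i j 0 k.
      by rewrite !mxE fi rM summxE.
    under eq_bigr do rewrite Ni mulr_suml.
    rewrite exchange_big /=; apply: eq_bigr => j _.
    rewrite (expand_det_row _ i); apply: eq_bigr => k _.
    rewrite [N' j i k]mxE eqxx; congr (_ * (_ * \det _)).
    apply/matrixP => a b; rewrite !mxE [_ == i]eq_sym (negPf (neq_lift _ _)).
    by rewrite !mxE.
  rewrite big_seq big1 => [d0|j sj].
    by rewrite unitmxE d0 unitr0 in uN.
  apply: contrapT => /eqP d0; apply: h; exists j => //.
  by rewrite unitmxE unitfE.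
exists (fun k => if k == i then Some j else f k); split=> [k|].
  case: eqP => [->//|/eqP ki]; have := fs k; case: (f k) => //.
  by rewrite inE negb_or ki.
suff <- : N' j = \matrix_k (if (if k == i then Some j else f k) is Some j'
  then r k j' else row k M) by [].
apply/row_matrixP => k; rewrite !rowK; case: eqP => [->//|_].
by case: (f k).
Qed.

(** The easy half of the theorem of Frobenius and Koenig: every permutation meets the
zero block. *)
Lemma det_zero_block m (M : 'M[F]_m) (P Q : {set 'I_m}) :
  {in P & Q, forall i j, M i j = 0} -> (m < #|P| + #|Q|)%N -> \det M = 0.
Proof.
move=> M0 mPQ; apply: big1 => s _.
have [i iP siQ] : exists2 i, i \in P & s i \in Q.
  apply: contrapT => h.
  have dis : [disjoint [set s x | x in P] & Q].
    rewrite disjoint_subset; apply/subsetP => _ /imsetP [i iP ->].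
    by rewrite inE; apply/negP => siQ; apply: h; exists i.
  have := subset_leq_card (subsetT ([set s x | x in P] :|: Q)).
  rewrite cardsU disjoint_setI0 // cards0 subn0 cardsT card_ord leqNgt.
  by rewrite card_imset ?mPQ //; exact: perm_inj.
by rewrite (bigD1 i) //= M0 // mul0r mulr0.
Qed.

Lemma unitmx_perm m (M : 'M[F]_m) : M \in unitmx ->
  exists s : 'S_m, forall i, M i (s i) != 0.
Proof.
move=> uM; apply: contrapT => h.
have : \det M = 0; last by move=> e; rewrite unitmxE e unitr0 in uM.
apply: big1 => s _; apply/eqP; rewrite mulf_eq0; apply/orP; right.
rewrite prodf_seq_eq0; apply/hasP; apply: contrapT => h'; apply: h; exists s => i.
by apply/negP => Mi; apply: h'; exists i.
Qed.

End LinearAlgebra.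

(** * Integers in characteristic zero *)

Lemma natr_inj_char0 (K : fieldType) : [pchar K] =i pred0 ->
  injective (fun k : nat => k%:R : K).
Proof.
move=> charK; have main a b : (a <= b)%N -> a%:R = b%:R :> K -> a = b.
  move=> ab /eqP; rewrite eq_sym -subr_eq0 -natrB //.
  by move/pcharf0P: charK => -> /eqP e; apply/eqP; rewrite eqn_leq ab -subn_eq0 e.
by move=> a b e; case: (leqP a b) => [|/ltnW] ab; [|apply/esym]; apply: main.
Qed.

Section Char0.
Variables (K : fieldType) (charK : [pchar K] =i pred0).

Lemma intr_eq0_char0 (z : int) : (z%:~R == 0 :> K) = (z == 0).
Proof.
have charK' := iffLR (pcharf0P K) charK.
case: z => k; first by rewrite -pmulrn charK'.
by rewrite NegzE mulrNz oppr_eq0 -pmulrn charK'.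
Qed.

Lemma intr_inj_char0 : injective (fun z : int => z%:~R : K).
Proof.
move=> a b /eqP; rewrite -subr_eq0 -rmorphB intr_eq0_char0 subr_eq0.
by move/eqP.
Qed.

Lemma expz2_eq1 (z : int) : (2%:R : K) ^ z = 1 -> z = 0.
Proof.
have main (k : nat) : (2%:R : K) ^+ k = 1 -> k = 0%N.
  rewrite -natrX -[1]/(1%:R) => /(natr_inj_char0 charK).
  move=> e; have := ltn_expl k (isT : 1 < 2)%N.
  by rewrite e ltnS leqn0 => /eqP.
case: z => k; first by rewrite -exprnP => /main ->.
rewrite NegzE -exprnN => h; have : (2%:R : K) ^+ k.+1 = 1.
  by rewrite -[LHS]invrK h invr1.
by move/main.
Qed.

(** A maximal minor is a nonzero integer, hence remains nonzero in characteristic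
zero. *)
Lemma int_kernel q n (X : 'M[int]_(q, n)) :
  (forall d : 'cV[int]_n, X *m d = 0 -> d = 0) ->
  forall c : 'cV[K]_n, map_mx intr X *m c = 0 -> c = 0.
Proof.
move=> h; have fX : row_full (map_mx (intr : int -> rat) X).
  apply: row_full_ker => c Xc.
  have [p [a a0 pE]] := rat_poly_scale (rVpoly c^T).
  pose d : 'cV[int]_n := \col_i p`_i.
  have cE : c = (a%:~R)^-1 *: map_mx intr d.
    apply/colP => i; rewrite !mxE -coef_map -coefZ -pE.
    by rewrite coef_rVpoly_ord mxE.
  rewrite cE (_ : d = 0) ?map_mx0 ?scaler0 //; apply: h.
  move/eqP: Xc; rewrite cE -scalemxAr scaler_eq0 invr_eq0 intr_eq0 (negPf a0) /=.
  rewrite -map_mxM => /eqP e; apply/matrixP => i j.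
  by have /matrixP /(_ i j) := e; rewrite !mxE => /eqP; rewrite intr_eq0 => /eqP.
have := fullrowsub_unit fX; set f := fullrankfun _ => uX c Xc.
have {}uX : rowsub f (map_mx (intr : int -> K) X) \in unitmx.
  have mE (L : fieldType) : rowsub f (map_mx (intr : int -> L) X) = map_mx intr (rowsub f X).
    by apply/matrixP => i j; rewrite !mxE.
  move: uX; rewrite !mE !unitmxE !det_map_mx !unitfE intr_eq0.
  by rewrite intr_eq0_char0.
rewrite -[c](mulKmx uX); suff -> : rowsub f (map_mx intr X) *m c = 0 by rewrite mulmx0.
by rewrite mul_rowsub_mx Xc; apply/matrixP => i j; rewrite !mxE.
Qed.

End Char0.

(** * Monomials of the Stanley-Reisner ring *)

Section MonomialSupport.
Variable V : finType.
Implicit Types m : 'X_{1..#|V|}.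

Lemma mnm_supp0 : mnm_supp (0%MM : 'X_{1..#|V|}) = set0.
Proof. by apply/setP => v; rewrite !inE mnm0E. Qed.

Lemma mnm_suppD m m' : mnm_supp (m + m')%MM = mnm_supp m :|: mnm_supp m'.
Proof. by apply/setP => v; rewrite !inE mnmDE addn_eq0 negb_and. Qed.

Lemma mnm_suppU i : mnm_supp U_(i) = [set enum_val i : V].
Proof.
apply/setP => v; rewrite !inE mnm1E -[v in RHS]enum_rankK (inj_eq enum_val_inj).
by rewrite [RHS]eq_sym; case: (i == _).
Qed.

Lemma mnm_supp_set (S : {set V}) : mnm_supp (set_mnm S) = S.
Proof. by apply/setP => v; rewrite !inE mnmE enum_rankK; case: (v \in S). Qed.

Lemma mem_mnm_supp m i : (enum_val i \in mnm_supp m) = (m i != 0%N).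
Proof. by rewrite inE enum_valK. Qed.

Lemma mnm_supp_le m m' : (m <= m')%MM -> mnm_supp m \subset mnm_supp m'.
Proof.
move=> /mnm_lepP le; apply/subsetP => v; rewrite !inE -!lt0n => h.
exact: leq_trans h (le _).
Qed.

End MonomialSupport.

Section Coefficients.
Variables (K : closedFieldType) (V : finType) (D : complex V).
Local Notation R := {mpoly K[#|V|]}.
Local Notation A := (SR_ring K D).
Local Notation pi := (@SR_pi K V D).
Implicit Types (u v : A) (m : 'X_{1..#|V|}) (S : {set V}).

Definition cf m u : K := (SR_repr u)@_m.

Lemma cf_pi (p : R) m : mnm_supp m \in faces D -> cf m (pi p) = p@_m.
Proof. exact: SR_coef_pi. Qed.

Lemma cfD u v m : mnm_supp m \in faces D -> cf m (u + v) = cf m u + cf m v.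
Proof. exact: SR_coefD. Qed.

Lemma cfZ a u m : mnm_supp m \in faces D -> cf m (a *: u) = a * cf m u.
Proof. exact: SR_coefZ. Qed.

Lemma cf0 m : mnm_supp m \in faces D -> cf m 0 = 0.
Proof. exact: SR_coef0. Qed.

Lemma cf1 m : mnm_supp m \in faces D -> cf m 1 = (m == 0%MM)%:R.
Proof. by move=> mD; rewrite -(rmorph1 pi) cf_pi // mcoeff1. Qed.

Lemma cf_sum (I : Type) (r : seq I) (P : pred I) (F : I -> A) m :
  mnm_supp m \in faces D ->
  cf m (\sum_(i <- r | P i) F i) = \sum_(i <- r | P i) cf m (F i).
Proof.
by move=> mD; apply: (big_morph _ (fun u v => cfD u v mD) (cf0 mD)).
Qed.

Lemma pi_nonface m : mnm_supp m \notin faces D -> pi 'X_[m] = 0.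
Proof.
move=> mD; apply/eqP; rewrite -(rmorph0 pi) SR_pi_eq subr0.
apply/SR_idealP => k kD; rewrite mcoeffX; case: eqP => // e.
by rewrite e kD in mD.
Qed.

Lemma piD p q : pi (p + q) = pi p + pi q. Proof. exact: rmorphD. Qed.

Lemma piM p q : pi (p * q) = pi p * pi q. Proof. exact: rmorphM. Qed.

Lemma pi_sum (I : Type) (r : seq I) (P : pred I) (F : I -> R) :
  pi (\sum_(i <- r | P i) F i) = \sum_(i <- r | P i) pi (F i).
Proof. exact: rmorph_sum. Qed.

Lemma piXD m k : pi 'X_[m + k] = pi 'X_[m] * pi 'X_[k].
Proof. by rewrite mpolyXD piM. Qed.

Lemma face0 : mnm_supp (0%MM : 'X_{1..#|V|}) \in faces D.
Proof. by rewrite mnm_supp0 face_empty. Qed.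

Lemma faceU i : mnm_supp (U_(i)%MM : 'X_{1..#|V|}) \in faces D.
Proof. by rewrite mnm_suppU face_vertex. Qed.

Lemma face_sub m S : S \in faces D -> mnm_supp m \subset S -> mnm_supp m \in faces D.
Proof. exact: face_subset. Qed.

Lemma cfX k m : mnm_supp m \in faces D -> cf m (pi 'X_[k]) = (k == m)%:R.
Proof. by move=> mD; rewrite cf_pi // mcoeffX. Qed.

Lemma monomial_expansion u :
  u = \sum_(m <- msupp (SR_repr u) | mnm_supp m \in faces D) cf m u *: pi 'X_[m].
Proof.
rewrite -[LHS]SR_reprK {1}[SR_repr u]mpolyE rmorph_sum /= [RHS]big_mkcond /=.
apply: eq_bigr => m _; rewrite SR_piZ /cf; case: ifP => // /negbT mD.
by rewrite pi_nonface ?scaler0.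
Qed.

(** Monomials off the faces are zero, and the others form a basis: an additive
property need only be checked on the monomials that occur. *)
Lemma monomial_ind (P : A -> Prop) u :
  P 0 -> (forall a b, P a -> P b -> P (a + b)) ->
  (forall m, mnm_supp m \in faces D -> cf m u != 0 -> P (cf m u *: pi 'X_[m])) ->
  P u.
Proof.
move=> P0 PD Pm; rewrite [u]monomial_expansion big_seq_cond.
apply: (big_ind P) => // m /andP [mu mD].
by apply: Pm; rewrite // /cf -mcoeff_msupp.
Qed.

Lemma cfMX u m k : mnm_supp (m + k)%MM \in faces D ->
  cf (m + k)%MM (u * pi 'X_[k]) = cf m u.
Proof.
move=> mD; have mD' : mnm_supp m \in faces D.
  by apply: face_subset mD _; rewrite mnm_suppD subsetUl.
have [p ->] := SR_pi_surj u.
by rewrite -rmorphM [RHS]cf_pi // cf_pi // addmC mcoeffMX.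
Qed.

Lemma lrmorph_pi (f : {lrmorphism A -> A}) (p : R) :
  f (pi p) = \sum_(m <- msupp p) p@_m *: \prod_i f (pi 'X_i) ^+ m i.
Proof.
by rewrite SR_substE /SR_subst /mmap; apply: eq_bigr => m _; rewrite mulr_algl.
Qed.

(** ** Order filtrations *)

Section Order.
Variable wt : 'I_#|V| -> nat.

Definition mwt m : nat := (\sum_i m i * wt i)%N.

(** The powers of the ideal of the origin, each variable counting with a weight
of its own. *)
Definition ord_ge k u :=
  forall m, mnm_supp m \in faces D -> (mwt m < k)%N -> cf m u = 0.

Lemma mwtD m m' : mwt (m + m')%MM = (mwt m + mwt m')%N.
Proof. by rewrite /mwt -big_split; apply: eq_bigr => i _; rewrite mnmDE mulnDl. Qed.

Lemma mwtU i : mwt U_(i) = wt i.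
Proof.
rewrite /mwt (bigD1 i) //= mnm1E eqxx mul1n big1 ?addn0 // => j ji.
by rewrite mnm1E eq_sym (negPf ji).
Qed.

Lemma ord_ge0 u : ord_ge 0 u. Proof. by []. Qed.

Lemma ord_zero k : ord_ge k 0. Proof. by move=> m mD _; apply: cf0. Qed.

Lemma ord_leq k l u : (k <= l)%N -> ord_ge l u -> ord_ge k u.
Proof. by move=> kl h m mD mk; apply: h => //; apply: leq_trans mk kl. Qed.

Lemma ordD k u v : ord_ge k u -> ord_ge k v -> ord_ge k (u + v).
Proof. by move=> hu hv m mD mk; rewrite cfD // hu // hv // addr0. Qed.

Lemma ordZ k a u : ord_ge k u -> ord_ge k (a *: u).
Proof. by move=> hu m mD mk; rewrite cfZ // hu // mulr0. Qed.

Lemma ordN k u : ord_ge k u -> ord_ge k (- u).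
Proof. by rewrite -scaleN1r; apply: ordZ. Qed.

Lemma ord_sum k (I : Type) (r : seq I) (P : pred I) (F : I -> A) :
  (forall i, P i -> ord_ge k (F i)) -> ord_ge k (\sum_(i <- r | P i) F i).
Proof. by move=> h; apply: big_ind => //; [apply: ord_zero|apply: ordD]. Qed.

Lemma ordX m : ord_ge (mwt m) (pi 'X_[m]).
Proof. by move=> k kD lt; rewrite cfX //; case: eqP lt => // ->; rewrite ltnn. Qed.

Lemma ordM k l u v : ord_ge k u -> ord_ge l v -> ord_ge (k + l) (u * v).
Proof.
move=> hu hv.
apply: (@monomial_ind (fun w => ord_ge (k + l) (w * v)) u).
- by rewrite mul0r; apply: ord_zero.
- by move=> a b ha hb; rewrite mulrDl; apply: ordD.
move=> m mD mu; rewrite -scalerAl; apply: ordZ.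
apply: (@monomial_ind (fun w => ord_ge (k + l) (_ * w)) v).
- by rewrite mulr0; apply: ord_zero.
- by move=> a b ha hb; rewrite mulrDr; apply: ordD.
move=> m' mD' mv; rewrite -scalerAr; apply: ordZ.
rewrite -piXD; apply: ord_leq (@ordX _).
rewrite mwtD leq_add //; rewrite leqNgt; apply/negP => lt.
  by rewrite hu ?eqxx in mu.
by rewrite hv ?eqxx in mv.
Qed.

Lemma ord_eq0 u : (forall k, ord_ge k u) -> u = 0.
Proof.
move=> h; apply: SR_coef_eq => m mD.
by rewrite -!/(cf m _) cf0 // (h (mwt m).+1).
Qed.

End Order.
End Coefficients.

(** * Restriction to faces, and derivations *)

Section Restriction.
Variables (K : closedFieldType) (V : finType) (D : complex V).
Local Notation R := {mpoly K[#|V|]}.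
Local Notation A := (SR_ring K D).
Local Notation pi := (@SR_pi K V D).
Implicit Types (u v : A) (m : 'X_{1..#|V|}) (S : {set V}).

Definition vanishes_on S u := forall m, mnm_supp m \subset S -> cf m u = 0.

Definition restr_var S (i : 'I_#|V|) : R := if enum_val i \in S then 'X_i else 0.

(** The restriction of a function to the coordinate subspace of a face. Its
values lie in a domain, which the Stanley-Reisner ring is not. *)
Definition restr S u : R := mmap (@mpolyC #|V| K) (restr_var S) (SR_repr u).

Lemma mmap_restr S (p : R) m :
  (mmap (@mpolyC #|V| K) (restr_var S) p)@_m =
  if mnm_supp m \subset S then p@_m else 0.
Proof.
have X k : mmap1 (restr_var S) k = if mnm_supp k \subset S then 'X_[k] else 0.
  rewrite /mmap1; case: ifP => [/subsetP kS|/negbT /subsetPn [v vk vS]].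
    rewrite mpolyXE_id; apply: eq_bigr => i _; rewrite /restr_var.
    case: ifP => // /negbT iS; suff -> : k i = 0%N by rewrite !expr0.
    by apply/eqP; apply: contraNT iS => ki; apply: kS; rewrite mem_mnm_supp.
  rewrite (bigD1 (enum_rank v)) //= /restr_var enum_rankK (negPf vS).
  by rewrite inE in vk; rewrite expr0n (negPf vk) mul0r.
rewrite /mmap raddf_sum /=.
under eq_bigr => k _ do rewrite X mcoeffCM.
have [mp|mp] := boolP (m \in msupp p); last first.
  rewrite (memN_msupp_eq0 mp) if_same big_seq_cond big1 // => k /andP [kp _].
  case: ifP; rewrite ?mcoeff0 ?mulr0 // mcoeffX.
  by case: eqP => [e|]; rewrite ?mulr0 // -e kp in mp *.
rewrite (bigD1_seq m) ?msupp_uniq //= big1 ?addr0 => [|k /negPf km].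
  by case: ifP; rewrite ?mcoeff0 ?mulr0 // mcoeffX eqxx mulr1.
by case: ifP; rewrite ?mcoeff0 ?mulr0 // mcoeffX km mulr0.
Qed.

Section Face.
Variables (S : {set V}) (SD : S \in faces D).

Lemma mcoeff_restr u m : (restr S u)@_m = if mnm_supp m \subset S then cf m u else 0.
Proof. exact: mmap_restr. Qed.

Lemma restr_pi p : restr S (pi p) = mmap (@mpolyC #|V| K) (restr_var S) p.
Proof.
apply/mpolyP => m; rewrite mcoeff_restr mmap_restr; case: ifP => // mS.
by rewrite cf_pi //; apply: face_sub mS.
Qed.

Lemma restrD u v : restr S (u + v) = restr S u + restr S v.
Proof.
apply/mpolyP => m; rewrite mcoeffD !mcoeff_restr.
by case: ifP => mS; rewrite ?addr0 // cfD //; apply: face_sub mS.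
Qed.

Lemma restrZ a u : restr S (a *: u) = a *: restr S u.
Proof.
apply/mpolyP => m; rewrite mcoeffZ !mcoeff_restr.
by case: ifP => mS; rewrite ?mulr0 // cfZ //; apply: face_sub mS.
Qed.

Lemma restr0 : restr S 0 = 0.
Proof. by rewrite -(scale0r 0) restrZ scale0r. Qed.

Lemma restr1 : restr S 1 = 1.
Proof. by rewrite -(rmorph1 pi) restr_pi rmorph1. Qed.

Lemma restr_sum (I : Type) (r : seq I) (P : pred I) (F : I -> A) :
  restr S (\sum_(i <- r | P i) F i) = \sum_(i <- r | P i) restr S (F i).
Proof. by apply: (big_morph _ restrD restr0). Qed.

Lemma restrM u v : restr S (u * v) = restr S u * restr S v.
Proof.
have [p ->] := SR_pi_surj u; have [q ->] := SR_pi_surj v.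
by rewrite -rmorphM !restr_pi rmorphM.
Qed.

Lemma vanishes_restr u : vanishes_on S u <-> restr S u = 0.
Proof.
split=> [h|h m mS]; last by have := mcoeff_restr u m; rewrite h mcoeff0 mS.
by apply/mpolyP => m; rewrite mcoeff_restr mcoeff0; case: ifP => // /h.
Qed.

Lemma vanishesD u v : vanishes_on S u -> vanishes_on S v -> vanishes_on S (u + v).
Proof. by rewrite !vanishes_restr restrD => -> ->; rewrite addr0. Qed.

Lemma vanishesZ a u : vanishes_on S u -> vanishes_on S (a *: u).
Proof. by rewrite !vanishes_restr restrZ => ->; rewrite scaler0. Qed.

Lemma vanishesMl u v : vanishes_on S u -> vanishes_on S (u * v).
Proof. by rewrite !vanishes_restr restrM => ->; rewrite mul0r. Qed.

Lemma vanishes0 : vanishes_on S 0.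
Proof. by apply/vanishes_restr; exact: restr0. Qed.

Lemma vanishes_sum (I : Type) (r : seq I) (P : pred I) (F : I -> A) :
  (forall i, P i -> vanishes_on S (F i)) -> vanishes_on S (\sum_(i <- r | P i) F i).
Proof. by move=> h; apply: big_ind => //; [apply: vanishes0|apply: vanishesD]. Qed.

Lemma vanishesX m : ~~ (mnm_supp m \subset S) -> vanishes_on S (pi 'X_[m]).
Proof.
move=> mS k kS; rewrite cfX; last exact: face_sub kS.
by case: eqP => // e; rewrite e kS in mS.
Qed.

End Face.

Lemma exists_facet S : S \in faces D -> exists2 F, F \in facets D & S \subset F.
Proof.
move=> SD; have [F] := @maxset_exists _ [pred S | S \in faces D] S SD.
by move=> maxF SF; exists F; rewrite ?inE.
Qed.

Lemma facet_face F : F \in facets D -> F \in faces D.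
Proof. by rewrite inE => /maxsetp. Qed.

Lemma facet_max F S : F \in facets D -> S \in faces D -> F \subset S -> S = F.
Proof. by rewrite inE => /maxsetP [_ h] SD FS; apply: h. Qed.

Lemma vanishes_on_facets u : (forall F, F \in facets D -> vanishes_on F u) -> u = 0.
Proof.
move=> h; apply: SR_coef_eq => m mD; rewrite -!/(cf m _) cf0 //.
by have [F FD mF] := exists_facet mD; apply: h FD _ mF.
Qed.

(** The vertices over which the complex is a cone. *)
Definition core : {set V} := \bigcap_(F in facets D) F.

Lemma core_sub F : F \in facets D -> core \subset F.
Proof. exact: bigcap_inf. Qed.

Lemma core_face : core \in faces D.
Proof.
have [F FD _] := exists_facet (face_empty D).
exact: face_subset (facet_face FD) (core_sub FD).
Qed.

Lemma notin_core (x : V) : x \notin core -> exists2 F, F \in facets D & x \notin F.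
Proof.
move=> xC; apply: contrapT => h; case/negP: xC; apply/bigcapP => F FD.
by apply: contrapT => /negP xF; apply: h; exists F.
Qed.

(** ** Derivations *)

Definition derivation (E : A -> A) : Prop :=
  (forall a u v, E (a *: u + v) = a *: E u + E v) /\
  (forall u v, E (u * v) = E u * v + u * E v).

Section Derivation.
Variables (E : A -> A) (dE : derivation E).

Lemma der0 : E 0 = 0.
Proof. by have := dE.1 (-1) 0 0; rewrite scaler0 addr0 scaleN1r addNr. Qed.

Lemma derD u v : E (u + v) = E u + E v.
Proof. by have := dE.1 1 u v; rewrite !scale1r. Qed.

Lemma derZ a u : E (a *: u) = a *: E u.
Proof. by have := dE.1 a u 0; rewrite der0 !addr0. Qed.

Lemma derM u v : E (u * v) = E u * v + u * E v.
Proof. exact: dE.2. Qed.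

Lemma der1 : E 1 = 0.
Proof.
have := derM 1 1; rewrite !mulr1 mul1r => /eqP.
by rewrite -subr_eq0 opprD addrA subrr sub0r oppr_eq0 => /eqP.
Qed.

Lemma der_sum (I : Type) (r : seq I) (P : pred I) (F : I -> A) :
  E (\sum_(i <- r | P i) F i) = \sum_(i <- r | P i) E (F i).
Proof. by apply: (big_morph _ derD der0). Qed.

Lemma der_chain (p : R) : E (pi p) = \sum_i pi p^`M(i) * E (pi 'X_i).
Proof.
pose Q p := E (pi p) = \sum_i pi p^`M(i) * E (pi 'X_i).
have Q1 : Q 1.
  rewrite /Q rmorph1 der1 big1 // => i _.
  by rewrite -mpolyC1 mderivC rmorph0 mul0r.
have QM p1 p2 : Q p1 -> Q p2 -> Q (p1 * p2).
  rewrite /Q rmorphM derM => -> ->; rewrite mulr_suml mulr_sumr -big_split /=.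
  by apply: eq_bigr => i _; rewrite mderivM rmorphD !rmorphM /= mulrDl !mulrA;
    congr (_ + _); rewrite mulrAC.
have QU i : Q 'X_i.
  rewrite /Q (bigD1 i) //= mderivX mnm1E eqxx scale1r.
  have -> : (U_(i) - U_(i))%MM = 0%MM :> 'X_{1..#|V|}.
    by apply/mnmP => j; rewrite mnmBE subnn mnm0E.
  rewrite mpolyX0 rmorph1 mul1r big1 ?addr0 // => j /negPf ji.
  by rewrite mderivX mnm1E eq_sym ji scale0r rmorph0 mul0r.
suff : Q p by [].
rewrite [p]mpolyE; apply: (big_ind Q).
- by rewrite /Q rmorph0 der0 big1 // => i _; rewrite mderiv0 rmorph0 mul0r.
- move=> p1 p2; rewrite /Q rmorphD derD => -> ->; rewrite -big_split /=.
  by apply: eq_bigr => i _; rewrite mderivD rmorphD mulrDl.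
move=> m _; suff : Q 'X_[m].
  rewrite /Q SR_piZ derZ => ->; rewrite scaler_sumr; apply: eq_bigr => i _.
  by rewrite mderivZ SR_piZ scalerAl.
rewrite mpolyXE_id; apply: (big_ind Q) => // i _.
by elim: (m i) => [|k IH]; rewrite ?expr0 // exprS; apply: QM.
Qed.

(** The ideal of a facet [F] is the annihilator of the monomial [x_F], and also of
its square, so that Leibniz' rule applied to [u * x_F = 0] keeps it stable. *)
Lemma der_vanishes_facet F u :
  F \in facets D -> vanishes_on F u -> vanishes_on F (E u).
Proof.
move=> FD uF m mF; pose k : 'X_{1..#|V|} := set_mnm F.
have kF : mnm_supp k = F by apply: mnm_supp_set.
have ux0 : u * pi 'X_[k] = 0.
  apply: (@monomial_ind _ _ _ (fun w => w * pi 'X_[k] = 0) u).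
  - by rewrite mul0r.
  - by move=> a b ha hb; rewrite mulrDl ha hb addr0.
  move=> l lD lu; rewrite -scalerAl -piXD pi_nonface ?scaler0 //.
  rewrite mnm_suppD kF; apply/negP => h.
  have e := facet_max FD h (subsetUr _ _).
  by rewrite uF ?eqxx // -e subsetUl in lu.
have := congr1 (fun w => E w * pi 'X_[k]) ux0.
rewrite der0 mul0r derM mulrDl [_ * E _ * _]mulrAC ux0 mul0r addr0.
rewrite -mulrA -!piXD => e.
have mD : mnm_supp (m + (k + k))%MM \in faces D.
  by rewrite !mnm_suppD kF setUid (setUidPr mF) facet_face.
by rewrite -(cfMX (E u) mD) e cf0.
Qed.

Lemma der_vanishes_core u : vanishes_on core u -> vanishes_on core (E u).
Proof.
move=> uC; apply: (@monomial_ind _ _ _ (fun w => vanishes_on core (E w)) u).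
- by rewrite der0; apply/vanishes0/core_face.
- by move=> a b ha hb; rewrite derD; apply: vanishesD => //; apply: core_face.
move=> m mD mu; rewrite derZ; apply: (vanishesZ core_face).
have /subsetPn [v vm] : ~~ (mnm_supp m \subset core).
  by apply: contra mu => /uC ->.
move=> /notin_core [F FD vF] k kC.
apply: (der_vanishes_facet FD); last exact: subset_trans kC (core_sub FD).
apply: (vanishesX (facet_face FD)); apply/subsetPn; by exists v.
Qed.

(** By the chain rule a derivation is controlled by its values on the variables. The
shift [e] is 0 for derivations fixing the origin, and 1 for those to be shown
nilpotent. *)
Lemma der_ord (wt : 'I_#|V| -> nat) e :
  (forall i, ord_ge wt (wt i + e) (E (pi 'X_i))) ->
  forall k u, ord_ge wt k u -> ord_ge wt (k + e) (E u).
Proof.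
move=> h k u uk; apply: (@monomial_ind _ _ _ (fun w => ord_ge wt (k + e) (E w)) u).
- by rewrite der0; apply: ord_zero.
- by move=> a b ha hb; rewrite derD; apply: ordD.
move=> m mD mu; rewrite derZ; apply: ordZ; rewrite der_chain.
have km : (k <= mwt wt m)%N.
  by rewrite leqNgt; apply: contra mu => lt; rewrite uk.
apply: ord_sum => i _; rewrite mderivX.
case mi : (m i) => [|l]; first by rewrite scale0r rmorph0 mul0r; apply: ord_zero.
rewrite SR_piZ -scalerAl; apply: ordZ.
apply: ord_leq (ordM (@ordX _ _ D wt (m - U_(i))%MM) (h i)).
rewrite addnA leq_add2r; apply: leq_trans km _.
by rewrite -(mwtU wt i) -mwtD submK // lep1mP mi.
Qed.

End Derivation.

(** ** Linear parts *)

Definition lin u : 'rV[K]_#|V| := \row_i cf U_(i) u.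

Lemma linD u v : lin (u + v) = lin u + lin v.
Proof. by apply/rowP => i; rewrite !mxE cfD ?faceU. Qed.

Lemma linZ a u : lin (a *: u) = a *: lin u.
Proof. by apply/rowP => i; rewrite !mxE cfZ ?faceU. Qed.

Lemma lin0 : lin 0 = 0.
Proof. by apply/rowP => i; rewrite !mxE cf0 ?faceU. Qed.

Lemma lin_sum (I : Type) (r : seq I) (P : pred I) (F : I -> A) :
  lin (\sum_(i <- r | P i) F i) = \sum_(i <- r | P i) lin (F i).
Proof. by apply: (big_morph _ linD lin0). Qed.

Lemma linX i : lin (pi 'X_i) = delta_mx 0 i.
Proof. by apply/rowP => j; rewrite !mxE cfX ?faceU // eq_mnm1 eq_sym. Qed.

Local Notation wt1 := (fun _ : 'I_#|V| => 1%N).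

Lemma mwt1 m : mwt wt1 m = mdeg m.
Proof. by rewrite mdegE; apply: eq_bigr => i _; rewrite muln1. Qed.

Lemma ord1P u : ord_ge wt1 1 u <-> cf 0%MM u = 0.
Proof.
split=> [h|h m mD]; first by apply: h; rewrite ?face0 // mwt1 mdeg0.
by rewrite mwt1 ltnS leqn0 mdeg_eq0 => /eqP ->.
Qed.

Lemma ord2P u : ord_ge wt1 2 u <-> cf 0%MM u = 0 /\ lin u = 0.
Proof.
split=> [h|[h0 h1] m mD].
  split; first by apply: h; rewrite ?face0 // mwt1 mdeg0.
  by apply/rowP => i; rewrite !mxE h ?faceU // mwt1 mdeg1.
rewrite mwt1 ltnS leq_eqVlt ltnS leqn0 mdeg_eq0 => /orP [/mdeg1P [i /eqP ->]|].
  by have := congr1 (fun r : 'rV_#|V| => r 0 i) h1; rewrite !mxE.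
by move=> /eqP ->.
Qed.

Lemma linM u v : cf 0%MM v = 0 -> lin (u * v) = cf 0%MM u *: lin v.
Proof.
move=> v0; pose w := u - cf 0%MM u *: 1.
have w1 : ord_ge wt1 1 w.
  apply/ord1P; rewrite cfD ?face0 // -scaleNr cfZ ?face0 // cf1 ?face0 //.
  by rewrite eqxx mulr1 subrr.
have -> : u = w + cf 0%MM u *: 1 by rewrite subrK.
have /ord2P [_ e] := ordM w1 (iffRL (ord1P v) v0).
rewrite mulrDl linD e add0r -scalerAl mul1r linZ; congr (_ *: _).
by rewrite cfD ?face0 // (iffLR (ord1P w) w1) add0r cfZ ?face0 // cf1 ?face0 // eqxx
  mulr1.
Qed.

(** A derivation that preserves the ideal of the origin acts on the cotangent
space there by the matrix of the linear parts of the images of the variables. *)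
Definition lin_mx (E : A -> A) : 'M[K]_#|V| := \matrix_i lin (E (pi 'X_i)).

Lemma lin_der E u : derivation E -> (forall i, cf 0%MM (E (pi 'X_i)) = 0) ->
  lin (E u) = lin u *m lin_mx E.
Proof.
move=> dE h; rewrite mulmx_sum_row; have [p ->] := SR_pi_surj u.
rewrite (der_chain dE) lin_sum; apply: eq_bigr => i _.
rewrite linM // rowK !mxE !cf_pi ?face0 ?faceU // mcoeff_mderiv add0m.
by rewrite mnm0E mulr1n.
Qed.

End Restriction.

(** * Weight vectors *)

(** Artin's argument for the independence of characters. The predicate [P] bears on
families of vectors indexed by distinct characters, and is stable under linear
combinations and under multiplication by the values of the characters; the
members of the family are then isolated by cancelling the others one by one. *)
Lemma character_separation (K : fieldType) (I : eqType) (J : Type) (M : lmodType K)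
    (chi : I -> J -> K) (P : (I -> M) -> Prop) (s : seq I) (a : I -> M) :
  (forall a b c, P a -> P b -> P (fun i => c *: a i + b i)) ->
  (forall a j, P a -> P (fun i => chi i j *: a i)) ->
  {in s &, forall i i', i != i' -> exists j, chi i j != chi i' j} ->
  (forall i, i \notin s -> a i = 0) -> P a ->
  {in s, forall i, P (fun i' => if i' == i then a i else 0)}.
Proof.
move=> Plin Pchi.
elim: {s}(size s).+1 {-2}s (ltnSn (size s)) a => [//|k IH] s sk a sep a0 Pa i si.
have [/hasP [i1 s1 /= i1i]|] := boolP (has (predC1 i) s); last first.
  rewrite -all_predC => /allP h; rewrite [X in P X](_ : _ = a) //.
  apply/funext => i'; case: eqP => [->//|/eqP ne]; apply/esym/a0.
  by apply: contra ne => /h; rewrite /= negbK.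
have [j ji] := sep i i1 si s1 (contra_neq (@esym _ _ _) i1i).
pose s' := [seq x <- s | x != i1].
pose b i' := (- chi i1 j) *: a i' + chi i' j *: a i'.
have s'k : (size s' < k)%N.
  rewrite -ltnS; apply: leq_trans sk; rewrite ltnS size_filter.
  rewrite -(count_predC (predC1 i1) s) -addn1 leq_add2l.
  by rewrite -has_count; apply/hasP; exists i1 => //=; rewrite negbK.
have sub_s x : x \in s' -> x \in s by rewrite mem_filter => /andP [].
have {}IH := IH s' s'k b.
have : P (fun i' => if i' == i then b i else 0).
  apply: IH => [x y /sub_s xs /sub_s ys|x||].
  - exact: sep.
  - rewrite mem_filter negb_and negbK /b => /orP [/eqP ->|/a0 ->].
      by rewrite -scalerDl addNr scale0r.
    by rewrite !scaler0 addr0.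
  - by apply: (Plin a) => //; apply: Pchi.
  by rewrite mem_filter eq_sym i1i si.
have d0 : chi i j - chi i1 j != 0 by rewrite subr_eq0.
move=> h; have := Plin _ _ ((chi i j - chi i1 j)^-1 - 1) h h.
rewrite [X in P X -> _](_ : _ = (fun i' => if i' == i then a i else 0)) //.
apply/funext => i' /=; case: eqP => _; last by rewrite scaler0 addr0.
rewrite -{2}[b i]scale1r -scalerDl subrK /b -scalerDl scalerA.
by rewrite [- _ + _]addrC (mulVf d0) scale1r.
Qed.

Section Weights.
Variables (K : closedFieldType) (W : finType) (D : complex W).
Local Notation R := {mpoly K[#|W|]}.
Local Notation A := (SR_ring K D).
Local Notation pi := (@SR_pi K W D).
Variables (n : nat) (E : 'I_n -> A -> A).
Implicit Types (u v : A) (chi : 'rV[K]_n) (c : 'cV[K]_n).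

Definition weight_vec chi u := forall k, E k u = chi 0 k *: u.

(** The infinitesimal form of a faithful action of an [n]-dimensional torus: the
derivations [E k] are simultaneously diagonalizable and linearly independent. *)
Record toral : Prop := Toral {
  toral_der : forall k, derivation (E k);
  toral_decomp : forall u, exists s : seq 'rV[K]_n, exists a : 'rV[K]_n -> A,
    [/\ uniq s, forall chi, weight_vec chi (a chi) & u = \sum_(chi <- s) a chi];
  toral_free : forall c, (forall u, \sum_k c k 0 *: E k u = 0) -> c = 0
}.

Hypothesis tE : toral.
Let dE := toral_der tE.

Lemma weightD chi u v : weight_vec chi u -> weight_vec chi v -> weight_vec chi (u + v).
Proof. by move=> hu hv k; rewrite (derD (dE k)) hu hv scalerDr. Qed.

Lemma weightZ chi a u : weight_vec chi u -> weight_vec chi (a *: u).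
Proof. by move=> hu k; rewrite (derZ (dE k)) hu !scalerA mulrC. Qed.

Lemma weight0 chi : weight_vec chi 0.
Proof. by move=> k; rewrite (der0 (dE k)) scaler0. Qed.

Lemma weight1 : weight_vec 0 1.
Proof. by move=> k; rewrite (der1 (dE k)) mxE scale0r. Qed.

Lemma weight_sum chi (I : Type) (r : seq I) (P : pred I) (F : I -> A) :
  (forall i, P i -> weight_vec chi (F i)) ->
  weight_vec chi (\sum_(i <- r | P i) F i).
Proof. by move=> h; apply: big_ind => //; [apply: weight0|apply: weightD]. Qed.

Lemma weightM chi chi' u v :
  weight_vec chi u -> weight_vec chi' v -> weight_vec (chi + chi') (u * v).
Proof.
by move=> hu hv k; rewrite (derM (dE k)) hu hv mxE scalerDl scalerAl scalerAr.
Qed.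

Lemma weightX chi u l : weight_vec chi u -> weight_vec (chi *+ l) (u ^+ l).
Proof.
move=> hu; elim: l => [|l IH]; first exact: weight1.
by rewrite mulrS exprS; apply: weightM.
Qed.

Definition dir c u := \sum_k c k 0 *: E k u.

Lemma dir_der c : derivation (dir c).
Proof.
split=> [a u v|u v]; rewrite /dir.
  rewrite scaler_sumr -big_split /=; apply: eq_bigr => k _.
  by rewrite (dE k).1 scalerDr !scalerA mulrC.
rewrite mulr_suml mulr_sumr -big_split /=; apply: eq_bigr => k _.
by rewrite (dE k).2 scalerDr scalerAl scalerAr.
Qed.

Lemma dir_weight c chi u : weight_vec chi u -> dir c u = (chi *m c) 0 0 *: u.
Proof.
move=> hu; rewrite /dir mxE scaler_suml; apply: eq_bigr => k _.
by rewrite hu scalerA mulrC.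
Qed.

(** Stable subspaces are graded, by [character_separation]. This will be applied to
the ideals of faces, to the order filtrations and to zero. *)
Lemma weight_components (U : A -> Prop) (I : eqType) (s : seq I)
    (chi : I -> 'rV[K]_n) (a : I -> A) :
  U 0 -> (forall (x : K) u v, U u -> U v -> U (x *: u + v)) ->
  (forall k u, U u -> U (E k u)) ->
  uniq s -> {in s &, injective chi} -> (forall i, weight_vec (chi i) (a i)) ->
  U (\sum_(i <- s) a i) -> {in s, forall i, U (a i)}.
Proof.
move=> U0 Ulin UE us inj_chi aw Ua i si.
pose b i := if i \in s then a i else 0.
pose P (f : I -> A) := (forall i, weight_vec (chi i) (f i)) /\ U (\sum_(i <- s) f i).
have [_] : P (fun i' => if i' == i then b i else 0).
  apply: (@character_separation _ _ _ _ (fun i j => chi i 0 j) P s) => //.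
  - move=> f g c [fw Uf] [gw Ug]; split=> [j|].
      by apply: weightD => //; apply: weightZ.
    by rewrite big_split -scaler_sumr; apply: Ulin.
  - move=> f j [fw Uf]; split=> [l|]; first exact: weightZ.
    suff <- : E j (\sum_(l <- s) f l) = \sum_(l <- s) chi l 0 j *: f l by exact: UE.
    by rewrite (der_sum (dE j)); apply: eq_bigr => l _; apply: fw.
  - move=> j l sj sl; apply: contraNP => h.
    apply/eqP/inj_chi => //; apply/rowP => k.
    by apply/eqP/negPn/negP => hk; apply: h; exists k.
  - by move=> j /negPf sj; rewrite /b sj.
  split=> [l|]; first by rewrite /b; case: ifP => // _; apply: weight0.
  by rewrite (eq_big_seq a) // /b => l ->.
by rewrite (bigD1_seq i) //= eqxx big1 ?addr0 /b ?si // => j /negPf ->.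
Qed.

Lemma weight_independence (I : eqType) (s : seq I) (chi : I -> 'rV[K]_n) (a : I -> A) :
  uniq s -> {in s &, injective chi} -> (forall i, weight_vec (chi i) (a i)) ->
  \sum_(i <- s) a i = 0 -> {in s, forall i, a i = 0}.
Proof.
apply: (weight_components (U := fun u => u = 0)) => //.
  by move=> c u v -> ->; rewrite scaler0 addr0.
by move=> k u ->; rewrite (der0 (dE k)).
Qed.

End Weights.

(** * A fixed point of the torus *)

Lemma mpoly_algebra_ind (K : closedFieldType) n (Q : {mpoly K[n]} -> Prop) :
  (forall a p q, Q p -> Q q -> Q (a *: p + q)) -> Q 1 ->
  (forall p q, Q p -> Q q -> Q (p * q)) -> (forall i, Q 'X_i) -> forall p, Q p.
Proof.
move=> Qlin Q1 QM QX p; rewrite [p]mpolyE; apply: (big_ind Q).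
- by rewrite -(addNr 1) -scaleN1r; apply: Qlin.
- by move=> q r Qq Qr; rewrite -[q]scale1r; apply: Qlin.
move=> m _; have Q0 : Q 0 by rewrite -(addNr 1) -scaleN1r; apply: Qlin.
rewrite -[_ *: _]addr0; apply: Qlin => //.
rewrite mpolyXE_id; apply: (big_ind Q) => // i _.
by elim: (m i) => [|k IH]; rewrite ?expr0 // exprS; apply: QM.
Qed.

Section FixedPoint.
Variables (K : closedFieldType) (charK : [pchar K] =i pred0).
Variables (W : finType) (D : complex W).
Local Notation m := #|W|.
Local Notation R := {mpoly K[m]}.
Local Notation A := (SR_ring K D).
Local Notation pi := (@SR_pi K W D).
Variables (n : nat) (E : 'I_n -> A -> A) (tE : toral E).
Implicit Types (u v : A) (chi : 'rV[K]_n) (c : 'cV[K]_n).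
Let dE := toral_der tE.
Local Notation r := (restr (core D)).
Let CD := core_face D.
Let wt (i : 'I_m) : nat := if enum_val i \in core D then 2%N else 3%N.

(** If a derivation of the torus raises the order then it is nilpotent modulo each
power of the ideal of the origin, and being diagonalizable it vanishes. *)
Lemma toral_raise_order w c :
  (forall i, ord_ge w (w i + 1) (dir E c (pi 'X_i))) -> c = 0.
Proof.
move=> h; apply: (toral_free tE) => u; rewrite -/(dir E c u).
have dc := dir_der tE c.
have [s [a [_ aw ->]]] := toral_decomp tE u.
rewrite (der_sum dc) big1 // => chi _; rewrite (dir_weight _ (aw chi)).
have [->|x0] := eqVneq ((chi *m c) 0 0) 0; first by rewrite scale0r.
suff -> : a chi = 0 by rewrite scaler0.
(* A nonzero eigenvalue lets the order be raised indefinitely. *)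
apply: (ord_eq0 (wt := w)) => k; elim: k => [|k IH]; first exact: ord_ge0.
rewrite -[a chi](scalerK x0) scalerA mulVf // scale1r -[a chi]scale1r -(mulVf x0).
rewrite -scalerA -(dir_weight _ (aw chi)); apply: ordZ.
by have := der_ord dc h IH; rewrite addn1.
Qed.

Lemma core_components (i : 'I_m) s (a : 'rV[K]_n -> A) : enum_val i \notin core D ->
  uniq s -> (forall chi, weight_vec E chi (a chi)) ->
  pi 'X_i = \sum_(chi <- s) a chi -> {in s, forall chi, vanishes_on (core D) (a chi)}.
Proof.
move=> iC us aw xE; apply: (weight_components tE (chi := id)) => //.
- exact: vanishes0.
- by move=> x u v hu hv; apply: vanishesD => //; apply: vanishesZ.
- by move=> k u; apply: der_vanishes_core.
rewrite -xE. apply: (vanishesX _ CD); rewrite mnm_suppU sub1set.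
exact: iC.
Qed.

(** The directions of the torus that act trivially on the functions on the core fix
the origin, and act on its cotangent space through the weights of [#|W| - #|core|]
vectors: a direction killing all these weights vanishes, since it raises the
order when the variables off the core count 3 and those of the core count 2. *)
Lemma core_kernel : exists kappa : 'I_m -> 'rV[K]_n, forall c,
  (forall i, enum_val i \notin core D -> kappa i *m c = 0) ->
  (forall chi u, weight_vec E chi u -> r u != 0 -> chi *m c = 0) -> c = 0.
Proof.
pose dec (i : 'I_m) (p : seq 'rV[K]_n * ('rV[K]_n -> A)) :=
  [/\ uniq p.1, forall chi, weight_vec E chi (p.2 chi) &
      pi 'X_i = \sum_(chi <- p.1) p.2 chi].
have exdec i : exists p, dec i p.
  by have [s [a h]] := toral_decomp tE (pi 'X_i); exists (s, a).
have [sa saP] := choice exdec.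
pose s i := if enum_val i \in core D then [:: 0] else (sa i).1.
pose y i chi := if enum_val i \in core D then pi 'X_i else (sa i).2 chi.
have lin1 i : row i 1%:M = \sum_(chi <- s i) lin (y i chi).
  rewrite -lin_sum row1 -(@linX _ _ D); congr lin; rewrite /s /y; case: ifP => iC.
    by rewrite big_seq1.
  by have [_ _ ->] := saP i.
have [kappa [ks uY]] := unitmx_select (unitmx1 _ _) lin1.
set Y := (X in X \in unitmx) in uY.
exists kappa => c kc rc.
have dc := dir_der tE c.
have vC i : vanishes_on (core D) (dir E c (pi 'X_i)).
  have [us aw ->] := saP i; rewrite (der_sum dc); apply: (vanishes_sum CD) => chi _.
  rewrite (dir_weight _ (aw chi)); have [r0|r0] := eqVneq (r ((sa i).2 chi)) 0.
    by apply/vanishesZ/vanishes_restr.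
  by rewrite (rc _ _ (aw chi) r0) mxE scale0r; apply: vanishes0.
have c0 i : cf 0%MM (dir E c (pi 'X_i)) = 0.
  by apply: vC; rewrite mnm_supp0 sub0set.
(* The image of [dir E c] vanishes on the core, so its linear part involves only the
variables off the core, where the chosen vectors form a basis killed by it. *)
pose M' : 'M[K]_m := \matrix_i if enum_val i \in core D then 0
                               else lin (dir E c (pi 'X_i)).
have YM : Y *m M' = 0.
  apply/row_matrixP => i; rewrite row_mul row0 rowK.
  have [iC|iC] := boolP (enum_val i \in core D).
    by rewrite /y iC linX -rowE rowK iC.
  have yC : vanishes_on (core D) (y i (kappa i)).
    rewrite /y (negPf iC); have [us aw xE] := saP i.
    by apply: (core_components iC us aw xE); have := ks i; rewrite /s (negPf iC).
  have : lin (dir E c (y i (kappa i))) = 0.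
    rewrite /y (negPf iC); have [_ aw _] := saP i.
    by rewrite (dir_weight _ (aw _)) kc // mxE scale0r lin0.
  rewrite (lin_der _ dc c0) !mulmx_sum_row => e; rewrite -[RHS]e.
  apply: eq_bigr => j _; rewrite !rowK; case: ifP => // jC.
  by rewrite mxE yC ?scale0r // mnm_suppU sub1set.
have M0 i : enum_val i \notin core D -> lin (dir E c (pi 'X_i)) = 0.
  move=> iC; have : M' = 0 by rewrite -(mulKmx uY M') YM mulmx0.
  by move/(congr1 (row i)); rewrite rowK row0 (negPf iC).
(* A monomial not supported on the core has weight at least 3, and one of degree at
least 2 has weight at least 4. *)
apply: (@toral_raise_order wt) => i l lD lt.
have [lC|/subsetPn [x xl xC]] := boolP (mnm_supp l \subset core D); first exact: vC.
have lx : (3 <= mwt wt l)%N.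
  rewrite /mwt (bigD1 (enum_rank x)) //= /wt enum_rankK (negPf xC).
  rewrite inE -lt0n in xl; apply: leq_trans (leq_addr _ _).
  by rewrite leq_pmull.
move: lt; rewrite [wt i]/wt; case: ifP => iC; first by rewrite ltnNge lx.
have /ord2P ord2 : cf 0%MM (dir E c (pi 'X_i)) = 0 /\ lin (dir E c (pi 'X_i)) = 0.
  by split; rewrite // M0 // iC.
move=> lt; apply: ord2 => //; rewrite mwt1 ltnNge; apply/negP => l2.
move: lt; rewrite ltnNge => /negP []; apply: (@leq_trans (mdeg l * 2)).
  by rewrite -[(3 + 1)%N]/(2 * 2)%N leq_mul2r l2.
rewrite mdegE big_distrl /=; apply: leq_sum => j _; rewrite leq_mul2l /wt.
by case: ifP; rewrite orbT.
Qed.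



Local Notation iota := (@FracField.tofrac R).

(** The restrictions to the core of the derivations span, over the field of
rational functions, a space of rank [#|core|]; a weight vector of weight zero is
killed by them, so that its differential on the core vanishes. *)
Lemma weight0_const : (m <= n)%N ->
  forall u, weight_vec E 0 u -> r u = (cf 0%MM u)%:MP.
Proof.
move=> mn u u0; have [kappa kP] := core_kernel.
pose P chi := (exists2 i, enum_val i \notin core D & chi = kappa i) \/
  (exists2 v, weight_vec E chi v & r v != 0).
have [q [Z [PZ fZ]]] : exists q (Z : 'M[K]_(q, n)), (forall i, P (row i Z)) /\ row_full Z.
  apply: row_full_family => c h; apply: kP => [i iC|chi v hv v0].
    by apply: h; left; exists i.
  by apply: h; right; exists v.
pose j : {rmorphism K -> {fraction R}} := iota \o @mpolyC m K.
(* The rows of the variables on the core hold the values of the derivations there,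
and the other rows the weights given by [core_kernel]. *)
pose N := \matrix_(i < m, k < n)
  if enum_val i \in core D then iota (r (E k (pi 'X_i))) else j (kappa i 0 k).
pose g v i := if enum_val i \in core D then iota (r (pi (SR_repr v)^`M(i))) else 0.
have chain v k : iota (r (E k v)) = \sum_i g v i * N i k.
  rewrite -{1}[v]SR_reprK (der_chain (dE k)) (restr_sum CD) rmorph_sum.
  apply: eq_bigr => i _; rewrite (restrM CD) rmorphM /g mxE; case: ifP => // iC.
  suff -> : r (E k (pi 'X_i)) = 0 by rewrite rmorph0 mulr0 mul0r.
  apply/vanishes_restr/(der_vanishes_core (dE k))/(vanishesX _ CD).
  by rewrite mnm_suppU sub1set iC.
(* [core_kernel] says that a constant vector in the kernel of [N] vanishes; [Z] gives
the same over the field of fractions. *)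
have fN : row_full N.
  apply: row_full_ker => c Nc; have fZ' : row_full (map_mx j Z) by rewrite row_full_map.
  have [B BZ] := row_fullP fZ'.
  suff Zc : map_mx j Z *m c = 0 by rewrite -[c]mul1mx -BZ -mulmxA Zc mulmx0.
  apply/row_matrixP => i; rewrite row_mul row0 -map_row.
  apply/matrixP => a b; rewrite !ord1 mxE [RHS]mxE {a b}.
  have [[l lC ->]|[v hv v0]] := PZ i.
    have /matrixP /(_ l 0) := Nc; rewrite !mxE => e; rewrite -[RHS]e.
    by apply: eq_bigr => k _; rewrite !mxE (negPf lC).
  have v0' : iota (r v) != 0 by rewrite tofrac_eq0.
  apply: (mulfI v0'); rewrite mulr0 mulr_sumr.
  transitivity (\sum_k (\sum_l g v l * N l k) * c k 0).
    apply: eq_bigr => k _; rewrite -chain hv (restrZ CD) mulrA mxE.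
    by rewrite -mul_mpolyC rmorphM /= [iota (r v) * _]mulrC.
  under eq_bigr do rewrite mulr_suml.
  rewrite exchange_big big1 //= => l _.
  have /matrixP /(_ l 0) := Nc; rewrite [LHS]mxE [RHS]mxE => e.
  transitivity (g v l * \sum_k N l k * c k 0); last by rewrite e mulr0.
  by rewrite mulr_sumr; apply: eq_bigr => k _; rewrite mulrA.
have freeN : row_free N.
  by rewrite /row_free eqn_leq rank_leq_row (eqP fN).
have g0 : \row_i g u i = 0.
  apply: (row_free_inj freeN); rewrite mul0mx; apply/rowP => k.
  rewrite !mxE; under eq_bigr do rewrite mxE.
  by rewrite -chain u0 mxE scale0r restr0 // rmorph0.
apply/mpolyP => l; rewrite mcoeff_restr mcoeffC.
have [->|l0] := eqVneq l 0%MM; first by rewrite mnm_supp0 sub0set mulr1.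
rewrite mulr0; case: ifP => // lC.
have [i li] : exists i, l i != 0%N.
  apply: contrapT => h; case/eqP: l0; apply/mnmP => i; rewrite mnm0E.
  by apply: contrapT => /eqP li; apply: h; exists i.
have iC : enum_val i \in core D by apply: (subsetP lC); rewrite mem_mnm_supp.
have := congr1 (fun x : 'rV_m => x 0 i) g0; rewrite !mxE /g iC => /eqP.
rewrite tofrac_eq0 => /eqP /(congr1 (mcoeff (l - U_(i))%MM)).
have lU : (l - U_(i) + U_(i))%MM = l by rewrite submK // lep1mP.
have sC : mnm_supp (l - U_(i))%MM \subset core D.
  by apply: subset_trans lC; apply: mnm_supp_le; rewrite lem_subr.
rewrite mcoeff_restr // sC cf_pi ?(face_sub CD sC) // mcoeff_mderiv lU mcoeff0.
rewrite -mulr_natr => /eqP; rewrite mulf_eq0 => /orP [/eqP //|].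
by move/pcharf0P: charK => ->.
Qed.

(** The product of the two restrictions is constant by [weight0_const]; so both are
units of a polynomial ring, that is constants, and constants have weight zero. *)
Lemma opposite_weights : (m <= n)%N -> forall chi u v,
  weight_vec E chi u -> weight_vec E (- chi) v -> r u != 0 -> r v != 0 -> chi = 0.
Proof.
move=> mn chi u v hu hv u0 v0.
have uv : weight_vec E 0 (u * v) by rewrite -(subrr chi); apply: weightM.
have := weight0_const mn uv; rewrite (restrM CD) => e.
have uv0 : r u * r v != 0 by rewrite mulf_neq0.
have : msize (r u * r v) = 1%N.
  by rewrite e msizeC -(mpolyC_eq0 m) -e uv0.
rewrite msizeM // => s1.
have su : (0 < msize (r u))%N by rewrite lt0n msize_poly_eq0.
have sv : (0 < msize (r v))%N by rewrite lt0n msize_poly_eq0.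
have su1 : (msize (r u) <= 1)%N.
  move: s1 su sv; case: (msize (r u)) => [|[|a]] //.
  by case: (msize (r v)) => [|b] //; rewrite addSn addnS.
have ru := msize1_polyC su1; set a := _@_0%MM in ru.
have w0 : vanishes_on (core D) (u - a *: 1).
  apply/vanishes_restr; rewrite (restrD CD) -scaleNr (restrZ CD) (restr1 _ CD) ru.
  by rewrite -mul_mpolyC mulr1 mpolyCN subrr.
apply/rowP => k; have := der_vanishes_core (dE k) w0.
rewrite -scaleNr (derD (dE k)) (derZ (dE k)) (der1 (dE k)) scaler0 addr0 hu.
move/vanishes_restr; rewrite (restrZ CD) -mul_mpolyC => /eqP.
by rewrite mulf_eq0 (negPf u0) orbF mpolyC_eq0 mxE => /eqP.
Qed.

End FixedPoint.

(** * Endomorphisms of the Stanley-Reisner ring *)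

Section Endomorphisms.
Variables (K : closedFieldType) (W : finType) (D : complex W).
Local Notation m := #|W|.
Local Notation R := {mpoly K[m]}.
Local Notation A := (SR_ring K D).
Local Notation pi := (@SR_pi K W D).
Implicit Types (u v : A).

Section Substitution.
Variable a : 'I_m -> A.

Lemma substM p q : SR_subst a (p * q) = SR_subst a p * SR_subst a q.
Proof. by rewrite /SR_subst rmorphM. Qed.

Lemma subst1 : SR_subst a 1 = 1.
Proof. by rewrite /SR_subst -mpolyX0 mmapX mmap11. Qed.

Lemma substD p q : SR_subst a (p + q) = SR_subst a p + SR_subst a q.
Proof. by rewrite /SR_subst rmorphD. Qed.

Lemma subst0 : SR_subst a 0 = 0.
Proof. by apply: (addrI (SR_subst a 0)); rewrite -substD !addr0. Qed.

Lemma substX i : SR_subst a 'X_i = a i.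
Proof. by rewrite /SR_subst mmapX mmap1U. Qed.

Lemma subst_gen S : SR_subst a (SR_generator K S) = \prod_(v in S) a (enum_rank v).
Proof.
rewrite /SR_generator (big_morph _ substM subst1).
by apply: eq_bigr => v _; rewrite substX.
Qed.

Lemma subst_ideal :
  (forall S, S \notin faces D -> \prod_(v in S) a (enum_rank v) = 0) ->
  forall p, p \in SR_ideal D -> SR_subst a p = 0.
Proof.
move=> h p; rewrite unfold_in => /asboolP [c ->].
rewrite (big_morph _ substD subst0); apply: big1 => S SD.
by rewrite substM subst_gen h // mulr0.
Qed.

(** A facet misses some vertex of each nonface, so that the product over a nonface
vanishes on all the facets. *)
Lemma lift_facets :
  (forall i F, F \in facets D -> enum_val i \notin F -> vanishes_on F (a i)) ->
  exists f : {lrmorphism A -> A}, forall i, f (pi 'X_i) = a i.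
Proof.
move=> h; have [|f fE] := SR_lift (a := a); last first.
  by exists f => i; rewrite fE substX.
apply: subst_ideal => S SD; apply: vanishes_on_facets => F FD.
have /subsetPn [v vS vF] : ~~ (S \subset F).
  by apply: contra SD; apply: face_subset; apply: facet_face.
rewrite (bigD1 v) //=; apply: (vanishesMl (facet_face FD)).
by apply: h; rewrite // enum_rankK.
Qed.

End Substitution.

Lemma lrmorph_eq (f g : {lrmorphism A -> A}) :
  (forall i, f (pi 'X_i) = g (pi 'X_i)) -> f =1 g.
Proof.
move=> h u; have [p ->] := SR_pi_surj u; rewrite !lrmorph_pi.
by apply: eq_bigr => k _; under eq_bigr do rewrite h.
Qed.

Lemma alg_aut_gens (f g : {lrmorphism A -> A}) :
  (forall i, g (f (pi 'X_i)) = pi 'X_i) -> (forall i, f (g (pi 'X_i)) = pi 'X_i) ->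
  exists h : alg_aut K D, aut h = f.
Proof.
move=> gf fg.
have fK : cancel f g by move=> u; apply: (lrmorph_eq (f := g \o f) (g := idfun)).
have gK : cancel g f by move=> u; apply: (lrmorph_eq (f := f \o g) (g := idfun)).
by exists (AlgAut fK gK).
Qed.

Variables (n : nat) (E : 'I_n -> A -> A).

Definition conj_der (f : alg_aut K D) k u := aut_inv f (E k (f u)).

Lemma weight_conj f chi u : weight_vec (conj_der f) chi u <-> weight_vec E chi (f u).
Proof.
split=> h k; last by rewrite /conj_der h linearZ /= autK.
by have := congr1 f (h k); rewrite /conj_der aut_invK linearZ.
Qed.

Lemma toral_conj f : toral E -> toral (conj_der f).
Proof.
move=> [dE decE freeE]; split.
- move=> k; split=> [a u v|u v]; rewrite /conj_der.
    by rewrite linearP (dE k).1 linearP.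
  by rewrite rmorphM (dE k).2 rmorphD !rmorphM /= !autK.
- move=> u; have [s [a [us aw fu]]] := decE (f u).
  exists s, (fun chi => aut_inv f (a chi)); split=> // [chi|].
    by apply/weight_conj; rewrite aut_invK.
  by rewrite -[u](autK f) fu rmorph_sum.
- move=> c h; apply: freeE => u; have := congr1 f (h (aut_inv f u)).
  rewrite rmorph0 rmorph_sum => e; rewrite -[RHS]e; apply: eq_bigr => k _.
  by rewrite /= linearZ /= /conj_der !aut_invK.
Qed.

End Endomorphisms.

Section Translation.
Variables (K : closedFieldType) (charK : [pchar K] =i pred0).
Variables (W : finType) (D : complex W).
Local Notation m := #|W|.
Local Notation R := {mpoly K[m]}.
Local Notation A := (SR_ring K D).
Local Notation pi := (@SR_pi K W D).
Variables (n : nat) (E : 'I_n -> A -> A) (tE : toral E) (mn : (m <= n)%N).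
Implicit Types (u v : A) (chi : 'rV[K]_n) (c : 'cV[K]_n).
Let dE := toral_der tE.
Local Notation r := (restr (core D)).
Let CD := core_face D.

Lemma translation (pt : 'I_m -> K) : (forall i, enum_val i \notin core D -> pt i = 0) ->
  exists f : alg_aut K D, forall i, f (pi 'X_i) = pi 'X_i - pt i *: 1.
Proof.
move=> pt0.
have lift (t : 'I_m -> K) : (forall i, enum_val i \notin core D -> t i = 0) ->
    exists f : {lrmorphism A -> A}, forall i, f (pi 'X_i) = pi 'X_i - t i *: 1.
  move=> t0; apply: lift_facets => i F FD iF.
  have iC : enum_val i \notin core D by apply: contra iF; apply/subsetP/core_sub.
  rewrite t0 // scale0r subr0; apply: (vanishesX _ (facet_face FD)).
  by rewrite mnm_suppU sub1set.
have [f fE] := lift pt pt0.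
have [|g gE] := lift (fun i => - pt i); first by move=> i /pt0 ->; rewrite oppr0.
have [i|i|h hE] := alg_aut_gens (f := f) (g := g); last by exists h => i; rewrite hE.
  by rewrite fE raddfB /= linearZ_LR rmorph1 gE scaleNr opprK addrK.
by rewrite gE raddfB /= linearZ_LR rmorph1 fE scaleNr opprK subrK.
Qed.

(** The elements whose component of weight zero vanishes on the core. *)
Let N u := exists s : seq ('rV[K]_n * A),
  (forall q, q \in s -> weight_vec E q.1 q.2 /\ (q.1 = 0 -> r q.2 = 0)) /\
  u = \sum_(q <- s) q.2.

Let NZ a u : N u -> N (a *: u).
Proof.
move=> [s [sw ->]]; exists [seq (q.1, a *: q.2) | q <- s]; split.
  move=> _ /mapP [q qs ->] /=; have [qw q0] := sw q qs.
  by split=> [|/q0 e]; [apply: weightZ|rewrite (restrZ CD) e scaler0].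
by rewrite big_map scaler_sumr.
Qed.

Let ND u v : N u -> N v -> N (u + v).
Proof.
move=> [s [sw ->]] [t [tw ->]]; exists (s ++ t); split; last by rewrite big_cat.
by move=> q; rewrite mem_cat => /orP []; [apply: sw|apply: tw].
Qed.

Let N0 : N 0.
Proof. by exists [::]; split=> //; rewrite big_nil. Qed.

(* Where the weights cancel, one of the factors vanishes on the core by
[opposite_weights]. *)
Let NM u v : N u -> N (u * v).
Proof.
move=> Nu; have [t [a [_ aw ->]]] := toral_decomp tE v.
rewrite mulr_sumr; apply: (big_ind N); [exact: N0|exact: ND|move=> chi _].
case: Nu => [s [sw ->]]; exists [seq (q.1 + chi, q.2 * a chi) | q <- s]; split.
  move=> _ /mapP [q qs ->] /=; have [qw q0] := sw q qs.
  split; first exact: weightM.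
  rewrite (restrM CD) => /eqP; rewrite addrC addr_eq0 => /eqP e.
  have [->|rq] := eqVneq (r q.2) 0; first by rewrite mul0r.
  have [->|ra] := eqVneq (r (a chi)) 0; first by rewrite mulr0.
  have aw' : weight_vec E (- q.1) (a chi) by rewrite -e.
  by rewrite q0 ?mul0r // (opposite_weights charK tE mn qw aw').
by rewrite big_map mulr_suml.
Qed.

Let N1 : ~ N 1.
Proof.
move=> [s [sw e1]].
pose a chi := (chi == 0)%:R *: 1 - \sum_(q <- s | q.1 == chi) q.2.
have aw chi : weight_vec E chi (a chi).
  rewrite /a -scaleN1r; apply: (weightD tE); last first.
    apply: (weightZ tE); rewrite big_seq_cond; apply: (weight_sum tE).
    by move=> q /andP [qs /eqP <-]; have [] := sw q qs.
  case: eqP => [->|_]; last by rewrite scale0r; apply: weight0.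
  by rewrite scale1r; apply: weight1.
pose l := undup (0 :: map fst s).
have l0 : 0 \in l by rewrite mem_undup inE eqxx.
have suma : \sum_(chi <- l) a chi = 0.
  rewrite sumrB (bigD1_seq 0) ?undup_uniq //= eqxx scale1r big1 ?addr0; last first.
    by move=> chi /negPf ->; rewrite scale0r.
  apply/eqP; rewrite subr_eq0 {1}e1; apply/eqP/regroup; first exact: undup_uniq.
  by move=> x xs; rewrite mem_undup inE xs orbT.
have := weight_independence tE (chi := id) (undup_uniq _) (in2W (fun _ _ => id)) aw suma l0.
rewrite /a eqxx scale1r => /eqP; rewrite subr_eq0 => /eqP /(congr1 r).
rewrite (restr1 _ CD) (restr_sum CD) big_seq_cond big1; first by move/eqP; rewrite oner_eq0.
by move=> q /andP [qs /eqP q0]; have [_ ->] := sw q qs.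
Qed.

(** The weights of functions on the core generate a pointed cone, so that the weight
vectors of nonzero weight lie in a proper ideal; its zero is a fixed point, which
a translation along the core moves to the origin. *)
Lemma fixed_point : exists f : alg_aut K D,
  forall chi u, weight_vec E chi (f u) -> chi != 0 -> cf 0%MM u = 0.
Proof.
have pt i : {t : K | N (pi 'X_i - t *: 1) & (enum_val i \notin core D -> t = 0)}.
  apply: cid2; have [s [a [us aw xE]]] := toral_decomp tE (pi 'X_i).
  pose a0 := if 0 \in s then a 0 else 0; exists (cf 0%MM a0); last first.
    move=> iC; rewrite /a0; case: ifP => [s0|_]; last exact/cf0/face0.
    by apply: (core_components tE iC us aw xE s0); rewrite mnm_supp0 sub0set.
  have a0w : weight_vec E 0 a0 by rewrite /a0; case: ifP => _; [|apply: weight0].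
  have -> : pi 'X_i - cf 0%MM a0 *: 1 =
      (a0 - cf 0%MM a0 *: 1) + \sum_(chi <- s | chi != 0) a chi.
    rewrite xE addrAC; congr (_ + _); rewrite /a0; case: ifP => s0.
      by rewrite (bigD1_seq 0).
    rewrite add0r [LHS]big_seq_cond [RHS]big_seq_cond; apply: eq_bigl => chi.
    by rewrite andbT; case: eqP => [->|_]; rewrite ?s0 ?andbT.
  apply: ND.
    exists [:: (0, a0 - cf 0%MM a0 *: 1)]; split; last by rewrite big_seq1.
    move=> q; rewrite inE => /eqP -> /=; split=> [|_].
      apply: (weightD tE) => //; rewrite -scaleNr; apply: (weightZ tE).
      exact: weight1.
    rewrite (restrD CD) -scaleNr (restrZ CD) (restr1 _ CD) (weight0_const charK tE mn a0w).
    by rewrite -mul_mpolyC mulr1 mpolyCN subrr.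
  apply: (big_ind N); [exact: N0|exact: ND|move=> chi chi0].
  exists [:: (chi, a chi)]; split; last by rewrite big_seq1.
  by move=> q; rewrite inE => /eqP -> /=; split=> // e; rewrite e eqxx in chi0.
have [|f fE] := @translation (fun i => s2val (pt i)); first by move=> i; case: (pt i).
exists f => chi u fu chi0.
have Nu : N (f u).
  exists [:: (chi, f u)]; split; last by rewrite big_seq1.
  by move=> q; rewrite inE => /eqP -> /=; split=> // e; rewrite e eqxx in chi0.
(* [f u] is congruent to the value of [u] at the origin modulo the ideal [N]. *)
have Nc p : N (f (pi p) - p@_0%MM *: 1).
  elim/mpoly_algebra_ind: p => [a p q Np Nq||p q Np Nq|i].
  - have -> : f (pi (a *: p + q)) - (a *: p + q)@_0%MM *: 1 =
        a *: (f (pi p) - p@_0%MM *: 1) + (f (pi q) - q@_0%MM *: 1).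
      rewrite piD SR_piZ rmorphD /= linearZ /= mcoeffD mcoeffZ.
      by rewrite [a *: (_ - _)]scalerBr scalerDl scalerA opprD addrACA.
    by apply: ND => //; apply: NZ.
  - by rewrite !rmorph1 scale1r subrr; exact: N0.
  - rewrite piM rmorphM (_ : (p * q)@_0%MM = p@_0%MM * q@_0%MM); last exact: rmorphM.
    have -> : f (pi p) * f (pi q) - (p@_0%MM * q@_0%MM) *: 1 =
      (f (pi p) - p@_0%MM *: 1) * f (pi q) + (f (pi q) - q@_0%MM *: 1) * (p@_0%MM *: 1).
      rewrite !mulrBl -!scalerAl -!scalerAr !mul1r mulr1 scalerA [q@__ * _]mulrC.
      by rewrite addrA subrK.
    by apply: ND; apply: NM.
  - rewrite fE mcoeffX mnm1_eq0 scale0r subr0.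
    by case: (pt i).
have [p up] := SR_pi_surj u; rewrite up in Nu *.
have := Nc p; move/(NZ (-1))/(ND Nu).
rewrite scaleN1r opprB addrC subrK cf_pi ?face0 // => Np.
apply: contrapT => /eqP p0; apply: N1; have := NZ (p@_0%MM)^-1 Np.
by rewrite scalerA mulVf // scale1r.
Qed.

End Translation.

(** * Linearization of the torus *)

Section Linearization.
Variables (K : closedFieldType) (charK : [pchar K] =i pred0).
Variables (W : finType) (D : complex W).
Local Notation m := #|W|.
Local Notation R := {mpoly K[m]}.
Local Notation A := (SR_ring K D).
Local Notation pi := (@SR_pi K W D).
Variables (n : nat) (E : 'I_n -> A -> A) (tE : toral E) (mn : (m <= n)%N).
Implicit Types (u v : A) (chi : 'rV[K]_n) (c : 'cV[K]_n).
Let dE := toral_der tE.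
Local Notation ord := (ord_ge (fun _ : 'I_m => 1%N)).

Hypothesis fix0 : forall chi u, weight_vec E chi u -> chi != 0 -> cf 0%MM u = 0.

Let E0 k u : cf 0%MM (E k u) = 0.
Proof.
have [s [a [_ aw ->]]] := toral_decomp tE u.
rewrite (der_sum (dE k)) cf_sum ?face0 // big1 // => chi _; rewrite aw cfZ ?face0 //.
have [->|chi0] := eqVneq chi 0; first by rewrite mxE mul0r.
by rewrite (fix0 (aw chi) chi0) mulr0.
Qed.

Let dir0 c u : cf 0%MM (dir E c u) = 0.
Proof. by rewrite cf_sum ?face0 // big1 // => k _; rewrite cfZ ?face0 // E0 mulr0. Qed.

(** Weight components of the variables whose linear parts form a basis of the
cotangent space. Their weights separate the directions of the torus, so that
they form a basis of the dual of its Lie algebra. *)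
Lemma linearizing_components : exists (omega : 'I_m -> 'rV[K]_n) (y : 'I_m -> A),
  [/\ forall i, weight_vec E (omega i) (y i),
      forall i F, F \in facets D -> enum_val i \notin F -> vanishes_on F (y i),
      \matrix_i lin (y i) \in unitmx, n = m & row_free (\matrix_i omega i)].
Proof.
pose dec (i : 'I_m) (p : seq 'rV[K]_n * ('rV[K]_n -> A)) :=
  [/\ uniq p.1, forall chi, weight_vec E chi (p.2 chi) &
      pi 'X_i = \sum_(chi <- p.1) p.2 chi].
have exdec i : exists p, dec i p.
  by have [s [a h]] := toral_decomp tE (pi 'X_i); exists (s, a).
have [sa saP] := choice exdec.
have lin1 i : row i 1%:M = \sum_(chi <- (sa i).1) lin ((sa i).2 chi).
  by rewrite -lin_sum row1 -(@linX _ _ D); have [_ _ ->] := saP i.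
have [omega [os uY]] := unitmx_select (unitmx1 _ _) lin1.
(* A direction killing all the weights acts trivially on the cotangent space. *)
have fO : row_full (\matrix_i omega i).
  apply: row_full_ker => c oc; have dc := dir_der tE c.
  apply: (@toral_raise_order _ _ _ _ _ tE (fun=> 1%N)) => i; rewrite addn1.
  apply/ord2P; split; first exact: dir0.
  suff : lin_mx (dir E c) = 0 by move/(congr1 (row i)); rewrite rowK row0.
  rewrite -[lin_mx _](mulKmx uY); set YM := (X in invmx _ *m X).
  suff -> : YM = 0 by rewrite mulmx0.
  apply/row_matrixP => j; rewrite row_mul rowK row0 -lin_der //.
  have [_ aw _] := saP j; rewrite (dir_weight _ (aw _)).
  have /(congr1 (row j)) := oc; rewrite row_mul rowK row0 => ->.
  by rewrite mxE scale0r lin0.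
have nm : n = m.
  apply/eqP; rewrite eqn_leq mn andbT -(eqP fO).
  exact: rank_leq_row.
exists omega, (fun i => (sa i).2 (omega i)); split=> //.
- by move=> i; have [_ aw _] := saP i.
- move=> i F FD iF; have [us aw xE] := saP i; have FD' := facet_face FD.
  apply: (weight_components tE (U := vanishes_on F) (chi := id)
    (a := (sa i).2) _ _ _ us) => //.
  + exact: vanishes0.
  + by move=> x u v hu hv; apply: (vanishesD FD') => //; apply: (vanishesZ FD').
  + by move=> k u; apply: der_vanishes_facet.
  + by rewrite -xE; apply: (vanishesX _ FD'); rewrite mnm_suppU sub1set.
by rewrite /row_free (eqP fO) nm.
Qed.

Section Coordinates.
Variables (omega : 'I_m -> 'rV[K]_n) (y : 'I_m -> A) (psi : {lrmorphism A -> A}).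
Hypotheses (yw : forall i, weight_vec E (omega i) (y i))
  (yF : forall i F, F \in facets D -> enum_val i \notin F -> vanishes_on F (y i))
  (uY : \matrix_i lin (y i) \in unitmx) (freeO : row_free (\matrix_i omega i))
  (psiE : forall i, psi (pi 'X_i) = y i).

Let wgt (b : 'X_{1..m}) : 'rV[K]_n := \sum_i omega i *+ b i.

Let psiX b : psi (pi 'X_[b]) = \prod_i y i ^+ b i.
Proof.
rewrite lrmorph_pi msuppX big_seq1 mcoeffX eqxx scale1r.
by apply: eq_bigr => i _; rewrite psiE.
Qed.

Let psiX' (b : 'X_{1..m}) : psi (pi 'X_[b]) = \prod_i psi (pi 'X_i) ^+ b i.
Proof. by rewrite psiX; apply: eq_bigr => i _; rewrite psiE. Qed.

Let psi_weight b : weight_vec E (wgt b) (psi (pi 'X_[b])).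
Proof.
rewrite psiX /wgt; elim/big_rec2: _ => [|i u chi _ h]; first exact: weight1.
by apply: (weightM tE) => //; apply: weightX.
Qed.

Let wgt_inj : injective wgt.
Proof.
move=> b b' e; apply/mnmP => i; apply: (natr_inj_char0 charK).
have wE d : wgt d = (\row_j (d j)%:R) *m \matrix_j omega j.
  rewrite mulmx_sum_row; apply: eq_bigr => j _.
  by rewrite rowK mxE scaler_nat.
move: e; rewrite !wE => /(row_free_inj freeO) /rowP /(_ i).
by rewrite !mxE.
Qed.

(* Otherwise the linear parts of [y i] and of the coordinates off [F] would be too many
independent vectors in the span of the variables off [F]. *)
Let restr_y_neq0 i F : F \in facets D -> enum_val i \in F -> restr F (y i) != 0.
Proof.
move=> FD iF; apply/negP => /eqP /vanishes_restr h.
suff d0 : \det (\matrix_i lin (y i)) = 0.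
  by have := uY; rewrite unitmxE d0 unitr0.
pose Q := [set j : 'I_m | enum_val j \in F].
apply: (@det_zero_block _ _ _ (i |: ~: Q) Q).
  move=> j k; rewrite !inE => jP kQ; rewrite !mxE.
  have kF : mnm_supp (U_(k) : 'X_{1..m})%MM \subset F by rewrite mnm_suppU sub1set.
  by case/orP: jP => [/eqP ->|jF]; [apply: h|apply: (yF FD jF)].
rewrite cardsU1 !inE iF /= add1n addSn addnC cardsC card_ord.
by [].
Qed.

Let psiX_neq0 b : mnm_supp b \in faces D -> psi (pi 'X_[b]) != 0.
Proof.
move=> bD; have [F FD bF] := exists_facet bD; apply/negP => /eqP b0.
have := congr1 (restr F) b0; rewrite (restr0 _ (facet_face FD)) psiX.
have rM := restrM (K := K) (facet_face FD).
have r1 := restr1 K (facet_face FD); rewrite (big_morph _ rM r1); apply/eqP/prodf_neq0 => i _.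
case bi : (b i) => [|k]; first by rewrite expr0 r1 oner_neq0.
have yi : restr F (y i) != 0.
  by apply: restr_y_neq0 => //; apply: (subsetP bF); rewrite mem_mnm_supp bi.
elim: k.+1 => [|l IH]; first by rewrite expr0 r1 oner_neq0.
by rewrite exprS rM mulf_neq0.
Qed.

Let psi_inj u : psi u = 0 -> u = 0.
Proof.
move=> u0; apply: SR_coef_eq => l lD; rewrite -!/(cf l _) cf0 //.
have [lu|/memN_msupp_eq0 //] := boolP (l \in msupp (SR_repr u)).
pose s := [seq k <- msupp (SR_repr u) | mnm_supp k \in faces D].
have : cf l u *: psi (pi 'X_[l]) = 0.
  apply: (weight_independence tE (s := s) (chi := wgt)
    (a := fun k => cf k u *: psi (pi 'X_[k]))).
  - by rewrite filter_uniq.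
  - by move=> k k' _ _; apply: wgt_inj.
  - by move=> k; apply: (weightZ tE).
  - rewrite -[RHS]u0 [u in RHS]monomial_expansion big_filter rmorph_sum.
    by apply: eq_bigr => k _; rewrite /= linearZ.
  - by rewrite mem_filter lD.
have := psiX_neq0 lD; set w := psi _ => w0 h.
apply: contrapT => /eqP c0; case/eqP: w0.
by rewrite -[w]scale1r -(mulVf c0) -scalerA h scaler0.
Qed.

Let y0 i : cf 0%MM (y i) = 0.
Proof.
apply: (fix0 (yw i)); apply/negP => /eqP o0.
suff : ~~ row_free (\matrix_i omega i) by rewrite freeO.
by apply/row_freePn; exists i; rewrite rowK o0 sub0mx.
Qed.

(** Modulo higher order, the algebra generated by the new coordinates contains every
element: this holds to first order because the linear parts form a basis. *)
Let T k u := exists p, ord k (psi (pi p)) /\ ord k.+1 (u - psi (pi p)).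

Let T_all k u : ord k u -> T k u.
Proof.
have TZD l a u1 u2 : T l u1 -> T l u2 -> T l (a *: u1 + u2).
  move=> [p [p1 p2]] [q [q1 q2]]; exists (a *: p + q).
  rewrite piD SR_piZ rmorphD /= linearZ /=; split.
    by apply: ordD => //; apply: ordZ.
  by rewrite opprD addrACA -scalerBr; apply: ordD => //; apply: ordZ.
have T0 l : T l 0.
  exists 0; rewrite !rmorph0 subr0; split; exact: ord_zero.
have TM l l' u1 u2 : ord l u1 -> T l u1 -> T l' u2 -> T (l + l') (u1 * u2).
  move=> o1 [p [p1 p2]] [q [q1 q2]]; exists (p * q).
  rewrite piM rmorphM; split; first exact: ordM.
  have -> : u1 * u2 - psi (pi p) * psi (pi q) =
    u1 * (u2 - psi (pi q)) + (u1 - psi (pi p)) * psi (pi q).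
    by rewrite mulrBr mulrBl addrA subrK.
  by apply: ordD; [rewrite -addnS|rewrite -addSn]; apply: ordM.
have T1 : T 0 1.
  by exists 1; rewrite !rmorph1 subrr; split=> //; apply: ord_zero.
have TX i : T 1 (pi 'X_i).
  exists (\sum_j invmx (\matrix_i lin (y i)) i j *: 'X_j).
  have -> : psi (pi (\sum_j invmx (\matrix_i lin (y i)) i j *: 'X_j)) =
      \sum_j invmx (\matrix_i lin (y i)) i j *: y j.
    rewrite pi_sum rmorph_sum; apply: eq_bigr => j _.
    by rewrite SR_piZ /= linearZ /= psiE.
  split.
    by apply: ord_sum => j _; apply: ordZ; apply/ord1P; apply: y0.
  apply/ord2P; split.
    rewrite cfD ?face0 // -scaleN1r cfZ ?face0 // cf_sum ?face0 // big1 ?mulr0 ?addr0.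
      by rewrite cfX ?face0 // mnm1_eq0.
    by move=> j _; rewrite cfZ ?face0 // y0 mulr0.
  rewrite linD -scaleN1r linZ scaleN1r linX lin_sum; apply/eqP; rewrite subr_eq0.
  rewrite -row1 -(mulVmx uY) row_mul mulmx_sum_row; apply/eqP/eq_bigr => j _.
  by rewrite linZ !rowK mxE.
have ordXk i : ord 1 (pi 'X_i).
  by have := @ordX K _ D (fun=> 1%N) U_(i)%MM; rewrite mwtU.
have TXn i l : T l (pi 'X_i ^+ l) /\ ord l (pi 'X_i ^+ l).
  elim: l => [|l [IH1 IH2]]; first by rewrite expr0; split.
  by rewrite exprS -add1n; split; [apply: TM|apply: ordM].
have TXm b : T (mdeg b) (pi 'X_[b]).
  suff [] : T (mdeg b) (pi 'X_[b]) /\ ord (mdeg b) (pi 'X_[b]) by [].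
  have -> : pi 'X_[b] = \prod_i pi 'X_i ^+ b i.
    by rewrite mpolyXE_id rmorph_prod; apply: eq_bigr => i _; rewrite rmorphXn.
  rewrite mdegE; elim/big_rec2: _ => [|i w l _ [h1 h2]]; first by split.
  by have [t1 t2] := TXn i (b i); split; [apply: TM|apply: ordM].
move=> uk; apply: (@monomial_ind _ _ _ (T k) u) => // [a b Ta Tb|b bD bu].
  by rewrite -[a]scale1r; apply: TZD.
rewrite -[_ *: _]addr0; apply: TZD => //.
have : (k <= mdeg b)%N.
  by rewrite leqNgt; apply: contra bu => lt; rewrite uk // mwt1.
rewrite leq_eqVlt => /orP [/eqP ->//|kb].
exists 0; rewrite !rmorph0 subr0; split; first exact: ord_zero.
apply: ord_leq kb _; rewrite -(mwt1 b); exact: ordX.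
Qed.

Let dense k u : exists p, ord k (u - psi (pi p)).
Proof.
elim: k => [|k [p IH]]; first by exists 0; apply: ord_ge0.
have [q [_ h]] := T_all IH; exists (p + q).
by rewrite piD rmorphD opprD addrA.
Qed.

Let ordE k l u : ord l u -> ord l (E k u).
Proof.
move=> h; rewrite -[l]addn0; apply: (der_ord (dE k)) h => i.
by rewrite addn0; apply/ord1P; apply: E0.
Qed.

(** The weights of the monomials are distinct, so that a weight vector can only be
approximated by multiples of one and the same monomial. *)
Let psi_surj_weight chi u : weight_vec E chi u -> exists v, psi v = u.
Proof.
move=> uw.
have approx k : exists p, ord k (u - psi (pi (\sum_(b <- msupp p | wgt b == chi)
                                                p@_b *: 'X_[b]))).
  have [p pk] := dense k u; exists p.
  pose s := undup (chi :: map wgt (msupp p)).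
  pose a x := (x == chi)%:R *: u - \sum_(b <- msupp p | wgt b == x)
                                      p@_b *: psi (pi 'X_[b]).
  have aw x : weight_vec E x (a x).
    rewrite /a -scaleN1r; apply: (weightD tE).
      case: eqP => [->|_]; last by rewrite scale0r; apply: weight0.
      by rewrite scale1r.
    apply: (weightZ tE); rewrite big_seq_cond; apply: (weight_sum tE).
    by move=> b /andP [_ /eqP <-]; apply: (weightZ tE).
  have chis : chi \in s by rewrite mem_undup inE eqxx.
  have suma : \sum_(x <- s) a x = u - psi (pi p).
    rewrite sumrB (bigD1_seq chi) ?undup_uniq //= eqxx scale1r big1 ?addr0; last first.
      by move=> x /negPf ->; rewrite scale0r.
    congr (_ - _); rewrite lrmorph_pi -(regroup (key := wgt) _ (undup_uniq _)).
      by apply: eq_bigr => b _; rewrite psiX'.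
    by move=> x xp; rewrite mem_undup inE xp orbT.
  have := weight_components tE (U := ord k) (chi := id) (a := a) _ _ _
    (undup_uniq _) (in2W (fun _ _ => id)) aw _ chis.
  rewrite /a eqxx scale1r pi_sum rmorph_sum /=.
  under [X in _ -> ord k (_ - X)]eq_bigr do rewrite SR_piZ /= linearZ.
  apply; rewrite ?suma //; first exact: ord_zero.
  - by move=> x v w hv hw; apply: ordD => //; apply: ordZ.
  - by move=> l v; apply: ordE.
(* At most one monomial has weight [chi]. *)
have [[b bchi]|nob] := pselect (exists b, wgt b = chi); last first.
  exists 0; rewrite rmorph0; apply/esym/(ord_eq0 (wt := fun=> 1%N)) => k.
  have [p] := approx k; rewrite big1_seq; first by rewrite !rmorph0 subr0.
  by move=> b /andP [/eqP e _]; case: nob; exists b.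
have {}approx k : exists x, ord k (u - x *: psi (pi 'X_[b])).
  have [p pk] := approx k; exists p@_b; move: pk.
  have [bp|bp] := boolP (b \in msupp p).
    rewrite big_mkcond (bigD1_seq b) ?msupp_uniq //= bchi eqxx big1 ?addr0.
      by rewrite SR_piZ /= linearZ.
    move=> b' b'b; case: eqP => // e; case/eqP: b'b; apply: wgt_inj.
    by rewrite e bchi.
  rewrite (memN_msupp_eq0 bp) scale0r big1_seq ?rmorph0 // => b' /andP [/eqP e b'p].
  by case/negP: bp; rewrite -(wgt_inj (etrans e (esym bchi))).
have [z|nz] := eqVneq (psi (pi 'X_[b])) 0.
  exists 0; rewrite rmorph0; apply/esym/(ord_eq0 (wt := fun=> 1%N)) => k.
  by have [x] := approx k; rewrite z scaler0 subr0.
(* The coefficients of the approximations agree from the order where the monomial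
is visible on. *)
have [k0 nk0] : exists k, ~ ord k (psi (pi 'X_[b])).
  apply: contrapT => h; case/eqP: nz; apply: (ord_eq0 (wt := fun=> 1%N)) => k.
  by apply: contrapT => nk; apply: h; exists k.
have [x xk0] := approx k0; exists (x *: pi 'X_[b]); rewrite linearZ.
apply/eqP; rewrite eq_sym -subr_eq0; apply/eqP/(ord_eq0 (wt := fun=> 1%N)) => k.
have [z zk] := approx (maxn k k0).
have [xz|xz] := eqVneq (x - z) 0.
  move/eqP: xz; rewrite subr_eq0 => /eqP ->.
  by apply: ord_leq zk; apply: leq_maxl.
case: nk0; have : ord k0 ((x - z) *: psi (pi 'X_[b])).
  have -> : (x - z) *: psi (pi 'X_[b]) =
      (u - z *: psi (pi 'X_[b])) - (u - x *: psi (pi 'X_[b])).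
    by rewrite opprB [RHS]addrC addrA subrK scalerBl.
  apply: ordD; last exact: ordN.
  by apply: ord_leq zk; apply: leq_maxr.
by move/(ordZ (x - z)^-1); rewrite scalerA mulVf // scale1r.
Qed.

(** Injectivity holds because the images of the face monomials are nonzero, by
restriction to a facet, and have distinct weights. *)
Lemma coordinates_aut : exists f : alg_aut K D, aut f = psi.
Proof.
have psi_surj u : exists v, psi v = u.
  have [s [a [_ aw ->]]] := toral_decomp tE u.
  have [b bE] := choice (fun chi => psi_surj_weight (aw chi)).
  exists (\sum_(chi <- s) b chi); rewrite rmorph_sum.
  by apply: eq_bigr => chi _; rewrite /= bE.
have [v vE] := choice (fun i => psi_surj (pi 'X_i)).
have [|g gE] := SR_lift (a := v) (D := D).
  apply: subst_ideal => S SD; apply: psi_inj.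
  rewrite rmorph_prod; under eq_bigr do rewrite /= vE.
  have -> : \prod_(w in S) pi 'X_(enum_rank w) = pi (SR_generator K S).
    by rewrite rmorph_prod.
  by rewrite SR_generatorE pi_nonface // mnm_supp_set.
have gX i : g (pi 'X_i) = v i by rewrite gE substX.
have fg u : psi (g u) = u.
  by apply: (lrmorph_eq (f := psi \o g) (g := idfun)) => i /=; rewrite gX vE.
apply: (alg_aut_gens (f := psi) (g := g)) => i; last by rewrite gX vE.
apply/eqP; rewrite -subr_eq0; apply/eqP/psi_inj; rewrite rmorphB /=.
by rewrite fg subrr.
Qed.

End Coordinates.

Lemma linearization_at_origin : exists (omega : 'I_m -> 'rV[K]_n) (f : alg_aut K D),
  [/\ forall i, weight_vec E (omega i) (f (pi 'X_i)), n = m &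
      row_free (\matrix_i omega i)].
Proof.
have [omega [y [yw yF uY nm freeO]]] := linearizing_components.
have [psi psiE] := lift_facets yF.
have [f fE] := coordinates_aut yw yF uY freeO psiE.
by exists omega, f; split=> // i; rewrite fE psiE.
Qed.

End Linearization.

(** The translation of [fixed_point] brings a fixed point to the origin, where
[linearization_at_origin] applies. *)
Lemma linearization (K : closedFieldType) (charK : [pchar K] =i pred0)
    (W : finType) (D : complex W) n (E : 'I_n -> SR_ring K D -> SR_ring K D) :
  toral E -> (#|W| <= n)%N ->
  exists (omega : 'I_#|W| -> 'rV[K]_n) (f : alg_aut K D),
    [/\ forall i, weight_vec E (omega i) (f (SR_pi D 'X_i)), n = #|W| &
        row_free (\matrix_i omega i)].
Proof.
move=> tE mn; have [f fix0] := fixed_point charK tE mn.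
have tE' := toral_conj f tE.
have [|omega [g [gw nm freeO]]] := linearization_at_origin charK tE' mn.
  by move=> chi u /weight_conj; apply: fix0.
exists omega, (f * g)%g; split=> // i.
exact: (iffLR (weight_conj E f (omega i) (g _)) (gw i)).
Qed.

(** * Algebraic families of automorphisms *)

Section Families.
Variables (K : closedFieldType) (V : finType) (D : complex V).
Local Notation R := {mpoly K[#|V|]}.
Local Notation A := (SR_ring K D).
Local Notation pi := (@SR_pi K V D).
Variables (N : nat) (T : Type) (e : T -> 'rV[K]_N).
Implicit Types (g : T -> alg_aut K D).

(** Automorphisms whose values on the variables, and those of their inverses, depend
polynomially on the coordinates [e t] of a parameter. *)
Definition alg_family g := forall b v,
  exists2 F : 'rV[K]_N -> A, apoly F & forall t, sel (g t) b (SR_var K D v) = F (e t).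

Lemma SR_deg_exists (u : A) : exists d, SR_deg_le d u.
Proof. by exists (msize (SR_repr u)), (SR_repr u); rewrite ?SR_reprK. Qed.

Lemma apoly_deg (F : 'rV[K]_N -> A) : apoly F -> exists d, forall z, SR_deg_le d (F z).
Proof.
case=> s; elim: s F => [|q s IH] F sE.
  by exists 0%N => z; rewrite sE big_nil; exists 0; rewrite ?msize0 ?rmorph0.
have [d dP] := IH (fun z => \sum_(q <- s) q.1.@[z 0] *: q.2) (fun _ => erefl).
have [d' d'P] := SR_deg_exists q.2; exists (maxn d d') => z.
rewrite sE big_cons; apply: SR_deg_leD.
  by apply/SR_deg_leZ/SR_deg_le_mono/d'P/leq_maxr.
exact/SR_deg_le_mono/dP/leq_maxl.
Qed.

Lemma family_pieces g : alg_family g ->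
  exists2 d, forall t, aut_piece d (g t) &
    exists P : 'I_#|aut_coord D d| -> {mpoly K[N]},
      forall t i, aut_chart d (g t) 0 i = (P i).@[e t 0].
Proof.
move=> gF; have ex (q : bool * V) : exists F : 'rV[K]_N -> A, apoly F /\
    forall t, sel (g t) q.1 (SR_var K D q.2) = F (e t).
  by have [F F1 F2] := gF q.1 q.2; exists F.
have [F FP] := choice ex.
have [d dP] := choice (fun q => apoly_deg (proj1 (FP q))).
exists (\sum_q d q)%N.
  move=> t v; suff h b : SR_deg_le (\sum_q d q) (sel (g t) b (SR_var K D v)).
    by split; [apply: (h true)|apply: (h false)].
  rewrite (proj2 (FP (b, v)) t); apply: SR_deg_le_mono (dP (b, v) _).
  by rewrite (bigD1 (b, v)) //= leq_addr.
set dd := (\sum_q d q)%N.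
have exP (i : 'I_#|aut_coord D dd|) : exists P : {mpoly K[N]}, forall t,
    aut_chart dd (g t) 0 i = P.@[e t 0].
  rewrite -[i]enum_valK; case: (enum_val i) => [[b v] k].
  have [P PE] := apoly_coef (valP k) (proj1 (FP (b, v))).
  by exists P => t; rewrite aut_chartE (proj2 (FP (b, v)) t).
by have [P PE] := choice exP; exists P => t i; apply: PE.
Qed.

Lemma pieces_family g d : (forall t, aut_piece d (g t)) ->
  (exists P : 'I_#|aut_coord D d| -> {mpoly K[N]},
    forall t i, aut_chart d (g t) 0 i = (P i).@[e t 0]) -> alg_family g.
Proof.
move=> gd [P PE] b v.
exists (fun z => \sum_(k : face_mnm D d)
   (P (enum_rank ((b, v, k) : aut_coord D d))).@[z 0] *: pi 'X_[val (val k)]).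
  by exists [seq (P (enum_rank ((b, v, k) : aut_coord D d)), pi 'X_[val (val k)]) |
    k <- index_enum (face_mnm D d)] => z; rewrite big_map.
move=> t; rewrite [LHS](SR_basis (aut_piece_deg b v (gd t))).
by apply: eq_bigr => k _; rewrite -PE aut_chartE.
Qed.

Lemma family_value g : alg_family g -> forall b u,
  exists2 F : 'rV[K]_N -> A, apoly F & forall t, sel (g t) b u = F (e t).
Proof.
move=> gF b u; have [p ->] := SR_pi_surj u.
have ex (i : 'I_#|V|) : exists F : 'rV[K]_N -> A, apoly F /\
    forall t, sel (g t) b (pi 'X_i) = F (e t).
  have [F F1 F2] := gF b (enum_val i); exists F; split=> // t.
  by rewrite -F2 /SR_var enum_valK.
have [F FP] := choice ex.
exists (fun z => SR_subst (fun i => F i z) p).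
  by apply: apoly_subst => i; have [] := FP i.
move=> t; rewrite SR_substE; congr (SR_subst _ p); apply/funext => i.
by have [_ ->] := FP i.
Qed.

Lemma family_conj g (f : alg_aut K D) :
  alg_family g -> alg_family (fun t => f * g t * f^-1)%g.
Proof.
move=> gF b v; have [F [s sE] FP] := family_value gF b (aut_inv f (SR_var K D v)).
exists (fun z => f (F z)); last by move=> t; rewrite -FP; case: b FP.
exists [seq (q.1, f q.2) | q <- s] => z.
rewrite sE rmorph_sum big_map; apply: eq_bigr => q _.
by rewrite /= linearZ.
Qed.

End Families.

Lemma family_ind_morphism (K : closedFieldType) (V W : finType) (D : complex V)
    (D' : complex W) N (T : Type) (e : T -> 'rV[K]_N) (g : T -> alg_aut K D)
    (phi : alg_aut K D -> alg_aut K D') :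
  is_ind_morphism (aut_ind_variety K D) (aut_ind_variety K D') phi ->
  alg_family e g -> alg_family e (phi \o g).
Proof.
move=> phiM /family_pieces [d gd [P PE]]; have [l [phil [Q QE]]] := phiM d.
apply: (pieces_family (d := l)) => [t|]; first exact/phil/gd.
exists (fun i => Q i \mPo [tuple P j | j < _]) => t i.
rewrite [LHS](QE _ (gd t)) comp_mpoly_meval; apply: meval_eq => j.
by rewrite tnth_mktuple -PE.
Qed.

(** * Tori of automorphisms *)

Section Torus.
Variables (K : closedFieldType) (charK : [pchar K] =i pred0).
Variables (V : finType).
Local Notation n := #|V|.

Record torus := Torus { tval : V -> K; tval_neq0 : forall v, tval v != 0 }.
Implicit Types (t : torus) (chi : {ffun V -> int}).

Lemma torus_eq t t' : tval t =1 tval t' -> t = t'.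
Proof.
case: t t' => [t ht] [t' ht'] /= /funext e; subst t'.
by rewrite (Prop_irrelevance ht ht').
Qed.

Definition torus_mul t t' : torus :=
  @Torus (fun v => tval t v * tval t' v)
    (fun v => mulf_neq0 (tval_neq0 t v) (tval_neq0 t' v)).

Definition torus_one : torus := @Torus (fun=> 1) (fun=> oner_neq0 K).

Lemma two_neq0 : 2%:R != 0 :> K.
Proof. by rewrite (iffLR (pcharf0P K) charK). Qed.

Definition torus_pow2 (d : V -> int) : torus :=
  @Torus (fun v => 2%:R ^ d v) (fun v => expfz_neq0 (d v) two_neq0).

Definition character chi t : K := \prod_v tval t v ^ chi v.

Lemma character_neq0 chi t : character chi t != 0.
Proof. by apply/prodf_neq0 => v _; apply/expfz_neq0/tval_neq0. Qed.

Lemma character_mul chi t t' :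
  character chi (torus_mul t t') = character chi t * character chi t'.
Proof. by rewrite -big_split; apply: eq_bigr => v _; rewrite expfzMl. Qed.

Lemma character_one chi : character chi torus_one = 1.
Proof. by apply: big1 => v _; rewrite exp1rz. Qed.

Lemma characterD chi chi' t :
  character (chi + chi') t = character chi t * character chi' t.
Proof.
rewrite -big_split; apply: eq_bigr => v _ /=.
by rewrite ffunE expfzDr ?tval_neq0.
Qed.

Lemma character_pow2 chi d :
  character chi (torus_pow2 d) = 2%:R ^ (\sum_v d v * chi v).
Proof.
rewrite (big_morph (fun z => 2%:R ^ z) (id1 := 1) (op1 := *%R)).
- by apply: eq_bigr => v _; rewrite exprz_exp.
- by move=> a b; rewrite expfzDr ?two_neq0.
- by rewrite expr0z.
Qed.

Lemma character_distinct chi chi' : chi != chi' ->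
  exists t, character chi t != character chi' t.
Proof.
move=> ne; have [v nev] : exists v, chi v != chi' v.
  apply: contrapT => h; case/eqP: ne; apply/ffunP => v.
  by apply: contrapT => /eqP nev; apply: h; exists v.
exists (torus_pow2 (fun w => (w == v)%:R)); rewrite !character_pow2.
have sE (x : {ffun V -> int}) : \sum_w (w == v)%:R * x w = x v.
  rewrite (bigD1 v) //= eqxx mul1r big1 ?addr0 // => w /negPf ->.
  by rewrite mul0r.
rewrite !sE; apply: contra nev => /eqP e; rewrite -subr_eq0; apply/eqP.
apply: (expz2_eq1 charK); rewrite expfzDr ?two_neq0 // e -expfzDr ?two_neq0 //.
by rewrite subrr expr0z.
Qed.

(** A closed embedding in an affine space; polynomials in these coordinates are the
Laurent polynomials on the torus. *)
Definition torus_coord t : 'rV[K]_(n + n) :=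
  row_mx (\row_i tval t (enum_val i)) (\row_i (tval t (enum_val i))^-1).

Definition laurent_exp (k : 'X_{1..n + n}) : {ffun V -> int} :=
  [ffun v => (k (lshift n (enum_rank v)))%:Z - (k (rshift n (enum_rank v)))%:Z].

Lemma laurent_expE (k : 'X_{1..n + n}) t :
  \prod_i torus_coord t 0 i ^+ k i = character (laurent_exp k) t.
Proof.
rewrite big_split_ord /= -big_split /= /character (reindex (@enum_val V V)) /=; last first.
  by exists enum_rank => x _; rewrite ?enum_valK ?enum_rankK.
apply: eq_bigr => i _; rewrite row_mxEl row_mxEr !mxE ffunE enum_valK.
by rewrite expfzDr ?tval_neq0 // -exprnN exprVn.
Qed.

Section Laurent.
Variables (W : finType) (D : complex W).
Local Notation A := (SR_ring K D).
Local Notation pi := (@SR_pi K W D).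

Lemma laurent_expansion (F : 'rV[K]_(n + n) -> A) : apoly F ->
  exists s : seq {ffun V -> int}, exists a : {ffun V -> int} -> A,
    uniq s /\ forall t, F (torus_coord t) = \sum_(chi <- s) character chi t *: a chi.
Proof.
case=> s sE.
pose L := [seq (laurent_exp k, q.1@_k *: q.2) | q <- s, k <- msupp q.1].
exists (undup (map fst L)), (fun chi => \sum_(q <- L | q.1 == chi) q.2).
split=> [|t]; first exact: undup_uniq.
have -> : F (torus_coord t) = \sum_(q <- L) character q.1 t *: q.2.
  rewrite sE big_allpairs_dep; apply: eq_bigr => q _ /=.
  rewrite mevalE scaler_suml; apply: eq_bigr => k _.
  by rewrite laurent_expE scalerA mulrC.
rewrite (regroup (key := fst) _ (undup_uniq (map fst L))) => [|x]; last first.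
  by rewrite mem_undup.
apply: eq_bigr => chi _; rewrite scaler_sumr; apply: eq_bigr => q /eqP -> //.
Qed.

Lemma laurent_independence (s : seq {ffun V -> int}) (a : {ffun V -> int} -> A) :
  uniq s -> (forall t, \sum_(chi <- s) character chi t *: a chi = 0) ->
  {in s, forall chi, a chi = 0}.
Proof.
move=> us h chi schi.
pose b x := if x \in s then a x else 0.
pose P (f : {ffun V -> int} -> A) :=
  forall t, \sum_(x <- s) character x t *: f x = 0.
have : P (fun x => if x == chi then b chi else 0).
  apply: (@character_separation _ _ _ _ character P s) => //.
  - move=> f g c Pf Pg t; under eq_bigr do rewrite scalerDr scalerA mulrC -scalerA.
    by rewrite big_split /= -scaler_sumr Pf Pg scaler0 addr0.
  - move=> f t' Pf t; rewrite -[RHS](Pf (torus_mul t t')); apply: eq_bigr => x _.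
    by rewrite character_mul scalerA.
  - by move=> x x' _ _; apply: character_distinct.
  - by move=> x /negPf sx; rewrite /b sx.
  - by move=> t; rewrite -[RHS](h t); apply: eq_big_seq => x sx; rewrite /b sx.
move/(_ torus_one); rewrite (bigD1_seq chi) //= eqxx big1 ?addr0; last first.
  by move=> x /negPf ->; rewrite scaler0.
by rewrite character_one scale1r /b schi.
Qed.

(** ** The Lie algebra of a torus of automorphisms *)

Variable tau : torus -> alg_aut K D.
Hypotheses (tauM : forall t t', tau (torus_mul t t') = (tau t * tau t')%g)
  (tauF : alg_family torus_coord tau)
  (tau_inj : forall t, tau t = 1%g -> forall v, tval t v = 1).

Definition tweight chi (u : A) := forall t, tau t u = character chi t *: u.

Let tau1 u : tau torus_one u = u.
Proof.
have : (tau torus_one * tau torus_one = tau torus_one * 1)%g.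
  rewrite -tauM mulg1; congr tau; apply: torus_eq => v.
  by rewrite /= mulr1.
by move/mulgI => ->.
Qed.

Lemma tweightD chi u v : tweight chi u -> tweight chi v -> tweight chi (u + v).
Proof. by move=> hu hv t; rewrite rmorphD /= hu hv scalerDr. Qed.

Lemma tweightZ chi c u : tweight chi u -> tweight chi (c *: u).
Proof. by move=> hu t; rewrite linearZ /= hu !scalerA mulrC. Qed.

Lemma tweight0 chi : tweight chi 0.
Proof. by move=> t; rewrite rmorph0 scaler0. Qed.

Lemma tweight_sum chi (I : Type) (r : seq I) (P : pred I) (F : I -> A) :
  (forall i, P i -> tweight chi (F i)) -> tweight chi (\sum_(i <- r | P i) F i).
Proof. by move=> h; apply: big_ind => //; [apply: tweight0|apply: tweightD]. Qed.

Lemma tweightM chi chi' u v :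
  tweight chi u -> tweight chi' v -> tweight (chi + chi') (u * v).
Proof.
by move=> hu hv t; rewrite rmorphM /= hu hv characterD -scalerAl -scalerAr scalerA.
Qed.

Lemma tweight_decomp u : exists s : seq {ffun V -> int}, exists a,
  [/\ uniq s, forall chi, tweight chi (a chi) & u = \sum_(chi <- s) a chi].
Proof.
have [F Fp FE] := family_value tauF true u.
have [s [a [us sE]]] := laurent_expansion Fp.
have tE t : tau t u = \sum_(chi <- s) character chi t *: a chi.
  by rewrite -sE -FE.
exists s, (fun chi => if chi \in s then a chi else 0); split=> //.
  move=> chi; case: ifP => [schi t|_]; last exact: tweight0.
  apply/eqP; rewrite -subr_eq0; apply/eqP.
  apply: (laurent_independence (a := fun x => tau t (a x) - character x t *: a x) us _ schi).
  move=> t'; under eq_bigr do rewrite scalerBr scalerA -character_mul.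
  rewrite sumrB; apply/eqP; rewrite subr_eq0; apply/eqP.
  have -> : \sum_(x <- s) character x (torus_mul t' t) *: a x = tau t (tau t' u).
    rewrite -[RHS]/((tau t * tau t')%g u) -tauM tE.
    by apply: eq_bigr => x _; rewrite !character_mul mulrC.
  by rewrite (tE t') rmorph_sum; apply: eq_bigr => x _; rewrite /= linearZ.
rewrite -[LHS]tau1 tE; apply: eq_big_seq => chi schi.
by rewrite schi character_one scale1r.
Qed.

Lemma tweight_independence (s : seq {ffun V -> int}) (a : {ffun V -> int} -> A) :
  uniq s -> (forall chi, tweight chi (a chi)) -> \sum_(chi <- s) a chi = 0 ->
  {in s, forall chi, a chi = 0}.
Proof.
move=> us aw a0; apply: (laurent_independence us) => t.
have := congr1 (aut (tau t)) a0; rewrite rmorph0 rmorph_sum => e.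
by rewrite -[RHS]e; apply: eq_bigr => chi _; rewrite /= aw.
Qed.

(** The differential of the torus action, which can be computed on any expression of an
element as a sum of weight vectors. *)
Lemma torus_derivative : exists E : 'I_n -> A -> A, forall k (I : Type) (s : seq I)
    (chi : I -> {ffun V -> int}) (a : I -> A),
  (forall i, tweight (chi i) (a i)) ->
  E k (\sum_(i <- s) a i) = \sum_(i <- s) (chi i (enum_val k))%:~R *: a i.
Proof.
have dec u : exists p : seq {ffun V -> int} * ({ffun V -> int} -> A),
    [/\ uniq p.1, forall chi, tweight chi (p.2 chi) & u = \sum_(chi <- p.1) p.2 chi].
  by have [s [a h]] := tweight_decomp u; exists (s, a).
have [p pP] := choice dec.
exists (fun k u => \sum_(chi <- (p u).1) (chi (enum_val k))%:~R *: (p u).2 chi).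
move=> k I s chi a aw; set u := \sum_(i <- s) a i.
have [up pw uE] := pP u; move: (p u) up pw uE => [r b] /= ur bw uE.
pose l := undup (map chi s ++ r).
have ul : uniq l by apply: undup_uniq.
pose d x := \sum_(y <- r | y == x) b y - \sum_(i <- s | chi i == x) a i.
have sl : {subset map chi s <= l}.
  by move=> x xs; rewrite mem_undup mem_cat xs.
have rl : {subset map id r <= l}.
  by move=> x; rewrite map_id mem_undup mem_cat orbC => ->.
have d0 : {in l, forall x, d x = 0}.
  apply: tweight_independence => // [x|].
    rewrite /d -scaleN1r; apply: tweightD; last apply: tweightZ.
      by apply: tweight_sum => y /eqP <-.
    by apply: tweight_sum => i /eqP <-.
  by rewrite sumrB -(regroup _ ul rl) -(regroup _ ul sl) -uE subrr.
rewrite (regroup _ ul rl) (regroup _ ul sl); apply: eq_big_seq => x xl.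
transitivity ((x (enum_val k))%:~R *: \sum_(y <- r | y == x) b y).
  by rewrite scaler_sumr; apply: eq_bigr => y /eqP ->.
have /eqP := d0 x xl; rewrite subr_eq0 => /eqP ->.
by rewrite scaler_sumr; apply: eq_bigr => i /eqP ->.
Qed.

Definition weight_row (chi : {ffun V -> int}) : 'rV[K]_n :=
  \row_k (chi (enum_val k))%:~R.

Lemma weight_row_inj : injective weight_row.
Proof.
move=> chi chi' /rowP h; apply/ffunP => v; apply: (intr_inj_char0 charK).
by have := h (enum_rank v); rewrite !mxE enum_rankK.
Qed.

Section Toral.
Variable E : 'I_n -> A -> A.
Hypothesis Esum : forall k (I : Type) (s : seq I)
    (chi : I -> {ffun V -> int}) (a : I -> A),
  (forall i, tweight (chi i) (a i)) ->
  E k (\sum_(i <- s) a i) = \sum_(i <- s) (chi i (enum_val k))%:~R *: a i.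

Lemma tweight_weight_vec chi u : tweight chi u -> weight_vec E (weight_row chi) u.
Proof.
move=> uw k; have := Esum k [:: tt] (chi := fun=> chi) (a := fun=> u) (fun=> uw).
by rewrite !big_seq1 mxE.
Qed.

Lemma weight_vec_tweight x u : weight_vec E x u -> u != 0 ->
  exists2 chi, x = weight_row chi & tweight chi u.
Proof.
move=> ux u0; have [s [a [us aw uE]]] := tweight_decomp u.
have h k : {in s, forall chi, (weight_row chi - x) 0 k *: a chi = 0}.
  apply: tweight_independence => // [chi|]; first exact: tweightZ.
  have := ux k; rewrite uE (Esum k s aw) => /eqP; rewrite -subr_eq0 => /eqP e.
  rewrite -[RHS]e scaler_sumr -sumrB; apply: eq_bigr => chi _.
  by rewrite !mxE scalerBl.
have {}h chi : chi \in s -> a chi != 0 -> weight_row chi = x.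
  move=> schi a0; apply/eqP; rewrite -subr_eq0; apply/eqP/rowP => k.
  rewrite [RHS]mxE; apply: contrapT => /eqP c0; case/eqP: a0.
  by rewrite -[a chi]scale1r -(mulVf c0) -scalerA h // scaler0.
have [chi schi a0] : exists2 chi, chi \in s & a chi != 0.
  apply: contrapT => h'; case/eqP: u0; rewrite uE big_seq big1 // => chi schi.
  by apply: contrapT => /eqP a0; apply: h'; exists chi.
exists chi; first by rewrite h.
rewrite uE big_seq; apply: tweight_sum => chi' schi'.
have [->|a0'] := eqVneq (a chi') 0; first exact: tweight0.
by rewrite (weight_row_inj (etrans (h chi schi a0) (esym (h chi' schi' a0')))).
Qed.

(** Linear independence over the field comes from the injectivity of the torus: an
integral relation between the coordinates of the weights would give a
one-parameter subgroup acting trivially. *)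
Lemma torus_toral : toral E.
Proof.
have Epair k (s : seq ({ffun V -> int} * A)) :
    (forall q, q \in s -> tweight q.1 q.2) ->
    E k (\sum_(q <- s) q.2) = \sum_(q <- s) (q.1 (enum_val k))%:~R *: q.2.
  move=> sw; pose a q := if q \in s then q.2 else (0 : A).
  transitivity (E k (\sum_(q <- s) a q)).
    by congr (E k); apply: eq_big_seq => q qs; rewrite /a qs.
  rewrite (Esum k s (chi := fst)) => [|q]; last first.
    by rewrite /a; case: ifP => [/sw|_] //; apply: tweight0.
  by apply: eq_big_seq => q qs; rewrite /a qs.
split.
- move=> k; split=> [c u v|u v].
    have [s [a [_ aw ->]]] := tweight_decomp u.
    have [t [b [_ bw ->]]] := tweight_decomp v.
    pose L := [seq (x, c *: a x) | x <- s] ++ [seq (x, b x) | x <- t].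
    have -> : c *: (\sum_(x <- s) a x) + \sum_(x <- t) b x = \sum_(q <- L) q.2.
      by rewrite big_cat !big_map /= scaler_sumr.
    rewrite Epair => [|q]; last first.
      by rewrite mem_cat => /orP [] /mapP [x _ ->] //; apply: tweightZ.
    rewrite big_cat !big_map /= (Esum k s aw) (Esum k t bw) scaler_sumr.
    by congr (_ + _); apply: eq_bigr => x _; rewrite !scalerA mulrC.
  have [s [a [_ aw ->]]] := tweight_decomp u.
  have [t [b [_ bw ->]]] := tweight_decomp v.
  pose L := [seq (x + y, a x * b y) | x <- s, y <- t].
  have -> : (\sum_(x <- s) a x) * (\sum_(x <- t) b x) = \sum_(q <- L) q.2.
    by rewrite big_allpairs_dep big_distrlr.
  rewrite Epair => [|q /allpairsP [[x y] [_ _ ->]]]; last exact: tweightM.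
  rewrite big_allpairs_dep (Esum k s aw) (Esum k t bw) !big_distrlr /= -big_split.
  apply: eq_bigr => x _; rewrite -big_split; apply: eq_bigr => y _ /=.
  by rewrite ffunE rmorphD scalerDl scalerAl scalerAr.
- move=> u; have [s [a [us aw ->]]] := tweight_decomp u.
  exists (map weight_row s), (fun x => \sum_(chi <- s | weight_row chi == x) a chi).
  split; first by rewrite map_inj_uniq //; apply: weight_row_inj.
    move=> x k; rewrite -big_filter (Esum k _ aw) !big_filter scaler_sumr; apply: eq_bigr => chi /eqP <-.
    by rewrite mxE.
  by rewrite -regroup // map_inj_uniq //; apply: weight_row_inj.
move=> c h.
have dec (i : 'I_#|W|) : exists p : seq {ffun V -> int} * ({ffun V -> int} -> A),
    [/\ uniq p.1, forall chi, tweight chi (p.2 chi) &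
        pi 'X_i = \sum_(chi <- p.1) p.2 chi].
  by have [s [a ?]] := tweight_decomp (pi 'X_i); exists (s, a).
have [p pP] := choice dec.
pose L := flatten [seq [seq chi <- (p i).1 | (p i).2 chi != 0] | i <- enum 'I_#|W|].
pose X : 'M[int]_(size L, n) := \matrix_(j, k) nth 0 L j (enum_val k).
have Lc chi : chi \in L -> \sum_k (chi (enum_val k))%:~R * c k 0 = 0.
  move=> /flatten_mapP [i _]; rewrite mem_filter => /andP [a0 _].
  have [_ aw _] := pP i; have := h ((p i).2 chi).
  under eq_bigr do rewrite (tweight_weight_vec (aw chi)) scalerA mxE mulrC.
  rewrite -scaler_suml => /eqP; rewrite scaler_eq0 (negPf a0) orbF => /eqP.
  by [].
(* The rows of [X] are the weights that occur in the variables. *)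
apply: (int_kernel charK (X := X)); last first.
  apply/colP => j; rewrite !mxE -[RHS](Lc (nth 0 L j)) ?mem_nth //.
  by apply: eq_bigr => k _; rewrite !mxE.
move=> d Xd; pose t := torus_pow2 (fun v => d (enum_rank v) 0).
have Ld chi : chi \in L -> character chi t = 1.
  move=> /(nthP 0) [j jL <-]; rewrite character_pow2.
  have /colP /(_ (Ordinal jL)) := Xd; rewrite !mxE => e.
  rewrite (reindex (@enum_val V V)) /=; last first.
    by exists enum_rank => x _; rewrite ?enum_valK ?enum_rankK.
  rewrite -[RHS](expr0z 2%:R); congr (_ ^ _); rewrite -[RHS]e; apply: eq_bigr => k _.
  by rewrite enum_valK mxE mulrC.
have t1 : tau t = 1%g.
  apply: alg_aut_eq => u; apply: (lrmorph_eq (f := tau t) (g := idfun)) => i /=.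
  have [_ aw ->] := pP i; rewrite rmorph_sum; apply: eq_big_seq => chi schi /=.
  have [->|a0] := eqVneq ((p i).2 chi) 0; first by rewrite rmorph0.
  rewrite aw Ld ?scale1r //; apply/flatten_mapP; exists i; rewrite ?mem_enum //.
  by rewrite mem_filter a0.
apply/colP => k; rewrite mxE; apply: (expz2_eq1 charK).
by have := tau_inj t1 (enum_val k); rewrite /= enum_valK.
Qed.

End Toral.

(** The Lie algebra of the torus is linearized by [linearization]; its eigenvectors are
weight vectors of the torus itself, and their eigenvalues are integers. *)
Lemma torus_linearization : (#|W| <= n)%N ->
  exists (omega : 'I_#|W| -> {ffun V -> int}) (f : alg_aut K D),
    [/\ forall i, tweight (omega i) (f (pi 'X_i)), n = #|W| &
        row_free (\matrix_i weight_row (omega i))].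
Proof.
move=> Wn; have [E Esum] := torus_derivative.
have [x [f [xw nm xfree]]] := linearization charK (torus_toral Esum) Wn.
have ex i : exists chi, x i = weight_row chi /\ tweight chi (f (pi 'X_i)).
  have [|chi e h] := weight_vec_tweight Esum (xw i); last by exists chi.
  apply/negP => /eqP /(congr1 (aut_inv f)); rewrite autK rmorph0.
  move/(congr1 (cf U_(i)%MM)); rewrite cfX ?faceU // eqxx cf0 ?faceU // => /eqP.
  by rewrite oner_eq0.
have [omega oP] := choice ex; exists omega, f; split=> // [i|].
  by have [] := oP i.
suff <- : \matrix_i x i = \matrix_i weight_row (omega i) by [].
by apply/row_matrixP => i; rewrite !rowK; have [] := oP i.
Qed.

End Laurent.
End Torus.

(** * Roots of the standard torus *)

Section Roots.
Variables (K : closedFieldType) (charK : [pchar K] =i pred0).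
Variables (V : finType) (D : complex V).
Local Notation R := {mpoly K[#|V|]}.
Local Notation A := (SR_ring K D).
Local Notation pi := (@SR_pi K V D).
Implicit Types (t : torus K V) (chi : {ffun V -> int}).

Lemma scaling_exists t : exists f : alg_aut K D,
  (forall i, f (pi 'X_i) = tval t (enum_val i) *: pi 'X_i) /\
  (forall i, aut_inv f (pi 'X_i) = (tval t (enum_val i))^-1 *: pi 'X_i).
Proof.
have lift (c : V -> K) : exists f : {lrmorphism A -> A},
    forall i, f (pi 'X_i) = c (enum_val i) *: pi 'X_i.
  apply: lift_facets => i F FD iF; apply: (vanishesZ (facet_face FD)).
  by apply: (vanishesX _ (facet_face FD)); rewrite mnm_suppU sub1set.
have [f fE] := lift (tval t); have [g gE] := lift (fun v => (tval t v)^-1).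
have [i|i|h hE] := alg_aut_gens (f := f) (g := g).
- by rewrite fE linearZ /= gE scalerA mulfV ?scale1r // tval_neq0.
- by rewrite gE linearZ /= fE scalerA mulVf ?scale1r // tval_neq0.
exists h; split=> i; first by rewrite hE fE.
apply: (can_inj (@autK _ _ _ h)); rewrite aut_invK hE linearZ /= fE.
by rewrite scalerA mulVf ?scale1r // tval_neq0.
Qed.

Definition std t : alg_aut K D := projT1 (cid (scaling_exists t)).

Lemma stdX t i : std t (pi 'X_i) = tval t (enum_val i) *: pi 'X_i.
Proof. by rewrite /std; case: (cid _) => f []. Qed.

Lemma std_invX t i : aut_inv (std t) (pi 'X_i) = (tval t (enum_val i))^-1 *: pi 'X_i.
Proof. by rewrite /std; case: (cid _) => f []. Qed.

Lemma alg_aut_ext (f g : alg_aut K D) :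
  (forall i, f (pi 'X_i) = g (pi 'X_i)) -> f = g.
Proof. by move=> h; apply/alg_aut_eq/lrmorph_eq. Qed.

Lemma stdM t t' : std (torus_mul t t') = (std t * std t')%g.
Proof.
apply: alg_aut_ext => i; rewrite stdX -[RHS]/(std t (std t' _)) stdX linearZ /= stdX.
by rewrite scalerA mulrC.
Qed.

Lemma std_family : alg_family (@torus_coord K V) std.
Proof.
move=> b v; have x_i : SR_var K D v = pi 'X_(enum_rank v) by [].
case: b.
  exists (fun z => z 0 (lshift _ (enum_rank v)) *: SR_var K D v).
    by apply: apolyZ; apply: apoly_const.
  by move=> t; rewrite /= x_i stdX row_mxEl mxE.
exists (fun z => z 0 (rshift _ (enum_rank v)) *: SR_var K D v).
  by apply: apolyZ; apply: apoly_const.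
by move=> t; rewrite /= x_i std_invX row_mxEr mxE.
Qed.

Lemma std_inj t : std t = 1%g -> forall v, tval t v = 1.
Proof.
move=> t1 v; have := stdX t (enum_rank v); rewrite t1 /= enum_rankK.
move/(congr1 (cf U_(enum_rank v)%MM)); rewrite cfZ ?faceU // cfX ?faceU // eqxx mulr1.
by move=> <-.
Qed.

Definition mnm_exp (m : 'X_{1..#|V|}) : {ffun V -> int} :=
  [ffun v => (m (enum_rank v))%:Z].

Lemma std_mon t m : std t (pi 'X_[m]) = character (mnm_exp m) t *: pi 'X_[m].
Proof.
rewrite lrmorph_pi msuppX big_seq1 mcoeffX eqxx scale1r.
under eq_bigr do rewrite stdX exprZn.
rewrite scaler_prod mpolyXE_id rmorph_prod; congr (_ *: _); last first.
  by apply: eq_bigr => i _; rewrite rmorphXn.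
rewrite /character (reindex (@enum_val V V)) /=; last first.
  by exists enum_rank => x _; rewrite ?enum_valK ?enum_rankK.
by apply: eq_bigr => i _; rewrite ffunE enum_valK.
Qed.

Lemma std_invZ t i : (std t)^-1%g (pi 'X_i) = (tval t (enum_val i))^-1 *: pi 'X_i.
Proof. exact: std_invX. Qed.

Definition unit_exp (v : V) : {ffun V -> int} := [ffun w => (w == v)%:R].

Lemma character_unit v t : character (unit_exp v) t = tval t v.
Proof.
rewrite /character (bigD1 v) //= ffunE eqxx big1 ?mulr1 //.
by move=> w /negPf wv; rewrite ffunE wv.
Qed.

(** The weights of the root subgroups, that is of the one-parameter additive groups
normalized by the standard torus; an isomorphism of ind-groups transports them. *)
Definition root chi := exists2 lambda : K -> alg_aut K D,
  alg_family (fun s : K => const_mx s : 'rV[K]_1) lambda &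
  [/\ forall s s', lambda (s + s') = (lambda s * lambda s')%g,
      exists s, lambda s <> 1%g &
      forall t s, (std t * lambda s * (std t)^-1)%g = lambda (character chi t * s)].

(** The exponents of the homogeneous locally nilpotent derivations: a monomial
supported on an exposing face of [v], times the derivation along [v]. *)
Definition root_shape chi := exists v,
  [/\ chi v = -1, forall w, w != v -> 0 <= chi w &
      [set w | 0 < chi w] \in exposing D v].

(** The group is [x_v |-> x_v + s * x^m]; every facet containing the support of [m]
contains [v], so that the image of [x_v] vanishes wherever [x_v] does. *)
Lemma root_of_exposing v (m : 'X_{1..#|V|}) : mnm_supp m \in exposing D v ->
  root (mnm_exp m - unit_exp v).
Proof.
rewrite inE => /andP [mD /andP [vm vcl]].
have mi0 : m (enum_rank v) = 0%N by apply/eqP; move: vm; rewrite inE negbK.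
pose a s (i : 'I_#|V|) : A :=
  if i == enum_rank v then pi 'X_i + s *: pi 'X_[m] else pi 'X_i.
have lift s : exists f : {lrmorphism A -> A}, forall i, f (pi 'X_i) = a s i.
  apply: lift_facets => i F FD iF; have FD' := facet_face FD.
  have xi : vanishes_on F (pi 'X_i).
    by apply: (vanishesX _ FD'); rewrite mnm_suppU sub1set.
  rewrite /a; case: eqP => // e; apply: (vanishesD FD') => //; apply: (vanishesZ FD').
  apply: (vanishesX _ FD'); apply: contra iF => mF; rewrite e enum_rankK.
  by move/bigcapP: vcl; apply; rewrite inE FD.
have [f fE] := choice lift.
have fm s : f s (pi 'X_[m]) = pi 'X_[m].
  rewrite lrmorph_pi msuppX big_seq1 mcoeffX eqxx scale1r mpolyXE_id rmorph_prod.
  apply: eq_bigr => i _; rewrite fE /a rmorphXn.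
  by case: eqP => // ->; rewrite mi0 !expr0.
have faa s s' i : f s (f s' (pi 'X_i)) = a (s + s') i.
  rewrite fE /a; case: eqP => [->|/eqP/negPf ni]; last by rewrite fE /a ni.
  by rewrite rmorphD /= linearZ /= fm fE /a eqxx -addrA -scalerDl.
have a0 i : a 0 i = pi 'X_i by rewrite /a scale0r addr0 if_same.
have exaut s : exists h : alg_aut K D, aut h = f s /\ aut_inv h =1 f (- s).
  have [i|i|h hE] := alg_aut_gens (f := f s) (g := f (- s)).
  - by rewrite faa addNr a0.
  - by rewrite faa subrr a0.
  exists h; split=> // u; apply: (can_inj (@autK _ _ _ h)); rewrite aut_invK hE.
  apply/esym; apply: (lrmorph_eq (f := f s \o f (- s)) (g := idfun)) => i /=.
  by rewrite faa subrr a0.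
have [lambda lP] := choice exaut.
have lX s i : lambda s (pi 'X_i) = a s i by have [-> _] := lP s.
exists lambda.
  have ap (c : K) w : exists2 F : 'rV[K]_1 -> A, apoly F &
      forall s, a (c * s) (enum_rank w) = F (const_mx s).
    have [e|ne] := boolP (enum_rank w == enum_rank v).
      exists (fun z => pi 'X_(enum_rank w) + z 0 0 *: (c *: pi 'X_[m])).
        by apply: apolyD; [apply: apoly_const|apply: apolyZ; apply: apoly_const].
      by move=> s; rewrite /a e mxE scalerA mulrC.
    exists (fun=> pi 'X_(enum_rank w)); first exact: apoly_const.
    by move=> s; rewrite /a (negPf ne).
  move=> b w; case: b.
    by have [F Fp FE] := ap 1 w; exists F => // s; rewrite -FE mul1r -lX.
  have [F Fp FE] := ap (-1) w; exists F => // s; rewrite -FE mulN1r /=.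
  by have [_ ->] := lP s; rewrite fE.
split=> [s s'||t s].
- apply: alg_aut_ext => i; rewrite lX -[RHS]/(lambda s (lambda s' _)).
  by have [-> _] := lP s; have [-> _] := lP s'; rewrite faa.
- exists 1 => e; have := lX 1 (enum_rank v); rewrite e /a eqxx scale1r /=.
  move/(congr1 (cf m)); rewrite cfD // -[LHS]addr0 => /addrI /esym.
  by rewrite cfX // eqxx => /eqP; rewrite oner_eq0.
apply: alg_aut_ext => i.
rewrite -[LHS]/(std t (lambda s ((std t)^-1%g (pi 'X_i)))) std_invZ linearZ linearZ /=.
rewrite !lX /a; case: eqP => [->|_].
  rewrite rmorphD /= linearZ /= stdX std_mon enum_rankK scalerDr !scalerA.
  rewrite mulVf ?tval_neq0 // scale1r; congr (_ + _ *: _).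
  have -> : character (mnm_exp m - unit_exp v) t = character (mnm_exp m) t / tval t v.
    apply: (mulIf (tval_neq0 t v)); rewrite -{1}character_unit -characterD subrK.
    by rewrite divfK // tval_neq0.
  by rewrite [RHS]mulrC mulrCA [_^-1 * _]mulrC; exact: mulrC.
by rewrite stdX scalerA mulVf ?scale1r // tval_neq0.
Qed.

Section RootShape.
Variables (chi : {ffun V -> int}) (lambda : K -> alg_aut K D).
Hypotheses (lambdaF : alg_family (fun s : K => const_mx s : 'rV[K]_1) lambda)
  (lambdaD : forall s s', lambda (s + s') = (lambda s * lambda s')%g)
  (lambda_chi : forall t s,
     (std t * lambda s * (std t)^-1)%g = lambda (character chi t * s)).

Let lambda0 : lambda 0 = 1%g.
Proof.
have : (lambda 0 * lambda 0 = lambda 0 * 1)%g by rewrite -lambdaD addr0 mulg1.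
exact: mulgI.
Qed.

Let lambdaN s u : lambda s (lambda (- s) u) = u.
Proof. by rewrite -[LHS]/((lambda s * lambda (- s))%g u) -lambdaD subrr lambda0. Qed.

Let coefficient i m : mnm_supp m \in faces D -> exists P : {poly K},
  forall s, cf m (lambda s (pi 'X_i)) = P.[s].
Proof.
move=> mD; have [F Fp FE] := family_value lambdaF true (pi 'X_i).
have [Q QE] := apoly_coef mD Fp.
exists (\sum_(k <- msupp Q) Q@_k *: 'X^(mdeg k)) => s.
rewrite /cf -[aut (lambda s) _]/(sel (lambda s) true _) FE QE mevalE horner_sum.
by apply: eq_bigr => k _; rewrite hornerZ hornerXn mdegE !big_ord1 mxE.
Qed.

(* Conjugation by the torus multiplies the parameter by [character chi t], so that only
one weight can occur in a given degree of the parameter. *)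
Let coefficient_weight i m (P : {poly K}) k : mnm_supp m \in faces D ->
  (forall s, cf m (lambda s (pi 'X_i)) = P.[s]) -> P`_k != 0 ->
  mnm_exp m = unit_exp (enum_val i) + chi *+ k.
Proof.
move=> mD PE Pk.
suff h t : character (mnm_exp m) t = character (unit_exp (enum_val i) + chi *+ k) t.
  apply: contrapT => /eqP ne; have [t] := character_distinct charK ne.
  by rewrite h eqxx.
set c := character chi t; set x := tval t (enum_val i).
have x0 : x != 0 := tval_neq0 t _.
have hom s : P.[c * s] = x^-1 * (character (mnm_exp m) t * P.[s]).
  rewrite -!PE -lambda_chi.
  rewrite -[aut (_ * _)%g _]/(std t (lambda s ((std t)^-1%g (pi 'X_i)))).
  rewrite std_invZ linearZ /= linearZ /= cfZ //; congr (_ * _).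
  set u := lambda s (pi 'X_i); rewrite [u in LHS]monomial_expansion rmorph_sum.
  rewrite [u in RHS]monomial_expansion !cf_sum // mulr_sumr; apply: eq_bigr => l lD.
  rewrite /= linearZ /= std_mon !cfZ // cfX //.
  by case: eqP => [->|_]; rewrite ?mulr0 // !mulr1 mulrC.
have : c ^+ k * P`_k = x^-1 * character (mnm_exp m) t * P`_k.
  pose q := \poly_(l < size P) (c ^+ l * P`_l - x^-1 * character (mnm_exp m) t * P`_l).
  have q0 : q = 0.
    apply/eqP/contraT => /closed_nonrootP [s]; rewrite rootE horner_poly => /eqP [].
    under eq_bigr do rewrite mulrBl.
    rewrite sumrB; apply/eqP; rewrite subr_eq0; apply/eqP.
    transitivity (P.[c * s]).
      rewrite horner_coef; apply: eq_bigr => l _.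
      by rewrite exprMn mulrCA mulrA.
    rewrite hom horner_coef !mulr_sumr; apply: eq_bigr => l _.
    by rewrite !mulrA.
  have kP : (k < size P)%N.
    by rewrite ltnNge; apply: contra Pk => /leq_sizeP ->.
  have := congr1 (fun p : {poly K} => p`_k) q0; rewrite coef_poly kP coef0 => /eqP.
  by rewrite subr_eq0 => /eqP.
move/(mulIf Pk) => e; rewrite characterD character_unit -/x.
have -> : character (chi *+ k) t = c ^+ k.
  elim: k {Pk e} => [|k IH].
    by rewrite mulr0n expr0 [LHS]big1 // => w _; rewrite ffunE expr0z.
  by rewrite mulrS characterD IH exprS.
by rewrite e mulrA mulfV // mul1r.
Qed.

Let fixed_var i : (forall m k (P : {poly K}), mnm_supp m \in faces D ->
    (forall s, cf m (lambda s (pi 'X_i)) = P.[s]) -> P`_k.+1 = 0) ->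
  forall s, lambda s (pi 'X_i) = pi 'X_i.
Proof.
move=> h s; apply: SR_coef_eq => m mD; rewrite -!/(cf m _).
have [P PE] := coefficient i mD.
have P0 : P = (P`_0)%:P.
  by apply/polyP => -[|k]; rewrite coefC //= (h m k P mD PE).
have e0 : cf m (pi 'X_i) = P.[0] by rewrite -PE lambda0.
by rewrite e0 PE P0 !hornerC.
Qed.

Let weight_at (i : 'I_#|V|) m k v : mnm_exp m = unit_exp (enum_val i) + chi *+ k ->
  (m (enum_rank v))%:Z = (v == enum_val i : nat)%:Z + chi v *+ k.
Proof. by move/ffunP/(_ v); rewrite !ffunE ffunMnE natz. Qed.

Let trivial_weight0 : chi = 0 -> forall i s, lambda s (pi 'X_i) = pi 'X_i.
Proof.
move=> chi0 i; apply: fixed_var => m k P mD PE.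
apply: contrapT => /eqP Pk; have := coefficient_weight mD PE Pk.
rewrite chi0 mul0rn addr0 => /ffunP mE.
have {}mE : m = U_(i)%MM.
  apply/mnmP => j; have := mE (enum_val j); rewrite !ffunE enum_valK.
  by rewrite (inj_eq enum_val_inj) mnm1E eq_sym; case: eqP => _ /eqP; lia.
rewrite mE in PE mD => {mE m}.
have lE s : lambda s (pi 'X_i) = P.[s] *: pi 'X_i.
  apply: SR_coef_eq => l lD; rewrite -!/(cf l _) cfZ // cfX //.
  have [<-|ne] := eqVneq; first by rewrite mulr1.
  rewrite mulr0; have [Q QE] := coefficient i lD; rewrite QE.
  have [->|Q0] := eqVneq Q 0; first by rewrite horner0.
  case/eqP: ne; have Ql : Q`_(size Q).-1 != 0 by rewrite -lead_coefE lead_coef_eq0.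
  have := coefficient_weight lD QE Ql; rewrite chi0 mul0rn addr0 => /ffunP h.
  apply/mnmP => j; have := h (enum_val j); rewrite !ffunE enum_valK.
  by rewrite (inj_eq enum_val_inj) mnm1E eq_sym; case: eqP => _ /eqP; lia.
have : size P == 1%N.
  apply: contraT => /closed_rootP [s /rootP Ps].
  have := lambdaN (- s) (pi 'X_i).
  rewrite opprK lE Ps scale0r rmorph0 => /(congr1 (cf U_(i)%MM)).
  by rewrite cf0 // cfX // eqxx => /eqP; rewrite eq_sym oner_eq0.
by move/size_poly1P => [c _ Pc]; rewrite Pc coefC eqxx in Pk.
Qed.

(** With a nonnegative weight the image of a variable is a multiple of it; since the
inverse automorphism has the same property, degrees cannot grow. *)
Let trivial_nonneg : (forall v, 0 <= chi v) -> forall i s, lambda s (pi 'X_i) = pi 'X_i.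
Proof.
move=> chi_ge0; have [/trivial_weight0 //|chi0] := eqVneq chi 0.
have [w chiw] : exists w, 0 < chi w.
  apply: contrapT => h; case/eqP: chi0; apply/ffunP => w; rewrite ffunE.
  have := chi_ge0 w; rewrite le_eqVlt => /orP [/eqP <-//|cw].
  by case: h; exists w.
move=> i; apply: fixed_var => m k P mD PE; apply: contrapT => /eqP Pk.
have mE := weight_at _ (coefficient_weight mD PE Pk).
have mdeg2 : (1 < mdeg m)%N.
  have mw := mE w; have mi := mE (enum_val i); rewrite enum_valK eqxx in mi.
  have ci : 0 <= chi (enum_val i) *+ k.+1 by rewrite mulrn_wge0.
  have cw : 0 < chi w *+ k.+1 by rewrite mulrn_wgt0.
  rewrite mdegE (bigD1 i) //=; have [wi|wi] := eqVneq w (enum_val i).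
    rewrite wi enum_valK in mw cw; rewrite eqxx in mw.
    have aux (a b : nat) (x : int) : a%:Z = 1 + x -> 0 < x -> (1 < a + b)%N by lia.
    exact: aux mw cw.
  rewrite (bigD1 (enum_rank w)) /=; last first.
    by apply: contra wi => /eqP <-; rewrite enum_rankK.
  have aux (a b c : nat) (x y : int) : a%:Z = 1 + x -> 0 <= x -> b%:Z = 0 + y ->
    0 < y -> (1 < a + (b + c))%N by lia.
  by rewrite (negPf wi) in mw; apply: aux mi ci mw cw.
have [s Ps] : exists s, P.[s] != 0.
  have : P != 0 by apply: contra Pk => /eqP ->; rewrite coef0.
  by move/closed_nonrootP => [s]; exists s.
pose x := lambda (- s) (pi 'X_i).
have [y xE] : exists y, x = pi 'X_i * y.
  exists (\sum_(l <- msupp (SR_repr x) | mnm_supp l \in faces D)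
            cf l x *: pi 'X_[l - U_(i)]).
  rewrite [LHS]monomial_expansion mulr_sumr; apply: eq_bigr => l lD.
  rewrite -scalerAr; have [->|cl] := eqVneq (cf l x) 0; first by rewrite !scale0r.
  congr (_ *: _); rewrite -piXD addmC submK // lep1mP.
  have [Q QE] := coefficient i lD; have [k' Qk] : exists k', Q`_k' != 0.
    apply: contrapT => h; case/eqP: cl; rewrite QE (_ : Q = 0) ?horner0 //.
    apply/polyP => k'; rewrite coef0; apply: contrapT => /eqP Qk.
    by apply: h; exists k'.
  have := weight_at (enum_val i) (coefficient_weight lD QE Qk).
  have : 0 <= chi (enum_val i) *+ k' by rewrite mulrn_wge0.
  rewrite enum_valK eqxx => ci le; apply/eqP => li.
  by move: le; rewrite li; lia.
pose S := mnm_supp m.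
have iS : enum_val i \in S.
  have := mE (enum_val i); have : 0 <= chi (enum_val i) *+ k.+1 by rewrite mulrn_wge0.
  rewrite mem_mnm_supp enum_valK eqxx => ci le; apply/eqP => mi.
  by move: le; rewrite mi; lia.
(* On the face that supports the monomial [m], the variable would have a divisor of
degree at least 2. *)
have := lambdaN s (pi 'X_i); rewrite -/x xE rmorphM /= => /(congr1 (restr S)).
rewrite (restrM mD) [RHS](restr_pi mD) mmapX mmap1U /restr_var iS => e.
have e0 : 'X_i != 0 :> R by rewrite -msize_poly_eq0 msizeX.
have : restr S (lambda s (pi 'X_i)) * restr S (lambda s y) != 0 by rewrite e.
rewrite mulf_eq0 negb_or => /andP [r1 r2].
have sz := congr1 (fun p : R => msize p) e; rewrite msizeM // msizeX mdeg1 in sz.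
have sm : (mdeg m < msize (restr S (lambda s (pi 'X_i))))%N.
  by apply: msize_mdeg_lt; rewrite mcoeff_msupp mcoeff_restr subxx PE.
have sy : (0 < msize (restr S (lambda s y)))%N by rewrite lt0n msize_poly_eq0.
have aux (a b c : nat) : (1 < a)%N -> (a < b)%N -> (0 < c)%N -> (b + c).-1 <> 2%N.
  move=> a1 ab; case: c => // c _; rewrite addnS => /= bc.
  by have := leq_ltn_trans a1 ab; rewrite -bc ltnNge leq_addr.
exact: aux mdeg2 sm sy sz.
Qed.

(** Exponents are nonnegative, so a weight negative at [v] moves only [x_v], and by a
single monomial whose exponent at [v] is zero. If a facet [F] contained the
support of that monomial but not [v], then applying the automorphism to
[x_v * x_F = 0] would yield a nonzero monomial. *)
Lemma root_shapeP : (exists s, lambda s <> 1%g) -> root_shape chi.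
Proof.
move=> [s0 ls0].
have moved : ~ forall i s, lambda s (pi 'X_i) = pi 'X_i.
  by move=> h; apply: ls0; apply: alg_aut_ext => i; rewrite h.
have [v cv] : exists v, chi v < 0.
  apply: contrapT => h; apply: moved; apply: trivial_nonneg => v.
  by rewrite leNgt; apply/negP => cv; apply: h; exists v.
have fixed i : enum_val i != v -> forall s, lambda s (pi 'X_i) = pi 'X_i.
  move=> iv; apply: fixed_var => m k P mD PE; apply: contrapT => /eqP Pk.
  have := weight_at v (coefficient_weight mD PE Pk).
  have : chi v *+ k.+1 < 0 by rewrite pmulrn_llt0.
  by rewrite eq_sym (negPf iv); lia.
pose i := enum_rank v.
have [m [k [P [mD PE Pk]]]] : exists m k P, [/\ mnm_supp m \in faces D,
    forall s, cf m (lambda s (pi 'X_i)) = P.[s] & P`_k.+1 != 0].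
  apply: contrapT => h; apply: moved => j s.
  have [jv|] := eqVneq (enum_val j) v; last by move/fixed; apply.
  have -> : j = i by rewrite /i -jv enum_valK.
  apply: fixed_var => m k P mD PE; apply: contrapT => /eqP Pk.
  by apply: h; exists m, k, P.
have mE w := weight_at w (coefficient_weight mD PE Pk).
have [k0 chiv] : k = 0%N /\ chi v = -1.
  have mv := mE v; rewrite enum_rankK eqxx in mv.
  have aux0 (a : nat) (x : int) : a%:Z = 1 + (x + 0) -> x < 0 -> x = -1 by lia.
  have aux1 (a : nat) (x y : int) : a%:Z = 1 + (x + (x + y)) -> x < 0 -> y <= 0 -> False.
    by lia.
  move: mv; case: (k) => [|k']; rewrite !mulrS ?mulr0n => mv.
    by split=> //; apply: aux0 mv cv.
  by case: (aux1 _ _ _ mv cv); rewrite mulrn_wle0 // ltW.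
have mv : m i = 0%N by have := mE v; rewrite enum_rankK eqxx k0 mulr1n chiv => -[].
have mw w : w != v -> chi w = m (enum_rank w).
  by move=> wv; have := mE w; rewrite enum_rankK (negPf wv) k0 mulr1n add0r.
exists v; split=> // [w wv|]; first by rewrite mw.
have -> : [set w | 0 < chi w] = mnm_supp m.
  apply/setP => w; rewrite !inE; have [->|wv] := eqVneq w v; first by rewrite chiv mv.
  by rewrite mw //; lia.
rewrite inE mD inE mv /=; apply/bigcapP => F; rewrite inE => /andP [FD mF].
apply: contrapT => /negP vF.
pose x := pi 'X_[set_mnm F].
have xfix s : lambda s x = x.
  rewrite lrmorph_pi msuppX big_seq1 mcoeffX eqxx scale1r /x mpolyXE_id rmorph_prod.
  apply: eq_bigr => j _; rewrite rmorphXn /= mnmE.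
  case jF : (enum_val j \in F); last by rewrite !expr0.
  by rewrite fixed //; apply: contraNneq vF => <-.
have x0 : pi 'X_i * x = 0.
  rewrite -piXD pi_nonface // mnm_suppD mnm_supp_set mnm_suppU enum_rankK.
  apply/negP => h; have := facet_max FD h (subsetUr _ _).
  by move/setP/(_ v); rewrite !inE eqxx (negPf vF).
have mFD : mnm_supp (m + set_mnm F)%MM \in faces D.
  by rewrite mnm_suppD mnm_supp_set (setUidPr mF) facet_face.
case/eqP: Pk; suff -> : P = 0 by rewrite coef0.
apply/eqP/contraT => /closed_nonrootP [s]; rewrite rootE -PE => /eqP [].
rewrite -(@cfMX _ _ _ _ m (set_mnm F)) // -/x -[x](xfix s) -rmorphM /= x0 rmorph0.
exact: cf0.
Qed.

End RootShape.

Lemma root_has_shape chi : root chi -> root_shape chi.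
Proof. by move=> [lambda lF [lD l1 lchi]]; apply: (root_shapeP lF lD lchi). Qed.

End Roots.

(** * From the roots to the complex *)

Lemma row_free_injection (F : fieldType) m n (M : 'M[F]_(m, n)) : n = m -> row_free M ->
  exists2 s : 'I_m -> 'I_n, injective s & forall i, M i (s i) != 0.
Proof.
move=> nm; case: m / nm M => M; rewrite row_free_unit => /unitmx_perm [s sP].
by exists s => //; apply: perm_inj.
Qed.

Section Transport.
Variables (K : closedFieldType) (charK : [pchar K] =i pred0).
Variables (V W : finType) (D : complex V) (E : complex W).
Local Notation piE := (@SR_pi K W E).
Local Notation piD := (@SR_pi K V D).
Variables (phi : alg_aut K D -> alg_aut K E) (psi : alg_aut K E -> alg_aut K D).
Hypotheses (phiM : {morph phi : x y / (x * y)%g}) (phiK : cancel phi psi)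
  (psiK : cancel psi phi)
  (phi_ind : is_ind_morphism (aut_ind_variety K D) (aut_ind_variety K E) phi)
  (psi_ind : is_ind_morphism (aut_ind_variety K E) (aut_ind_variety K D) psi).

Let phi1 : phi 1%g = 1%g.
Proof. by apply: (mulgI (phi 1%g)); rewrite -phiM !mulg1. Qed.

Let phiV x : phi x^-1%g = (phi x)^-1%g.
Proof. by apply: (mulgI (phi x)); rewrite -phiM !mulgV. Qed.

Let psiM : {morph psi : x y / (x * y)%g}.
Proof. by move=> x y; apply: (can_inj phiK); rewrite phiM !psiK. Qed.

Definition root_image (omega : 'I_#|W| -> {ffun V -> int}) (g : {ffun W -> int}) :
  {ffun V -> int} := [ffun v => \sum_w omega (enum_rank w) v * g w].

(** After a conjugation the image of the standard torus lies in the standard torus, and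
the isomorphism carries the additive groups normalized by the one to additive
groups normalized by the other. *)
Lemma roots_transported : (#|W| <= #|V|)%N ->
  exists omega : 'I_#|W| -> {ffun V -> int},
    [/\ #|V| = #|W|, row_free (\matrix_i weight_row K (omega i)) &
        forall g, root K E g -> root K D (root_image omega g)].
Proof.
move=> WV; pose tau t := phi (std D t).
have tauM t t' : tau (torus_mul t t') = (tau t * tau t')%g.
  by rewrite /tau stdM phiM.
have tauF : alg_family (@torus_coord K V) tau.
  exact: family_ind_morphism phi_ind (std_family K D).
have tau_inj t : tau t = 1%g -> forall v, tval t v = 1.
  by move=> t1; apply: (@std_inj K V D); rewrite -[std D t]phiK [phi _]t1 -phi1 phiK.
have [omega [f [fw VW ofree]]] := torus_linearization charK tauM tauF tau_inj WV.
exists omega; split=> // g [lambda lF [lD l1 lg]].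
exists (fun s => psi (f * lambda s * f^-1)%g).
  exact: family_ind_morphism psi_ind (family_conj f lF).
pose res t : torus K W := @Torus K W (fun w => character (omega (enum_rank w)) t)
  (fun w => character_neq0 (omega (enum_rank w)) t).
have tauE t : tau t = (f * std E (res t) * f^-1)%g.
  apply: (mulIg f); rewrite mulgVK; apply: alg_aut_ext => i.
  rewrite -[LHS]/(tau t (f _)) fw -[RHS]/(f (std E (res t) _)) stdX linearZ /=.
  by rewrite enum_valK.
split=> [s s'||t s].
- by rewrite -psiM lD !mulgA mulgVK.
- have [s ls] := l1; exists s => e; apply: ls.
  have e' : (f * lambda s * f^-1 = 1)%g by rewrite -[LHS]psiK e phi1.
  by have := congr1 (fun x => f^-1 * x * f)%g e'; rewrite !mulgA mulVg mul1g mulgVK mulg1 mulVg.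
apply: (can_inj phiK); rewrite !phiM phiV !psiK -/(tau t) tauE.
have -> : (f * std E (res t) * f^-1 * (f * lambda s * f^-1) * (f * std E (res t) * f^-1)^-1
  = f * (std E (res t) * lambda s * (std E (res t))^-1) * f^-1)%g.
  by rewrite !invgM invgK !mulgA !mulgVK.
rewrite lg; congr (_ * lambda (_ * _)%R * _)%g.
rewrite /character; under eq_bigr => w _.
  rewrite [tval _ _]/= /character (big_morph (fun x => x ^ g w) (id1 := 1) (op1 := *%R)).
  - under eq_bigr do rewrite exprz_exp.
    over.
  - by move=> x y; rewrite expfzMl.
  - by rewrite exp1rz.
rewrite exchange_big; apply: eq_bigr => v _ /=.
rewrite ffunE (big_morph (fun z => tval t v ^ z) (id1 := 1) (op1 := *%R)) //.
by move=> a b; rewrite expfzDr // tval_neq0.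
Qed.

End Transport.

(** ** Recovering the faces *)

Section Exposing.
Variables (V : finType) (D : complex V).

Lemma exposing_face v S : S \in exposing D v -> v |: S \in faces D.
Proof.
rewrite inE => /andP [SD /andP [_ vcl]]; have [G GD SG] := exists_facet SD.
apply: face_subset (facet_face GD) _; rewrite subUset sub1set SG andbT.
by move/bigcapP: vcl; apply; rewrite inE GD.
Qed.

(** Exposing faces are stable under enlargement within the faces avoiding the vertex, so
an exposed facet is exposed by all its other vertices together. *)
Lemma exposed_facet F : F \in facets D -> exposed D F ->
  exists2 v, v \in F & F :\ v \in exposing D v.
Proof.
move=> FD [v [S]]; rewrite inE => /andP [SD /andP [vS /bigcapP vcl]] SF.
have vF : v \in F by apply: vcl; rewrite inE FD.
exists v => //; rewrite inE !inE eqxx /= (face_subset (facet_face FD)) ?subsetDl //=.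
apply/bigcapP => G; rewrite inE => /andP [GD FG]; apply: vcl; rewrite inE GD.
apply: subset_trans FG; apply/subsetP => w wS; rewrite !inE (subsetP SF) // andbT.
by apply: contraNneq vS => <-.
Qed.

Lemma root_shape_ge chi v : root_shape D chi -> -1 <= chi v.
Proof.
move=> [w [cw cge _]]; have [->|vw] := eqVneq v w; first by rewrite cw.
by apply: le_trans (cge v vw).
Qed.

End Exposing.

Section Combinatorics.
Variables (V W : finType) (D : complex V) (E : complex W).

(** A linear map taking roots to roots has nonnegative values on the directions in
which a family of roots is unbounded. Applied to a root whose positive part is a
large multiple of a facet deprived of an exposing vertex, it gives a root whose
coordinates are nonzero on any transversal of nonzero entries. *)
Lemma roots_to_faces (o : W -> V -> int) (s : W -> V) :
  (forall w, o w (s w) != 0) ->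
  (forall w0 (m : W -> nat), [set w | m w != 0%N] \in exposing E w0 ->
    root_shape D [ffun v => \sum_w o w v * (m w)%:Z - o w0 v]) ->
  fully_exposed E -> forall T, T \in faces E -> s @: T \in faces D.
Proof.
move=> os roots expE T TE; have [F FE TF] := exists_facet TE.
have [w0 w0F] := exposed_facet FE (expE F FE); set S := F :\ w0 => SE.
have opos j v : j \in S -> 0 <= o j v.
  move=> jS; rewrite leNgt; apply/negP => ojv.
  pose B : int := \sum_w o w v * (w \in S : nat)%:Z - o w0 v.
  (* Coordinates of roots are at least -1, which [k] copies of [j] would violate. *)
  pose k := (`|B| + 2)%N.
  have /(root_shape_ge v) : root_shape D [ffun v => \sum_w o w v *
      ((w \in S) + k * (w == j))%:Z - o w0 v].
    apply: (roots w0); rewrite [X in X \in _](_ : _ = S) //; apply/setP => w.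
    rewrite inE; have [->|_] := eqVneq w j; first by rewrite jS.
    by rewrite muln0 addn0; case: (w \in S).
  rewrite ffunE; have -> : \sum_w o w v * ((w \in S) + k * (w == j))%:Z - o w0 v =
      B + k%:Z * o j v.
    under eq_bigr do rewrite PoszD mulrDr; rewrite big_split /= addrAC.
    congr (_ + _); rewrite (bigD1 j) //= eqxx muln1 big1 ?addr0 1?mulrC // => w.
    by move/negPf ->; rewrite muln0 mulr0.
  have : k%:Z * o j v <= k%:Z * -1 by apply: ler_wpM2l => //; lia.
  by rewrite /k; lia.
(* Large enough to outweigh the negative term [o w0] of the root. *)
pose N := (\sum_v `|o w0 v| + 1)%N.
have oN v : `|o w0 v| < N%:Z.
  rewrite /N -abszE ltz_nat addn1 ltnS (bigD1 v) //=.
  exact: leq_addr.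
have [|v' [cv' cge PD]] := roots w0 (fun w => (w \in S) * N)%N.
  rewrite [X in X \in _](_ : _ = S) //; apply/setP => w; rewrite inE.
  by case: (w \in S); rewrite // mul1n /N addn1.
set chi := [ffun _ => _] in cv' cge PD.
pose sig v := \sum_(w in S) o w v.
have chiE v : chi v = N%:Z * sig v - o w0 v.
  rewrite ffunE mulr_sumr [in RHS]big_mkcond; congr (_ - _); apply: eq_bigr => w _.
  by case: (w \in S); rewrite ?mul1n ?mul0n ?mulr0 // mulrC.
have sig_ge0 v : 0 <= sig v by apply: sumr_ge0 => w wS; apply: opos.
have chi_gt0 v : 0 < sig v -> 0 < chi v.
  move=> sv; rewrite chiE; have : N%:Z * 1 <= N%:Z * sig v by apply: ler_wpM2l.
  by have := oN v; lia.
apply: face_subset (exposing_face PD) _; apply/subsetP => _ /imsetP [x xT ->].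
rewrite !inE; have [xS|] := boolP (x \in S).
  apply/orP; right; apply: chi_gt0; rewrite /sig (bigD1 x) //=.
  have ox : 0 < o x (s x) by rewrite lt_neqAle eq_sym os opos.
  apply: lt_le_trans ox _; rewrite lerDl; apply: sumr_ge0 => w /andP [wS _].
  exact: opos.
rewrite !inE (subsetP TF x xT) andbT negbK => /eqP ->.
have [->//|sv] := eqVneq (s w0) v'; rewrite /=.
have := sig_ge0 (s w0); rewrite le_eqVlt => /orP [/eqP s0|/chi_gt0 //].
rewrite lt_neqAle eq_sym cge // andbT chiE -s0 mulr0 sub0r oppr_eq0.
exact: os.
Qed.

(** Both maps on faces are injective, so that the two complexes have as many faces and
either map is onto. *)
Lemma bijection_of_faces (s : W -> V) (s' : V -> W) :
  injective s -> injective s' ->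
  (forall T, T \in faces E -> s @: T \in faces D) ->
  (forall S, S \in faces D -> s' @: S \in faces E) ->
  #|V| = #|W| -> complex_isomorphic D E.
Proof.
move=> si si' sE sD VW; exists s'; first by apply: inj_card_bij; rewrite ?VW.
have imi' := imset_inj si'; have imi := imset_inj si.
have eqX : [set s' @: S | S : {set V} in faces D] = faces E.
  apply/eqP; rewrite eqEcard; apply/andP; split.
    by apply/subsetP => _ /imsetP [S SD ->]; apply: sD.
  rewrite card_imset // -(card_imset (mem (faces E)) imi); apply: subset_leq_card.
  by apply/subsetP => _ /imsetP [T TE ->]; apply: sE.
move=> S; apply/idP/idP; last exact: sD.
by rewrite -{1}eqX => /imsetP [S' S'D /imi' ->].
Qed.

End Combinatorics.

(** ** Relabelling the coordinates *)

Section Varieties.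
Variable K : closedFieldType.

Lemma SR_pointsP (V : finType) (D : complex V) (x : 'rV[K]_#|V|) :
  SR_points D x <-> forall S, S \notin faces D -> \prod_(v in S) x 0 (enum_rank v) = 0.
Proof.
have genE S : (SR_generator K S).@[x 0] = \prod_(v in S) x 0 (enum_rank v).
  by rewrite rmorph_prod; apply: eq_bigr => v _; rewrite /= mevalXU.
split=> [h S SD|h p].
  rewrite -genE; apply: h; apply/SR_idealP => m mD; rewrite SR_generatorE mcoeffX.
  by case: eqP => // e; rewrite -e mnm_supp_set (negPf SD) in mD.
rewrite unfold_in => /asboolP [c ->]; rewrite raddf_sum big1 // => S SD /=.
by rewrite mevalM genE h // mulr0.
Qed.

Definition relabel (V W : finType) (h : W -> V) (x : 'rV[K]_#|V|) : 'rV[K]_#|W| :=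
  \row_j x 0 (enum_rank (h (enum_val j))).

Lemma relabel_morphism (V W : finType) (D : complex V) (E : complex W) (h : W -> V) :
  injective h -> (forall T, T \notin faces E -> h @: T \notin faces D) ->
  is_morphism (SR_variety K D) (SR_variety K E) (relabel h).
Proof.
move=> hi hD; split=> [x /SR_pointsP xD|].
  apply/SR_pointsP => T /hD /xD; rewrite big_imset; last exact: in2W.
  by move=> e; rewrite -[RHS]e; apply: eq_bigr => w _; rewrite mxE enum_rankK.
exists (fun j => 'X_(enum_rank (h (enum_val j)))) => x _ i /=.
by rewrite mxE mevalXU.
Qed.

Lemma variety_of_complex (V W : finType) (D : complex V) (E : complex W) :
  complex_isomorphic D E -> variety_isomorphic (SR_variety K D) (SR_variety K E).
Proof.
move=> [f [g fK gK] fD]; exists (relabel g), (relabel f); split.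
- apply: relabel_morphism => [|T]; first exact: can_inj gK.
  by rewrite -fD -imset_comp (eq_imset _ (g := id)) ?imset_id // => w /=; rewrite gK.
- apply: relabel_morphism => [|S]; first exact: can_inj fK.
  by rewrite fD.
- by move=> x _; apply/rowP => i; rewrite !mxE enum_rankK fK enum_valK.
- by move=> x _; apply/rowP => i; rewrite !mxE enum_rankK gK enum_valK.
Qed.

End Varieties.

(** The weights of the linearized torus form an invertible matrix, which has a
transversal of nonzero entries. *)
Lemma faces_transported (K : closedFieldType) (charK : [pchar K] =i pred0)
    (V W : finType) (D : complex V) (E : complex W)
    (phi : alg_aut K D -> alg_aut K E) (psi : alg_aut K E -> alg_aut K D) :
  {morph phi : x y / (x * y)%g} -> cancel phi psi -> cancel psi phi ->
  is_ind_morphism (aut_ind_variety K D) (aut_ind_variety K E) phi ->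
  is_ind_morphism (aut_ind_variety K E) (aut_ind_variety K D) psi ->
  fully_exposed E -> (#|W| <= #|V|)%N ->
  #|V| = #|W| /\ exists2 s : W -> V, injective s &
    forall T, T \in faces E -> s @: T \in faces D.
Proof.
move=> phiM phiK psiK phi_ind psi_ind expE WV.
have [omega [VW ofree roots]] := roots_transported charK phiM phiK psiK phi_ind psi_ind WV.
split=> //; have [s si sP] := row_free_injection VW ofree.
exists (fun w => enum_val (s (enum_rank w))).
  by move=> w w' /enum_val_inj/si/enum_rank_inj.
apply: (@roots_to_faces _ _ _ _ (fun w v => omega (enum_rank w) v)) => //.
  move=> w; have := sP (enum_rank w); rewrite !mxE.
  by apply: contra => /eqP ->; rewrite mulr0z.
move=> w0 m mE; pose k : 'X_{1..#|W|} := [multinom m (enum_val i) | i < #|W|].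
have kE : mnm_supp k = [set w | m w != 0%N].
  by apply/setP => w; rewrite !inE mnmE enum_rankK.
rewrite -kE in mE; have := root_has_shape charK (roots _ (root_of_exposing K mE)).
set x := root_image _ _; rewrite [X in _ -> root_shape D X](_ : _ = x) //.
apply/ffunP => v; rewrite !ffunE; under [RHS]eq_bigr do rewrite !ffunE mulrBr.
rewrite sumrB; congr (_ - _).
  by apply: eq_bigr => w _; rewrite mnmE enum_rankK.
by rewrite (bigD1 w0) //= eqxx mulr1 big1 ?addr0 // => w /negPf ->; rewrite mulr0.
Qed.

Theorem mainTheorem1 (K : closedFieldType) (charK : [pchar K] =i pred0)
    (V W : finType) (D : complex V) (E : complex W)
    (exposedD : fully_exposed D) (exposedE : fully_exposed E)
    (isoAut : ind_group_isomorphic (aut_ind_group K D) (aut_ind_group K E)) :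
  complex_isomorphic D E /\
  variety_isomorphic (SR_variety K D) (SR_variety K E).
Proof.
have [phi [psi [phiM phiK psiK phi_ind psi_ind]]] := isoAut.
have psiM : {morph psi : x y / (x * y)%g}.
  by move=> x y; apply: (can_inj phiK); rewrite phiM !psiK.
have VW : #|V| = #|W|.
  have [WV|/ltnW VW] := leqP #|W| #|V|.
    by have [] := faces_transported charK phiM phiK psiK phi_ind psi_ind exposedE WV.
  by have [] := faces_transported charK psiM psiK phiK psi_ind phi_ind exposedD VW.
have [] := faces_transported charK phiM phiK psiK phi_ind psi_ind exposedE.
  by rewrite VW.
move=> _ [s si sE].
have [] := faces_transported charK psiM psiK phiK psi_ind phi_ind exposedD.
  by rewrite VW.
move=> _ [s' si' sD].
have iso : complex_isomorphic D E := bijection_of_faces si si' sE sD VW.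
by split=> //; apply: variety_of_complex.
Qed.
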